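(* The group $\mathcal{GT}_1(PSL_3(\mathbb{F}_3))$ is isomorphic to $$C_2^{26}\times D_8^{6}\times S_3^{4}\times S_4^{21}\times S_6^{12}\times S_7^{6}\times S_8^{3}\times S_9^{11}\times A^{3}\times B^{8}\times C^{5},$$ where $A$, $B$, $C$ are groups of the form $$A=(((C_2\times C_2\times C_2\times C_2\times C_2)\rtimes A_6)\rtimes C_2)\rtimes C_2,$$ $$B=((((C_2\times D_8)\rtimes C_2)\rtimes C_3)\rtimes C_2)\rtimes C_2,$$ $$C=((C_2\times C_2\times C_2\times C_2)\rtimes A_5)\rtimes C_2,$$ for suitable actions defining these semidirect products.
   Context: $C_n$ is the cyclic group of order $n$, $D_8$ the dihedral group of order $8$, $S_n$ and $A_n$ the symmetric and alternating groups of degree $n$. For a finite group $G$, let $F_2=\langle x,y\rangle$ be the free group on two generators, and let $N_G$ be the intersection of all normal subgroups $N$ of $F_2$ with $F_2/N\cong G$. Put $\overline{G}=F_2/N_G$, a finite group; the images of $x,y$ in $\overline{G}$ are still denoted $x,y$. There are automorphisms $\theta,\delta$ of $\overline{G}$ with $\theta(x)=y$, $\theta(y)=x$ and $\delta(x)=y^{-1}x^{-1}$, $\delta(y)=y$. The group $\mathcal{GT}_1(G)$ is the image in $\mathrm{Out}(\overline{G})$ of the subgroup of all $\varphi\in\mathrm{Aut}(\overline{G})$ such that (1) $\varphi(x)$ is conjugate to $x$ in $\overline{G}$, and (2) the class of $\varphi$ in $\mathrm{Out}(\overline{G})$ commutes with the classes of $\theta$ and of $\delta$. *)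

(* Defs.v *)
From HB Require Import structures.
From mathcomp Require Import all_boot all_order all_fingroup all_algebra.
From mathcomp Require Import all_solvable.
From mathcomp Require Import boolp.

Set Implicit Arguments.
Unset Strict Implicit.
Unset Printing Implicit Defensive.

Import GroupScope GRing.Theory.
Local Open Scope group_scope.

Section FreeGroup.

Variable I : choiceType.

(* The letter (i, false) stands for the generator i, (i, true) for i^-1. *)
Definition letter := (I * bool)%type.
Implicit Types (a b : letter) (u v w : seq letter).

Definition flip a : letter := (a.1, ~~ a.2).
Definition reduced w := sorted (fun a b => b != flip a) w.

Record free_group := FreeGroup { word :> seq letter; wordP : reduced word }.

HB.instance Definition _ := [isSub for word].
HB.instance Definition _ := [Choice of free_group by <:].

Definition push a w : seq letter :=
  if w is b :: w' then if b == flip a then w' else a :: w else [:: a].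

Definition cat_red u v := foldr push v u.
Definition inv_word u : seq letter := rev (map flip u).

Lemma flipK : involutive flip.
Proof. by case=> i b; rewrite /flip /= negbK. Qed.

Lemma flip_neq a : (a == flip a) = false.
Proof. by case: a => i b; apply/negbTE/eqP => -[]; case: b. Qed.

Lemma reduced_push a w : reduced w -> reduced (push a w).
Proof.
case: w => //= b w rw; case: ifP => [_|/negbT nb] /=; last by rewrite nb.
by case: w rw => //= c w /andP[].
Qed.

Lemma pushK a w : reduced w -> push (flip a) (push a w) = w.
Proof.
case: w => [_|b w] /=; first by rewrite flipK eqxx.
case: (eqVneq b (flip a)) => [-> | _ _] /=; last by rewrite flipK eqxx.
by case: w => //= c w /andP[/negbTE ->].
Qed.

Lemma pushVK a w : reduced w -> push a (push (flip a) w) = w.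
Proof. by move=> rw; rewrite -{1}(flipK a) pushK. Qed.

Lemma reduced_cat u v : reduced v -> reduced (cat_red u v).
Proof. by move=> rv; elim: u => //= a u; apply: reduced_push. Qed.

Lemma push_cat a u v : reduced v ->
  cat_red (push a u) v = push a (cat_red u v).
Proof.
move=> rv; case: u => //= b u; case: (eqVneq b (flip a)) => [-> | //].
by rewrite pushVK // reduced_cat.
Qed.

Lemma cat_redA u v w : reduced w ->
  cat_red (cat_red u v) w = cat_red u (cat_red v w).
Proof. by move=> rw; elim: u => //= a u IHu; rewrite push_cat // IHu. Qed.

Lemma cat_redE u v : reduced (u ++ v) -> cat_red u v = u ++ v.
Proof.
elim: u => //= a u IHu r_auv; rewrite IHu; last exact: path_sorted r_auv.
by case: (u ++ v) r_auv => //= b w /andP[/negbTE ->].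
Qed.

Lemma reduced_inv u : reduced u -> reduced (inv_word u).
Proof.
rewrite /reduced /inv_word rev_sorted sorted_map; apply: sub_sorted => a b /=.
by rewrite flipK => /eqP nb; apply/eqP => /esym.
Qed.

Lemma cat_redV u : cat_red (inv_word u) u = [::].
Proof.
rewrite /cat_red /inv_word; elim: u => //= a u IHu.
by rewrite rev_cons foldr_rcons /= flipK eqxx.
Qed.

Definition fg_one := @FreeGroup [::] isT.
Definition fg_mul x y := FreeGroup (reduced_cat (word x) (wordP y)).
Definition fg_inv x := FreeGroup (reduced_inv (wordP x)).

Lemma fg_mulA : associative fg_mul.
Proof. by move=> x y z; apply: val_inj; rewrite /= cat_redA // wordP. Qed.
Lemma fg_mul1 : left_id fg_one fg_mul.
Proof. by move=> x; apply: val_inj. Qed.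
Lemma fg_mulr1 : right_id fg_one fg_mul.
Proof. by move=> x; apply: val_inj; rewrite /= cat_redE cats0 ?wordP. Qed.
Lemma fg_mulV : left_inverse fg_one fg_inv fg_mul.
Proof. by move=> x; apply: val_inj; rewrite /= cat_redV. Qed.
Lemma fg_mulrV : right_inverse fg_one fg_inv fg_mul.
Proof.
move=> x; apply: val_inj => /=.
rewrite -{1}[word x](mapK flipK) -[map flip (map _ _)]revK -map_rev -/(inv_word _).
by rewrite cat_redV.
Qed.

HB.instance Definition _ :=
  isGroup.Build free_group fg_mulA fg_mul1 fg_mulr1 fg_mulV fg_mulrV.


Definition gen (i : I) := @FreeGroup [:: (i, false)] isT.

Section UniversalProperty.

Variables (H : groupType) (f : I -> H).

Definition eval_letter a : H := if a.2 then (f a.1)^-1 else f a.1.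
Definition eval (x : free_group) : H := \prod_(a <- word x) eval_letter a.

Lemma eval_gen i : eval (gen i) = f i.
Proof. by rewrite /eval big_seq1. Qed.

Lemma eval_flip a : eval_letter (flip a) = (eval_letter a)^-1.
Proof. by case: a => i [] //=; rewrite /eval_letter /= invgK. Qed.

Lemma eval_push a w :
  \prod_(b <- push a w) eval_letter b =
  eval_letter a * \prod_(b <- w) eval_letter b.
Proof.
case: w => [|b w] /=; first by rewrite big_seq1 big_nil mulg1.
case: eqP => [-> | _]; last by rewrite big_cons.
by rewrite big_cons eval_flip mulgA mulgV mul1g.
Qed.

Lemma evalM : {morph eval : x y / x * y}.
Proof.
move=> x y; rewrite /eval /=; elim: (word x) => [|a u IHu] /=.
  by rewrite big_nil mul1g.
by rewrite eval_push IHu big_cons mulgA.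
Qed.

End UniversalProperty.

Lemma hom_eval (H : groupType) (g : free_group -> H) :
  {morph g : x y / x * y} -> g =1 eval (g \o gen).
Proof.
move=> gM; have g1: g 1 = 1 by apply: (@mulgI _ (g 1)); rewrite -gM !mulg1.
have gV x: g x^-1 = (g x)^-1.
  by apply/esym/mulg1_eq; rewrite -gM mulgV.
have gw w (rw : reduced w) :
  g (FreeGroup rw) = \prod_(a <- w) eval_letter (g \o gen) a; last first.
  by case=> w rw; apply: gw.
elim: w => [|a w IHw] in rw *.
  by rewrite big_nil -g1; congr g; apply: val_inj.
have rw': reduced w := path_sorted rw.
have ra: reduced [:: a] by [].
rewrite big_cons -(IHw rw').
have ->: FreeGroup rw = FreeGroup ra * FreeGroup rw'.
  by apply: val_inj; rewrite /= -[RHS]/(cat_red [:: a] w) cat_redE.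
rewrite gM; congr (_ * _); rewrite /eval_letter /=.
by case: a {rw} ra => i [] ra /=; rewrite -?gV; congr g; apply: val_inj.
Qed.

Lemma hom_eq (H : groupType) (f g : free_group -> H) :
  {morph f : x y / x * y} -> {morph g : x y / x * y} ->
  (forall i, f (gen i) = g (gen i)) -> f =1 g.
Proof.
move=> fM gM fg x; rewrite (hom_eval fM) (hom_eval gM).
by apply: eq_bigr => a _; rewrite /eval_letter /= fg.
Qed.

End FreeGroup.

Section QuotientGroup.

Variable F : groupType.

Definition normal_pred (N : {pred F}) :=
  group_closed N /\ forall x y, x \in N -> x ^ y \in N.

Record normal_subgroup :=
  NormalSubgroup { nsub :> {pred F}; nsubP : normal_pred nsub }.

Variable N : normal_subgroup.

Lemma nsub1 : 1 \in nsub N. Proof. by case: (nsubP N) => -[]. Qed.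
Lemma nsubM x y : x \in nsub N -> y \in nsub N -> x * y \in nsub N.
Proof. by case: (nsubP N) => /group_closedM NM _; apply: NM. Qed.
Lemma nsubV x : x \in nsub N -> x^-1 \in nsub N.
Proof. by case: (nsubP N) => /group_closedV NV _; apply: NV. Qed.
Lemma nsubJ x y : x \in nsub N -> x ^ y \in nsub N.
Proof. by case: (nsubP N) => _; apply. Qed.

Definition same_coset : rel F := fun x y => x^-1 * y \in nsub N.

Lemma same_coset_refl : reflexive same_coset.
Proof. by move=> x; rewrite /same_coset mulVg nsub1. Qed.
Lemma same_coset_sym : symmetric same_coset.
Proof.
by move=> x y; apply/idP/idP => /nsubV; rewrite invgM invgK.
Qed.
Lemma same_coset_trans : transitive same_coset.
Proof.
move=> y x z Nxy Nyz; have := nsubM Nxy Nyz.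
by rewrite mulgA -(mulgA _ y) mulgV mulg1.
Qed.

Canonical same_coset_equiv :=
  EquivRel same_coset same_coset_refl same_coset_sym same_coset_trans.

Definition quotient_group := {eq_quot same_coset_equiv}%qT.

HB.instance Definition _ := Choice.on quotient_group.

Definition qproj (x : F) : quotient_group := (\pi x)%qT.
Definition qrepr (q : quotient_group) : F := generic_quotient.repr q.

Lemma qreprK : cancel qrepr qproj. Proof. exact: reprK. Qed.

Lemma qproj_eq x y : (qproj x == qproj y) = (x^-1 * y \in nsub N).
Proof. exact: (eqmodE same_coset_equiv x y). Qed.

Definition q_one := qproj 1.
Definition q_mul p q := qproj (qrepr p * qrepr q).
Definition q_inv p := qproj (qrepr p)^-1.

Lemma q_mulE x y : q_mul (qproj x) (qproj y) = qproj (x * y).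
Proof.
apply/eqP; rewrite qproj_eq invgM.
have Nx: (qrepr (qproj x))^-1 * x \in nsub N by rewrite -qproj_eq qreprK.
have Ny: (qrepr (qproj y))^-1 * y \in nsub N by rewrite -qproj_eq qreprK.
move: (qrepr _) Nx (qrepr _) Ny => x' Nx y' Ny.
have -> : y'^-1 * x'^-1 * (x * y) = (x'^-1 * x) ^ y' * (y'^-1 * y).
  by rewrite /conjg -!mulgA mulVKg.
exact/nsubM/Ny/nsubJ.
Qed.

Lemma q_invE x : q_inv (qproj x) = qproj x^-1.
Proof.
apply/eqP; rewrite qproj_eq invgK.
have Nx: (qrepr (qproj x))^-1 * x \in nsub N by rewrite -qproj_eq qreprK.
move: (qrepr _) Nx => x' Nx; have := nsubJ x^-1 (nsubV Nx).
by rewrite /conjg invgM !invgK !mulgA mulgV mul1g.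
Qed.

Lemma q_mulA : associative q_mul.
Proof.
by move=> p q r; rewrite -[p]qreprK -[q]qreprK -[r]qreprK !q_mulE mulgA.
Qed.
Lemma q_mul1 : left_id q_one q_mul.
Proof. by move=> p; rewrite -[p]qreprK q_mulE mul1g. Qed.
Lemma q_mulr1 : right_id q_one q_mul.
Proof. by move=> p; rewrite -[p]qreprK q_mulE mulg1. Qed.
Lemma q_mulV : left_inverse q_one q_inv q_mul.
Proof. by move=> p; rewrite -[p]qreprK q_invE q_mulE mulVg. Qed.
Lemma q_mulrV : right_inverse q_one q_inv q_mul.
Proof. by move=> p; rewrite -[p]qreprK q_invE q_mulE mulgV. Qed.

HB.instance Definition _ :=
  isGroup.Build quotient_group q_mulA q_mul1 q_mulr1 q_mulV q_mulrV.

Lemma qprojM : {morph qproj : x y / x * y}.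
Proof. by move=> x y; rewrite -q_mulE. Qed.

End QuotientGroup.

Section Homomorphism.

Variables (F H : groupType) (f : F -> H).
Hypothesis fM : {morph f : x y / x * y}.

Lemma hom1 : f 1 = 1.
Proof. by apply: (@mulgI _ (f 1)); rewrite -fM !mulg1. Qed.

Lemma homV x : f x^-1 = (f x)^-1.
Proof. by apply/esym/mulg1_eq; rewrite -fM mulgV hom1. Qed.

End Homomorphism.

Section Kernel.

Variables (F : groupType) (gT : finGroupType) (G : {group gT}).

(* The abstract group H is isomorphic to the finite group G. *)
Definition iso_to (H : groupType) :=
  exists f : H -> gT,
    [/\ {morph f : x y / x * y}, injective f &
        forall g, g \in G <-> exists x, f x = g].

Definition hom_onto (f : F -> gT) :=
  {morph f : x y / x * y} /\ forall g, g \in G <-> exists x, f x = g.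

Lemma ker_normal (f : F -> gT) :
  {morph f : x y / x * y} -> normal_pred [pred x | f x == 1].
Proof.
move=> fM; split=> [|x y].
  split=> [|x y]; rewrite !inE ?(hom1 fM) // => /eqP fx /eqP fy.
  by rewrite fM (homV fM) fx fy mulgV.
rewrite !inE => /eqP fx.
by rewrite /conjg !fM (homV fM) fx mul1g mulVg.
Qed.

Lemma ker_iso (f : F -> gT) (f_onto : hom_onto f) :
  iso_to (quotient_group (NormalSubgroup (ker_normal f_onto.1))).
Proof.
case: f_onto => fM fG /=; set N := NormalSubgroup _.
have fE x : f (qrepr (qproj N x)) = f x.
  have /eqP := qreprK (qproj N x); rewrite qproj_eq inE fM (homV fM).
  by move/eqP/mulg1_eq; rewrite invgK.
exists (f \o @qrepr _ N); split=> [p q | p q /= fpq | g].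
- by rewrite /= -[p]qreprK -[q]qreprK -qprojM !fE fM.
- apply/eqP; rewrite -[p]qreprK -[q]qreprK qproj_eq inE fM (homV fM) fpq.
  by rewrite mulVg.
apply: (iff_trans (fG g)); split=> [[x <-] | [p <-]]; last by exists (qrepr p).
by exists (qproj N x); rewrite /= fE.
Qed.

(* The intersection of all the N <| F with F / N isomorphic to G. *)
Definition in_all_N : {pred F} :=
  [pred x | `[< forall N : normal_subgroup F,
                  iso_to (quotient_group N) -> x \in nsub N >]].

Lemma in_all_NP x :
  reflect (forall f, hom_onto f -> f x = 1) (x \in in_all_N).
Proof.
apply: (iffP (asboolP _)) => [kx f f_onto | kx N [f [fM f_inj fG]]].
  by apply/eqP/(kx _ (ker_iso f_onto)).
have pM: {morph f \o qproj N : x y / x * y} by move=> y z; rewrite /= qprojM fM.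
have p_onto: hom_onto (f \o qproj N).
  split=> // g; apply: (iff_trans (fG g)); split=> [[q <-] | [y <-]]; last by eexists.
  by exists (qrepr q); rewrite /= qreprK.
have := kx _ p_onto; rewrite -(hom1 pM) /= => /f_inj/esym/eqP.
by rewrite qproj_eq invg1 mul1g.
Qed.

Lemma in_all_N_normal : normal_pred in_all_N.
Proof.
split=> [|x y].
  split=> [|x y]; first by apply/in_all_NP => f [/hom1].
  move=> /in_all_NP kx /in_all_NP ky.
  apply/in_all_NP => f f_onto; case: (f_onto) => fM _.
  by rewrite fM (homV fM) kx // ky // mulgV.
move=> /in_all_NP kx; apply/in_all_NP => f f_onto.
by case: (f_onto) => fM _; rewrite /conjg !fM (homV fM) kx // mul1g mulVg.
Qed.

Definition NG := NormalSubgroup in_all_N_normal.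

Lemma NG_stable (a : F -> F) : {morph a : x y / x * y} ->
  (forall y, exists x, a x = y) -> forall x, x \in nsub NG -> a x \in nsub NG.
Proof.
move=> aM a_onto x /in_all_NP kx; apply/in_all_NP => f [fM fG].
apply: (kx (f \o a)); split=> [y z | g]; first by rewrite /= aM fM.
apply: (iff_trans (fG g)); split=> [[y <-] | [y <-]]; last by exists (a y).
by have [z <-] := a_onto y; exists z.
Qed.

End Kernel.

Definition F2 := free_group bool.
HB.instance Definition _ := monoid.Group.on F2.

Definition F2x : F2 := gen false.
Definition F2y : F2 := gen true.

Section Gbar.

Variables (gT : finGroupType) (G : {group gT}).

Definition Gbar := quotient_group (NG F2 G).

HB.instance Definition _ := monoid.Group.on Gbar.

Definition xbar : Gbar := qproj _ F2x.
Definition ybar : Gbar := qproj _ F2y.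

Definition Gbar_code (q : Gbar) : {ffun {ffun bool -> gT} -> gT} :=
  [ffun f : {ffun bool -> gT} => eval f (qrepr q)].

Lemma Gbar_code_inj : injective Gbar_code.
Proof.
move=> p q /ffunP pq; rewrite -[p]qreprK -[q]qreprK.
apply/eqP; rewrite qproj_eq; apply/in_all_NP => f [fM _].
have fE z: f z = eval [ffun b => f (gen b)] z.
  rewrite (hom_eval fM); apply: eq_bigr => a _.
  by rewrite /eval_letter /= ffunE.
have := pq [ffun b => f (gen b)]; rewrite !ffunE -!fE fM (homV fM) => ->.
by rewrite mulVg.
Qed.

Definition Gbar_decode c : option Gbar :=
  if pselect (exists q, Gbar_code q = c) is left ex_q
  then Some (sval (cid ex_q)) else None.

Lemma Gbar_codeK : pcancel Gbar_code Gbar_decode.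
Proof.
move=> q; rewrite /Gbar_decode; case: pselect => [ex_q|[]]; last by exists q.
by case: cid => p /= /Gbar_code_inj ->.
Qed.

HB.instance Definition _ := PCanIsCountable Gbar_codeK.
HB.instance Definition _ : isFinite Gbar := PCanIsFinite Gbar_codeK.

Lemma Gbar_hom_eq (H : groupType) (f g : Gbar -> H) :
  {morph f : p q / p * q} -> {morph g : p q / p * q} ->
  f xbar = g xbar -> f ybar = g ybar -> f =1 g.
Proof.
move=> fM gM fgx fgy q; rewrite -[q]qreprK.
have pM (h : Gbar -> H) : {morph h : p q / p * q} ->
    {morph h \o @qproj _ (NG F2 G) : p q / p * q}.
  by move=> hM u v; rewrite /= qprojM hM.
rewrite -[LHS]/((f \o qproj _) _) -[RHS]/((g \o qproj _) _).
by apply: hom_eq; [apply: pM.. | case].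
Qed.

Lemma induced_aut (a : F2 -> F2) : {morph a : u v / u * v} ->
  (forall v, exists u, a u = v) ->
  exists2 t, t \in Aut [set: Gbar] & forall u, t (qproj _ u) = qproj _ (a u).
Proof.
move=> aM a_onto; pose t (q : Gbar) : Gbar := qproj _ (a (qrepr q)).
have tE u : t (qproj _ u) = qproj _ (a u).
  apply/eqP; rewrite qproj_eq -(homV aM) -aM; apply: NG_stable => //.
  by rewrite -qproj_eq qreprK.
have tM : {morph t : p q / p * q}.
  by move=> p q; rewrite -[p]qreprK -[q]qreprK -qprojM !tE aM qprojM.
have t_onto p : exists q, t q = p.
  have [u au] := a_onto (qrepr p); exists (qproj _ u).
  by rewrite tE au qreprK.
have t_inj : injective t.
  have /image_injP : #|image t predT| == #|(predT : {pred Gbar})|.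
    apply/eqP/eq_card => p; rewrite inE; apply/imageP.
    by have [q <-] := t_onto p; exists q.
  by move=> inj_t p q; apply: inj_t.
exists (perm t_inj); last by move=> u; rewrite permE tE.
rewrite inE; apply/andP; split; first by apply/subsetP => q; rewrite inE.
by apply/morphicP => p q _ _; rewrite !permE tM.
Qed.

Definition theta_word : F2 -> F2 := eval (fun b : bool => if b then F2x else F2y).
Definition delta_word : F2 -> F2 :=
  eval (fun b : bool => if b then F2y else F2y^-1 * F2x^-1).

Lemma theta_exists : exists t : {perm Gbar},
  [&& t \in Aut [set: Gbar], t xbar == ybar & t ybar == xbar].
Proof.
have thM := @evalM _ _ (fun b : bool => if b then F2x else F2y).
have thK u : theta_word (theta_word u) = u.
  apply: (hom_eq (f := theta_word \o theta_word) (g := id)) => // [v w | i].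
    by rewrite /= /theta_word !thM.
  by case: i; rewrite /= /theta_word !eval_gen.
have [t At tE] := induced_aut thM (fun u => ex_intro _ _ (thK u)).
by exists t; rewrite At !tE !eval_gen !eqxx.
Qed.

Lemma delta_exists : exists t : {perm Gbar},
  [&& t \in Aut [set: Gbar], t xbar == ybar^-1 * xbar^-1 & t ybar == ybar].
Proof.
set d := fun b : bool => if b then F2y else F2y^-1 * F2x^-1.
have dM := @evalM _ _ d; have dV u := homV dM u.
pose e := eval (fun b : bool => if b then F2y else F2x^-1 * F2y^-1).
have eM : {morph e : u v / u * v} by apply: evalM.
have deK u : eval d (e u) = u.
  apply: (hom_eq (f := eval d \o e) (g := id)) => // [v w | i].
    by rewrite /= eM dM.
  case: i; rewrite /= /e !eval_gen // dM !dV !eval_gen /d.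
  by rewrite invgM !invgK mulgK.
have [t At tE] := induced_aut dM (fun u => ex_intro _ _ (deK u)).
exists t; rewrite At !tE !eval_gen eqxx andbT /= /d qprojM.
by rewrite !(homV (@qprojM _ _)).
Qed.

Definition theta : {perm Gbar} := xchoose theta_exists.
Definition delta : {perm Gbar} := xchoose delta_exists.

Lemma thetaP :
  [/\ theta \in Aut [set: Gbar], theta xbar = ybar & theta ybar = xbar].
Proof. by have /and3P[? /eqP ? /eqP ?] := xchooseP theta_exists. Qed.

Lemma deltaP :
  [/\ delta \in Aut [set: Gbar], delta xbar = ybar^-1 * xbar^-1 &
      delta ybar = ybar].
Proof. by have /and3P[? /eqP ? /eqP ?] := xchooseP delta_exists. Qed.

Definition Inn : {group {perm Gbar}} :=
  (conj_aut [set: Gbar] @* [set: Gbar])%G.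

Lemma Inn_normal : Inn <| Aut [set: Gbar].
Proof.
apply/andP; split; first exact: Aut_conj_aut.
apply/subsetP => t At; rewrite inE; apply/subsetP => _ /imsetP[s Inn_s ->].
have /morphimP[g _ _ ->] := Inn_s.
have -> : conj_aut [set: Gbar] g ^ t = conj_aut [set: Gbar] (t g).
  have tM : {morph t : p q / p * q}.
    by move=> p q; have /morphicP-> := Aut_morphic At; rewrite ?inE.
  apply/permP => p.
  rewrite /conjg !permM conj_autE ?inE // conj_autE ?inE // /conjg.
  by rewrite !tM permKV (homV tM).
apply: mem_morphim; last by rewrite inE.
by apply: (subsetP (normG _)); rewrite inE.
Qed.

Definition Out := (Aut [set: Gbar] / Inn).

(* Aut(Gbar) normalises Inn, so [coset Inn phi] is the class of phi in Out. *)
Definition GT1_aut : {set {perm Gbar}} :=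
  [set phi in Aut [set: Gbar] |
     [&& phi xbar \in xbar ^: [set: Gbar],
         coset Inn phi \in 'C[coset Inn theta] &
         coset Inn phi \in 'C[coset Inn delta]]].

Lemma GT1_aut_group_set : group_set GT1_aut.
Proof.
have nInn := subsetP (normal_norm Inn_normal).
apply/group_setP; split=> [|s t].
  apply/setIdP; split; first exact: group1.
  by rewrite morph1 !group1 perm1 class_refl.
move=> /setIdP[As /and3P[sx sth sde]] /setIdP[At /and3P[tx tth tde]].
apply/setIdP; split; first exact: groupM.
rewrite morphM ?nInn //; apply/and3P; split; [| exact: groupM..].
have tM : {morph t : p q / p * q}.
  by move=> p q; have /morphicP-> := Aut_morphic At; rewrite ?inE.
have /imsetP[g _ sxE] := sx; have /imsetP[h _ txE] := tx.
rewrite permM sxE /conjg !tM (homV tM) txE -/(conjg _ _) -conjgM.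
by apply: memJ_class; rewrite inE.
Qed.

Canonical GT1_aut_group := Group GT1_aut_group_set.

Definition GT1 : {group coset_of Inn} := (GT1_aut / Inn)%G.

Lemma GT1_sub_Out : GT1 \subset Out.
Proof. by apply/quotientS/subsetP => phi /setIdP[]. Qed.

End Gbar.

Section ProjectiveSpecialLinear.

Variables (n : nat) (F : finFieldType).

Definition SLset : {set {'GL_n[F]}} := [set g : {'GL_n[F]} | (\det g == 1)%R].

Lemma SL_group_set : group_set SLset.
Proof.
apply/group_setP; split=> [|g h]; first by rewrite inE GL_1E det1.
by rewrite !inE GL_MxE det_mulmx => /eqP-> /eqP->; rewrite mulr1.
Qed.

Definition SL : {group {'GL_n[F]}} := Group SL_group_set.

Definition PSL : {group coset_of 'Z(SL)} := (SL / 'Z(SL))%G.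

End ProjectiveSpecialLinear.

Notation "A \X B" := (setX_group A B)
  (at level 40, left associativity) : Group_scope.
Notation "A ^X n" := (setXn_group (fun _ : 'I_n => A))
  (at level 30, right associativity) : Group_scope.

(* 'Z_n is the ring Z/nZ only for n >= 2. *)
Definition Cyc n : {group 'Z_n} := [set: 'Z_n]%G.

(* Groups "of the form (..(H1 ><| H2) ><| ..) ><| Hn" for some actions: the
   factors are prescribed up to isomorphism. *)
Definition form := forall gT : finGroupType, {group gT} -> Prop.

Definition form_of (hT : finGroupType) (H : {group hT}) : form :=
  fun gT K => K \isog H.

Definition form_sdprod (P : form) (hT : finGroupType) (H : {group hT}) : form :=
  fun gT G => exists K L : {group gT}, [/\ K ><| L = G, P gT K & L \isog H].

Arguments form_of {hT} H gT K.
Arguments form_sdprod P {hT} H gT G.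

(* Main.v *)
From HB Require Import structures.
Require Import Defs.
From mathcomp Require Import all_boot all_order all_fingroup all_algebra.
From mathcomp Require Import all_solvable.
From mathcomp Require Import boolp ring zify.
Import Defs.
Set Implicit Arguments.
Unset Strict Implicit.
Unset Printing Implicit Defensive.
Import GroupScope.

(* Let G = PSL_3(F_3) = SL_3(F_3).  An element of Gbar is known by its values at
   the generating pairs of G.  As G is simple and nonabelian, values at pairs that
   are not in the same Aut(G)-orbit are independent (Hall), and Aut(G) is generated
   by the inner automorphisms and by the inverse transpose tau.  Hence Out(Gbar) is
   the group of all permutations of the set Y of G-classes of generating pairs that
   commute with tau, and GT_1(G) consists of those that also commute with theta and
   delta and preserve the conjugacy class of the first component.  On Y the group
   W = <theta, delta, tau> acts through S_3 x C_2.  Cut Y into blocks of points with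
   the same stabiliser in W and the same classes of x, y and xy: such a block of m
   points, up to its W-translates, contributes a factor S_m when distinct points
   lie in distinct W-orbits, and C_2 wr S_(m/2) when a W-orbit meets it in two
   points.  The number of factors of each kind comes from an enumeration of the 603
   classes of generating pairs whose triple of labels is least in its W-orbit.
   Finally C_2 wr S_m is C_2, D_8, C_2 x S_4, B, C_2 x C, A for m = 1, ..., 6. *)

(** No list of subgroups of [G] is used. Any element of the class labelled [L13] and any involution
    generate [G]; after normalising the pair, this is a closure computation for a few involutions.
    So a pair generates as soon as words in it reach these two classes, and the same criterion
    applied to products of conjugates shows that [G] is simple. Non-generation is certified by a
    common eigenvector, of the pair or of its inverse transpose, or by a small closed set.

    The group Aut(G) is not constructed. What is used is that generating pairs with the same
    relations are conjugate up to [tau]. This comes from one rigid pair [P0]: among the enumerated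
    classes, the truth values of eight relations leave only [P0] and its image under [tau], and
    words carry the conclusion to any pair.

    Restricting to minimal triples of labels leaves an ambiguity: several points of a W-orbit may
    share the minimal triple, with conjugate but distinct stabilisers, so that blocks with different
    keys could be W-translates of each other. The test [sel] excludes this. *)

Local Open Scope group_scope.

(** * Automorphisms of Gbar as permutations of classes of generating pairs *)

Section Words.
Variable gT : finGroupType.
Implicit Types (p q : gT * gT) (u v w : F2).

Definition ev p : F2 -> gT := eval (fun b : bool => if b then p.2 else p.1).
Definition conjp p (g : gT) := (p.1 ^ g, p.2 ^ g).
Definition genp (G : {set gT}) p := <<[set p.1; p.2]>> == G.
Definition samerel p q := forall u, ev p u = 1 <-> ev q u = 1.
Definition subst u v : F2 -> F2 := eval (fun b : bool => if b then v else u).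

Lemma evM p : {morph ev p : u v / u * v}. Proof. exact: evalM. Qed.
Lemma ev1 p : ev p 1 = 1. Proof. exact: hom1 (evM p). Qed.
Lemma evV p u : ev p u^-1 = (ev p u)^-1. Proof. exact: (homV (evM p)). Qed.
Lemma evx p : ev p F2x = p.1. Proof. exact: eval_gen. Qed.
Lemma evy p : ev p F2y = p.2. Proof. exact: eval_gen. Qed.

Lemma ev_eq p (f : F2 -> gT) : {morph f : u v / u * v} ->
  f F2x = p.1 -> f F2y = p.2 -> f =1 ev p.
Proof.
move=> fM fx fy; apply: hom_eq => //; first exact: evM.
by case; rewrite -/F2x -/F2y ?fx ?fy ?evx ?evy.
Qed.

Lemma ev_conj p g u : ev (conjp p g) u = ev p u ^ g.
Proof.
apply/esym; move: u; apply: (ev_eq (f := fun u => ev p u ^ g)) => [u v||].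
- by rewrite evM conjMg.
- by rewrite evx.
by rewrite evy.
Qed.

Lemma ev_subst p u v w : ev p (subst u v w) = ev (ev p u, ev p v) w.
Proof.
move: w; apply: (ev_eq (f := fun w => ev p (subst u v w))) => [w w'||].
- by rewrite /subst evalM evM.
- by rewrite /subst eval_gen.
by rewrite /subst eval_gen.
Qed.

Lemma evJ p u v : ev p (u ^ v) = ev p u ^ ev p v.
Proof. by rewrite /conjg !evM evV. Qed.

Lemma evR p u v : ev p [~ u, v] = [~ ev p u, ev p v].
Proof. by rewrite /commg evM evV evJ. Qed.

Section Generating.
Variable G : {group gT}.

Lemma ev_gen p u : genp G p -> ev p u \in G.
Proof.
move=> /eqP<-; rewrite /ev /eval; apply: group_prod => -[b [|]] _ /=.
  by rewrite groupV mem_gen //; case: b; rewrite !inE eqxx ?orbT.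
by rewrite mem_gen //; case: b; rewrite !inE eqxx ?orbT.
Qed.

Lemma genpP p : reflect (forall g, g \in G <-> exists u, ev p u = g) (genp G p).
Proof.
pose H := [set g | `[<exists u, ev p u = g>]].
have HP g : reflect (exists u, ev p u = g) (g \in H) by rewrite inE; apply: asboolP.
have gH : group_set H.
  apply/group_setP; split=> [|_ _ /HP[u <-] /HP[v <-]]; apply/HP.
    by exists 1; rewrite ev1.
  by exists (u * v); rewrite evM.
have defH : <<[set p.1; p.2]>> = H.
  apply/eqP; rewrite eqEsubset -[H]/(gval (Group gH)) gen_subG; apply/andP; split.
    by apply/subsetP => _ /set2P[]->; apply/HP; [exists F2x | exists F2y]; rewrite ?evx ?evy.
  by apply/subsetP => _ /HP[u <-]; apply/group_prod => -[[] []] _ /=;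
     rewrite /eval_letter /= ?groupV mem_gen // !inE eqxx ?orbT.
rewrite /genp defH; apply: (iffP eqP) => [<- g | GP]; first by split=> /HP.
by apply/setP => g; apply/HP/idP; rewrite (GP g).
Qed.

Lemma genp_mem p : genp G p -> p.1 \in G /\ p.2 \in G.
Proof. by move=> gp; rewrite -{1}evx -evy !ev_gen. Qed.

Lemma genp_conj p g : g \in G -> genp G p -> genp G (conjp p g).
Proof.
move=> Gg /eqP gp; apply/eqP; rewrite -(conjGid Gg) -gp -genJ; congr <<_>>.
by rewrite conjUg !conjg_set1.
Qed.

Lemma genp_hom p : genp G p <-> hom_onto G (ev p).
Proof.
split=> [/genpP gp | [_ gp]]; last exact/genpP.
by split; [apply: evM | ].
Qed.
End Generating.
End Words.

Section Permutations.
Variables (Y : finType) (T : eqType) (tth tde tta : Y -> Y) (lab : Y -> T).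

Definition symset := [set s : {perm Y} | [forall y, [&& s (tth y) == tth (s y),
   s (tde y) == tde (s y), s (tta y) == tta (s y) & lab (s y) == lab y]]].

Lemma symsetP (s : {perm Y}) : reflect (forall y, [/\ s (tth y) = tth (s y),
   s (tde y) = tde (s y), s (tta y) = tta (s y) & lab (s y) = lab y]) (s \in symset).
Proof.
rewrite inE; apply: (iffP forallP) => sP y.
  by have /and4P[/eqP ? /eqP ? /eqP ? /eqP ?] := sP y.
by have [-> -> -> ->] := sP y; rewrite !eqxx.
Qed.

Lemma symset_group : group_set symset.
Proof.
apply/group_setP; split=> [|s t /symsetP sP /symsetP tP].
  by apply/symsetP => y; rewrite !perm1.
apply/symsetP => y; rewrite !permM.
by have [-> -> -> <-] := sP y; have [-> -> -> ->] := tP (s y).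
Qed.
Canonical symgroup := Group symset_group.
End Permutations.

Section GT1Perm.
Variables (gT : finGroupType) (G : {group gT}).
Hypotheses (simpleG : simple G) (nabG : ~~ abelian G).
Variable tau : gT -> gT.
Hypotheses (tauM : {in G &, {morph tau : x y / x * y}})
  (tauG : forall x, x \in G -> tau x \in G) (tauK : {in G, involutive tau}).
Definition taup (p : gT * gT) := (tau p.1, tau p.2).
(** Generating pairs have the same relations exactly when an automorphism of [G] carries one to the
    other; so this expresses that Aut(G) is generated by the inner automorphisms and [tau]. *)
Hypothesis relH : forall p q, genp G p -> genp G q -> samerel p q ->
  exists2 g, g \in G & q = conjp p g \/ q = conjp (taup p) g.
Variables (Y : finType) (T : eqType) (cl : gT * gT -> Y) (lab : Y -> T)
  (tth tde tta : Y -> Y).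
Hypotheses
  (clP : forall p q, genp G p -> genp G q ->
     (cl p = cl q <-> exists2 g, g \in G & q = conjp p g))
  (cl_onto : forall y, exists2 p, genp G p & cl p = y)
  (tthE : forall p, genp G p -> tth (cl p) = cl (p.2, p.1))
  (tdeE : forall p, genp G p -> tde (cl p) = cl (p.2^-1 * p.1^-1, p.2))
  (ttaE : forall p, genp G p -> tta (cl p) = cl (taup p))
  (labP : forall p q, genp G p -> genp G q ->
     (lab (cl p) = lab (cl q) <-> q.1 \in p.1 ^: G)).

Notation genp := (genp G).
Implicit Types (p k : gT * gT) (u v : F2).

Lemma simpleG1 : G :!=: 1. Proof. by have [] := simpleP _ simpleG. Qed.

Lemma perfectG : G^`(1) = G.
Proof.
have [_ sG] := simpleP _ simpleG.
case: (sG _ (der_normal 1 G)) => // /derG1P abG.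
by case/negP: nabG.
Qed.

(** The image under [ev p] of the kernel of [ev q] is normal in the simple group [G]. *)
Lemma image_normal p q : genp p -> genp q ->
  (forall u, ev q u = 1 -> ev p u = 1) \/
  (forall c, c \in G -> exists2 u, ev p u = c & ev q u = 1).
Proof.
have [_ sG] := simpleP _ simpleG.
move=> gp gq; pose H := [set c | `[<exists2 u, ev p u = c & ev q u = 1>]].
have HP c : reflect (exists2 u, ev p u = c & ev q u = 1) (c \in H).
  by rewrite inE; apply: asboolP.
have gH : group_set H.
  apply/group_setP; split=> [|_ _ /HP[u <- qu] /HP[v <- qv]]; apply/HP.
    by exists 1; rewrite ev1.
  by exists (u * v); rewrite evM // qu qv mulg1.
have nH : Group gH <| G.
  apply/andP; split; first by apply/subsetP => _ /HP[u <- _]; apply: ev_gen.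
  apply/subsetP => g /(genpP _ _ gp)[v <-]; rewrite inE.
  apply/subsetP => _ /imsetP[_ /HP[u <- qu] ->]; apply/HP.
  by exists (u ^ v); rewrite evJ // qu conj1g.
case: (sG _ nH) => [/setP H1 | /setP HG]; [left=> u qu | right=> c].
  by have /esym := H1 (ev p u); rewrite (introT (HP _)) ?inE => [/eqP|]; last by exists u.
by rewrite -HG => /HP.
Qed.

(** Otherwise the kernel of [ev p] lies in that of [ev k]. If the converse inclusion failed, the
    kernel of [ev k] would map onto [G] under [ev p]; every word would then agree at [p] with a
    relation of [k], hence be a relation of [k] itself, and [G] would be trivial. *)
Lemma image_all k p : genp k -> genp p -> ~ samerel p k ->
  forall c, c \in G -> exists2 u, ev k u = c & ev p u = 1.
Proof.
move=> gk gp nkp; case: (image_normal gk gp) => // pk; case: nkp => u.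
split; first exact: pk.
case: (image_normal gp gk) => [kp | all_p]; first exact: kp.
case/eqP: simpleG1; apply/trivgP/subsetP => _ /(genpP _ _ gk)[v <-].
have [w pw kw] := all_p _ (ev_gen v gp).
rewrite inE -[v](mulKVg w) evM kw mul1g; apply/eqP/pk.
by rewrite evM evV pw mulVg.
Qed.

(* Commutators of preimages: since [G] is perfect, the pairs of a list can be killed one at a time. *)
Lemma hall_seq k (s : seq (gT * gT)) : genp k -> {in s, forall p, genp p /\ ~ samerel p k} ->
  forall c, c \in G -> exists2 u, ev k u = c & {in s, forall p, ev p u = 1}.
Proof.
move=> gk; elim: s => [_ c /(genpP _ _ gk)[u <-]|p s IHs sP]; first by exists u.
have {}IHs := IHs (fun q sq => sP q (mem_behead (s := p :: s) sq)).
have [gp npk] := sP p (mem_head _ _).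
pose P u := {in p :: s, forall p, ev p u = 1}.
pose H := [set c | `[<exists2 u, ev k u = c & P u>]].
have HP c : reflect (exists2 u, ev k u = c & P u) (c \in H).
  by rewrite inE; apply: asboolP.
have gH : group_set H.
  apply/group_setP; split=> [|_ _ /HP[u <- Pu] /HP[v <- Pv]]; apply/HP.
    by exists 1; rewrite ?ev1 // => q _; rewrite ev1.
  by exists (u * v) => [|q sq]; rewrite evM // Pu // Pv // mulg1.
suff sGH: G \subset Group gH by move=> c /(subsetP sGH)/HP.
rewrite -{1}perfectG gen_subG; apply/subsetP => _ /imset2P[c d Gc Gd ->].
have [u <- su] := IHs c Gc; have [v <- pv] := image_all gk gp npk Gd.
apply/HP; exists [~ u, v]; rewrite ?evR // => q; rewrite inE => /predU1P[->|sq].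
  by rewrite evR pv commg1.
by rewrite evR su // comm1g.
Qed.

Lemma ev_tau p u : genp p -> ev (taup p) u = tau (ev p u).
Proof.
move=> gp; apply/esym; move: u.
apply: (ev_eq (f := fun u => tau (ev p u))) => [u v||].
- by rewrite evM tauM ?ev_gen.
- by rewrite evx.
by rewrite evy.
Qed.

Lemma genp_tau p : genp p -> genp (taup p).
Proof.
move=> gp; apply/genpP => g; split=> [Gg | [u <-]].
  have /(genpP _ _ gp)[u pu] := tauG Gg.
  by exists u; rewrite ev_tau // pu tauK.
by rewrite ev_tau // tauG ?ev_gen.
Qed.

Lemma taupK p : genp p -> taup (taup p) = p.
Proof. by case: p => a b /genp_mem[/= Ga Gb]; rewrite /taup /= !tauK. Qed.

Definition pr y : gT * gT := s2val (cid2 (cl_onto y)).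
Lemma pr_gen y : genp (pr y). Proof. exact: s2valP (cid2 (cl_onto y)). Qed.
Lemma prK y : cl (pr y) = y. Proof. exact: s2valP' (cid2 (cl_onto y)). Qed.
Hint Resolve pr_gen : core.

Lemma ttaK : involutive tta.
Proof. by move=> y; rewrite -(prK y) !ttaE ?genp_tau // taupK. Qed.

(** The values of a word at [y] and at [tta y] determine each other through [tau], so only one point
    of each such pair can receive a free value. *)
Definition rep y := if enum_rank y <= enum_rank (tta y) then y else tta y.

Lemma rep_tta y : rep (tta y) = rep y.
Proof.
rewrite /rep ttaK; case: ltngtP => // /val_inj /enum_rank_inj //.
Qed.

Lemma repP y : rep y = y \/ rep y = tta y.
Proof. by rewrite /rep; case: ifP; [left | right]. Qed.

Lemma rep_id y : rep (rep y) = rep y.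
Proof. by case: (repP y) => E; rewrite [in LHS]E ?rep_tta. Qed.

Lemma samerel_rep y z : rep y = y -> rep z = z -> samerel (pr y) (pr z) -> y = z.
Proof.
move=> ry rz /relH[]// g Gg [] Ez.
  by rewrite -(prK z) -(prK y); apply/(clP (pr_gen y) (pr_gen z)); exists g.
have: tta y = z.
  rewrite -(prK y) ttaE // -(prK z); apply/clP; rewrite ?genp_tau //.
  by exists g.
by move=> tyz; rewrite -rz -tyz rep_tta.
Qed.

(** Distinct representatives have different relations. A word that is right at the earlier points is
    therefore corrected at [y] by a factor that is trivial at all of them. *)
Lemma hall_reps (s : seq Y) (f : Y -> gT) : uniq s ->
  {in s, forall y, rep y = y} -> (forall y, f y \in G) ->
  exists u, {in s, forall y, ev (pr y) u = f y}.
Proof.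
move=> + + Gf; elim: s => [|y s IHs] /=; first by exists 1.
move=> /andP[s'y us] rs; have ry := rs y (mem_head _ _).
have {}rs : {in s, forall z, rep z = z}.
  by move=> z sz; apply: rs; rewrite inE sz orbT.
have [u su] := IHs us rs.
have [|v yv sv] := @hall_seq (pr y) (map pr s) (pr_gen y) _
   (f y * (ev (pr y) u)^-1) (groupM (Gf y) (groupVr (ev_gen u (pr_gen y)))).
  move=> q /mapP[z sz ->]; split=> // /samerel_rep zy.
  by move: s'y; rewrite -(zy (rs z sz) ry) sz.
exists (v * u) => z; rewrite inE => /predU1P[->|sz]; rewrite evM.
  by rewrite yv mulgKV.
by rewrite sv ?map_f // mul1g su.
Qed.

Lemma hall (f : Y -> gT) : (forall y, f y \in G) ->
  exists u, forall y, rep y = y -> ev (pr y) u = f y.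
Proof.
move=> Gf; have [||u uP] := @hall_reps [seq y <- enum Y | rep y == y] f _ _ Gf.
- by rewrite filter_uniq ?enum_uniq.
- by move=> y; rewrite mem_filter => /andP[/eqP].
exists u => y ry; apply: uP; by rewrite mem_filter ry eqxx mem_enum.
Qed.

(** Properties compatible with conjugation and [tau] spread from the representatives, where values
    can be prescribed, to all generating pairs. *)
Lemma rep_ind (P : gT * gT -> Prop) :
  (forall p g, genp p -> g \in G -> P p -> P (conjp p g)) ->
  (forall p, genp p -> P p -> P (taup p)) ->
  (forall y, rep y = y -> P (pr y)) -> forall p, genp p -> P p.
Proof.
move=> Pconj Ptau Prep p gp; have: P (pr (rep (cl p))) by apply/Prep/rep_id.
set r := pr _ => Pr; have gr : genp r by exact: pr_gen.
case: (repP (cl p)) => E.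
  have [|g Gg ->] := iffLR (clP gr gp); first by rewrite prK.
  exact: Pconj.
have gtr := genp_tau gr.
have [|g Gg ->] := iffLR (clP gtr gp); first by rewrite -ttaE // prK E ttaK.
by apply: Pconj => //; apply: Ptau.
Qed.

Local Notation Gb := (Gbar G).
(** The value of an element of [Gbar] at a pair. For a generating pair the lift does not matter,
    since the kernel of [ev p] is one of the subgroups whose intersection is N_G. *)
Definition h p (q : Gb) : gT := ev p (qrepr q).

Lemma hE p u : genp p -> h p (qproj _ u) = ev p u.
Proof.
move=> gp; have /eqP := qreprK (qproj (NG Defs.F2 G) u).
rewrite qproj_eq => /in_all_NP/(_ _ (iffLR (genp_hom _ _) gp)).
by rewrite evM evV => /mulg1_eq; rewrite invgK.
Qed.

Lemma hM p : genp p -> {morph h p : q r / q * r}.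
Proof. by move=> gp q r; rewrite -[q]qreprK -[r]qreprK -qprojM !hE // evM. Qed.
Lemma hV p (q : Gb) : genp p -> h p q^-1 = (h p q)^-1.
Proof. by move=> gp; apply: (homV (hM gp)). Qed.
Lemma hJ p (q r : Gb) : genp p -> h p (q ^ r) = h p q ^ h p r.
Proof. by move=> gp; rewrite /conjg !hM // hV. Qed.

(** Every homomorphism of the free group onto [G] is evaluation at a generating pair, so these
    evaluations separate the points of [Gbar]. *)
Lemma h_inj (q r : Gb) : (forall p, genp p -> h p q = h p r) -> q = r.
Proof.
move=> hqr; apply/eqP; rewrite -[q]qreprK -[r]qreprK qproj_eq.
apply/in_all_NP => f [fM fG].
have fE : f =1 ev (f F2x, f F2y) by apply: ev_eq.
have gf : genp (f F2x, f F2y).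
  by apply/genp_hom; split=> [|g]; [apply: evM | rewrite fG; split=> -[u <-]; exists u].
by rewrite fE evM evV -!/(h _ _) hqr // mulVg.
Qed.

Lemma h_gen p (q : Gb) : genp p -> h p q \in G. Proof. exact: ev_gen. Qed.
Lemma h_x p : genp p -> h p (xbar G) = p.1. Proof. by move=> gp; rewrite hE // evx. Qed.
Lemma h_y p : genp p -> h p (ybar G) = p.2. Proof. by move=> gp; rewrite hE // evy. Qed.

Lemma h_conj p g (q : Gb) : genp p -> g \in G -> h (conjp p g) q = h p q ^ g.
Proof. by move=> gp Gg; rewrite /h ev_conj. Qed.
Lemma h_tau p (q : Gb) : genp p -> h (taup p) q = tau (h p q).
Proof. by move=> gp; rewrite /h ev_tau. Qed.

Lemma autM (s : {perm Gb}) : s \in Aut [set: Gb] -> {morph s : q r / q * r}.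
Proof. by move=> As q r; have /morphicP-> := Aut_morphic As; rewrite ?inE. Qed.

Lemma hom_genp (f : Gb -> gT) : {morph f : q r / q * r} ->
  (forall g, g \in G -> exists q : Gb, f q = g) -> (forall q, f q \in G) ->
  genp (f (xbar G), f (ybar G)).
Proof.
move=> fM f_onto Gf; apply/genp_hom.
have fE u : f (qproj _ u) = ev (f (xbar G), f (ybar G)) u.
  by apply: (ev_eq (f := f \o qproj _)) => // v w; rewrite /= qprojM fM.
split=> [|g]; first exact: evM.
split=> [/f_onto[q <-] | [u <-]]; last by rewrite -fE.
by exists (qrepr q); rewrite -fE qreprK.
Qed.

Definition act p (s : {perm Gb}) := (h p (s (xbar G)), h p (s (ybar G))).

Lemma act_gen p s : genp p -> s \in Aut [set: Gb] -> genp (act p s).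
Proof.
move=> gp As; apply: (@hom_genp (fun q => h p (s q))) => [q r|g Gg|q].
- by rewrite (autM As) hM.
- have /(genpP _ _ gp)[u <-] := Gg.
  by exists (s^-1 (qproj _ u)); rewrite permKV hE.
exact: h_gen.
Qed.

Lemma act_h p s (q : Gb) : genp p -> s \in Aut [set: Gb] -> h (act p s) q = h p (s q).
Proof.
move=> gp As; have ga := act_gen gp As.
apply: (Gbar_hom_eq (f := h (act p s)) (g := fun q => h p (s q))).
- exact: hM.
- by move=> r t; rewrite (autM As) hM.
- by rewrite h_x.
by rewrite h_y.
Qed.

Lemma act1 p : genp p -> act p 1 = p.
Proof. by case: p => a b gp; rewrite /act !perm1 h_x ?h_y. Qed.

(** An automorphism acts on pairs by precomposition, which reverses products. *)
Lemma actM p s t : genp p -> s \in Aut [set: Gb] -> t \in Aut [set: Gb] ->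
  act (act p s) t = act p (t * s).
Proof. by move=> gp As At; rewrite /act !(act_h _ gp As) !permM. Qed.

Lemma act_conj p g s : genp p -> g \in G -> act (conjp p g) s = conjp (act p s) g.
Proof. by move=> gp Gg; rewrite /act /conjp !h_conj. Qed.

Lemma act_tau p s : genp p -> act (taup p) s = taup (act p s).
Proof. by move=> gp; rewrite /act /taup !h_tau. Qed.

Lemma tauJ : {in G &, {morph tau : x y / x ^ y}}.
Proof.
move=> x y Gx Gy; apply: (mulgI (tau y)).
by rewrite -tauM ?groupJ // -!conjgC tauM.
Qed.

Lemma cl_conj p g : genp p -> g \in G -> cl (conjp p g) = cl p.
Proof.
by move=> gp Gg; apply/esym/(clP gp); [apply: genp_conj | exists g].
Qed.

Definition actY (s : {perm Gb}) y := cl (act (pr y) s).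

Lemma actYE s p : genp p -> s \in Aut [set: Gb] -> actY s (cl p) = cl (act p s).
Proof.
move=> gp As; have [|g Gg {2}->] := iffLR (clP (pr_gen (cl p)) gp).
  by rewrite prK.
by rewrite act_conj // cl_conj // act_gen.
Qed.

Lemma actYK s : s \in Aut [set: Gb] -> cancel (actY s) (actY s^-1).
Proof.
move=> As y; have As' := groupVr As.
by rewrite actYE ?act_gen // actM // mulVg act1 // prK.
Qed.

(** The inverse compensates the reversal in [actM]. As [actY s^-1] is known to be a permutation only
    for automorphisms, it is chosen with default 1. *)
Definition rho (s : {perm Gb}) : {perm Y} :=
  odflt 1 [pick t : {perm Y} | [forall y, t y == actY s^-1 y]].

Lemma rhoE s p : genp p -> s \in Aut [set: Gb] -> rho s (cl p) = cl (act p s^-1).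
Proof.
move=> gp As; have As' := groupVr As; rewrite -actYE // /rho.
case: pickP => [t /forallP/(_ (cl p))/eqP-> // | /(_ (perm (can_inj (actYK As'))))].
by case/negP; apply/forallP => y; rewrite permE.
Qed.

Lemma rhoM : {in Aut [set: Gb] &, {morph rho : s t / s * t}}.
Proof.
move=> s t As At; apply/permP => y; rewrite -(prK y) permM !rhoE ?act_gen ?groupM ?groupV //.
by rewrite actM ?groupV // invMg.
Qed.
Canonical rho_morphism := Morphism rhoM.

Lemma InnP s : reflect (exists q : Gb, s = conj_aut [set: Gb] q) (s \in Inn G).
Proof.
apply: (iffP morphimP) => [[q _ _ ->] | [q ->]]; first by exists q.
have Nq: q \in 'N([set: Gb])%g by apply: (subsetP (normG _)); rewrite inE.
by exists q => //; rewrite inE.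
Qed.

Lemma conj_autq (q r : Gb) : conj_aut [set: Gb] q r = r ^ q.
Proof. by rewrite conj_autE ?inE. Qed.

Lemma Inn_Aut s : s \in Inn G -> s \in Aut [set: Gb].
Proof. exact: (subsetP (normal_sub (Inn_normal G))). Qed.

Lemma hall_h (f : Y -> gT) : (forall y, f y \in G) ->
  exists q : Gb, forall y, rep y = y -> h (pr y) q = f y.
Proof.
by move=> /hall[u uP]; exists (qproj _ u) => y ry; rewrite hE // uP.
Qed.

(** If [s] fixes every class, it conjugates each representative pair by some element of [G]. By
    Hall's argument these elements are the values of a single [q] in [Gbar], and [s] agrees with
    conjugation by [q] at all generating pairs. *)
Lemma ker_rho s : s \in Aut [set: Gb] -> rho s = 1 -> s \in Inn G.
Proof.
move=> As rs1; have As' := groupVr As.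
have fP y : exists g, g \in G /\ act (pr y) s = conjp (pr y) g.
  have [|g Gg E] := iffLR (clP (pr_gen y) (act_gen (pr_gen y) As)).
    have : rho s^-1 = 1 by rewrite (morphV rho_morphism) //= rs1 invg1.
    by move/permP/(_ (cl (pr y))); rewrite perm1 rhoE // invgK => ->.
  by exists g.
have [q qP] := hall_h (fun y => proj1 (svalP (cid (fP y)))).
have qE p : genp p -> act p s = conjp p (h p q).
  move: p; apply: (rep_ind (P := fun p => act p s = conjp p (h p q)))
    => [p g gp Gg E | p gp E | y ry].
  - rewrite act_conj // h_conj // E /conjp /=.
    by rewrite -!conjJg.
  - have [Gp1 Gp2] := genp_mem gp; have Gpq := h_gen q gp.
    rewrite act_tau // h_tau // E /conjp /taup /=.
    by rewrite !tauJ.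
  by rewrite qP //; case: (svalP (cid (fP y))).
suff -> : s = conj_aut [set: Gb] q by apply/InnP; exists q.
apply/permP; apply: Gbar_hom_eq; first exact: autM.
- by move=> r t; rewrite !conj_autq conjMg.
- rewrite conj_autq; apply: h_inj => p gp; rewrite hJ // h_x //.
  by have [] := qE p gp.
rewrite conj_autq; apply: h_inj => p gp; rewrite hJ // h_y //.
by have [] := qE p gp.
Qed.

Lemma act_inn p (q : Gb) : genp p -> act p (conj_aut [set: Gb] q) = conjp p (h p q).
Proof. by move=> gp; rewrite /act !conj_autq !hJ // h_x ?h_y. Qed.

Lemma InnE s : s \in Aut [set: Gb] -> (s \in Inn G) = (rho s == 1).
Proof.
move=> As; apply/idP/eqP => [Is | ]; last exact: ker_rho.
apply/permP => y; rewrite -(prK y) rhoE // perm1.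
have /InnP[q ->] := groupVr Is; rewrite act_inn // cl_conj // h_gen //.
Qed.

Lemma rhoV s : s \in Aut [set: Gb] -> rho s^-1 = (rho s)^-1.
Proof. exact: (morphV rho_morphism). Qed.

Lemma coset_comm s t : s \in Aut [set: Gb] -> t \in Aut [set: Gb] ->
  (coset (Inn G) s \in 'C[coset (Inn G) t]) = (rho s * rho t == rho t * rho s).
Proof.
move=> As At; have nI := subsetP (normal_norm (Inn_normal G)).
rewrite -!rhoM // (sameP cent1P eqP) -!morphM ?nI //.
rewrite (sameP eqP (rcoset_kercosetP _ _)) ?nI ?groupM // mem_rcoset.
have Ast := groupM As At; have Ats := groupM At As.
by rewrite InnE ?(groupM Ast (groupVr Ats)) // (rhoM Ast (groupVr Ats)) rhoV // -eq_mulgV1.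
Qed.

Lemma rho_theta y : rho (theta G) y = tth y.
Proof.
have [At tx ty] := thetaP G; rewrite -(prK y) rhoE // tthE //.
have tVx : (theta G)^-1 (xbar G) = ybar G by rewrite -ty permK.
have tVy : (theta G)^-1 (ybar G) = xbar G by rewrite -tx permK.
by rewrite /act tVx tVy h_x // h_y.
Qed.

(** The inverse appears because [tde] is precomposition with [delta] itself while [rho] inverts; for
    [theta], which exchanges the generators, the two agree. *)
Lemma rho_delta y : rho (delta G)^-1 y = tde y.
Proof.
have [At tx ty] := deltaP G; rewrite -(prK y) rhoE ?groupV // tdeE //.
by rewrite /act invgK tx ty hM // !hV // h_x // h_y.
Qed.

Lemma rho_tta s y : s \in Aut [set: Gb] -> rho s (tta y) = tta (rho s y).
Proof.
move=> As; have As' := groupVr As.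
by rewrite -(prK y) ttaE // !rhoE ?genp_tau // act_tau // ttaE ?act_gen.
Qed.

(** When labels are preserved, a conjugating element exists at each representative separately;
    [hall_h] glues these into one element of [Gbar]. *)
Lemma rho_lab s : s \in Aut [set: Gb] ->
  (s (xbar G) \in xbar G ^: [set: Gb]) <-> (forall y, lab (rho s y) = lab y).
Proof.
move=> As; have As' := groupVr As; split=> [/imsetP[q _ xq] y | labs].
  have ga := act_gen (pr_gen y) As'.
  rewrite -(prK y) rhoE //; apply/labP => //.
  have {1}->: pr y = act (act (pr y) s^-1) s by rewrite actM // mulgV act1.
  by rewrite /= xq hJ // h_x //; apply: memJ_class (h_gen q ga).
have fP y : exists g, g \in G /\ (act (pr y) s).1 = (pr y).1 ^ g.
  have ga := act_gen (pr_gen y) As.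
  have: lab (cl (pr y)) = lab (cl (act (pr y) s)).
    by rewrite -(labs (cl (act _ s))) rhoE // actM // mulVg act1.
  by move/(iffLR (labP (pr_gen y) ga)) => /imsetP[g Gg ->]; exists g.
have [q qP] := hall_h (fun y => proj1 (svalP (cid (fP y)))).
apply/imsetP; exists q; rewrite ?inE //; apply: h_inj => p gp; rewrite hJ // h_x //.
move: p gp; apply: (rep_ind (P := fun p => h p (s (xbar G)) = p.1 ^ h p q))
    => [p g gp Gg E | p gp E | y ry].
- by rewrite !h_conj // E /= -conjJg.
- by rewrite !h_tau // E tauJ ?h_gen //; case/genp_mem: gp.
by rewrite qP //; case: (svalP (cid (fP y))).
Qed.

Lemma mem_GT1_aut s : s \in Aut [set: Gb] ->
  (s \in GT1_aut G) = (rho s \in symset tth tde tta lab).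
Proof.
move=> As; have [At _ _] := thetaP G; have [Ad _ _] := deltaP G.
have Ad' := groupVr Ad.
have deltaV : commute (rho s) (rho (delta G)) <-> commute (rho s) (rho (delta G)^-1).
  rewrite rhoV //; split=> c; first exact: commuteV.
  by rewrite -[rho (delta G)]invgK; apply: commuteV.
apply/setIdP/symsetP => [[_ /and3P[/(iffLR (rho_lab As)) labs cth cde]] y | sP].
  have{cth} /eqP/permP/(_ y) := etrans (esym (coset_comm As At)) cth.
  have{cde} /eqP/deltaV/permP/(_ y) := etrans (esym (coset_comm As Ad)) cde.
  by rewrite !permM !rho_theta !rho_delta (rho_tta _ As) labs.
split=> //; apply/and3P; split.
- by apply/(rho_lab As) => y; case: (sP y).
- apply: etrans (coset_comm As At) _; apply/eqP/permP => y.
  by rewrite !permM !rho_theta; case: (sP y).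
apply: etrans (coset_comm As Ad) _; apply/eqP/deltaV/permP => y.
by rewrite !permM !rho_delta; case: (sP y).
Qed.

(** The generators are sent to [X] and [Z], whose values at each representative form a pair of the
    class prescribed by [t]. Since [t] commutes with [tta], this holds at all generating pairs, and
    every class of pairs is reached, which makes the endomorphism injective. *)
Lemma rho_onto t : t \in symset tth tde tta lab ->
  exists2 s, s \in Aut [set: Gb] & rho s = t.
Proof.
move/symsetP=> tP.
have [X XP] := hall_h (fun y => proj1 (genp_mem (pr_gen (t y)))).
have [Z ZP] := hall_h (fun y => proj2 (genp_mem (pr_gen (t y)))).
pose im p := (h p X, h p Z).
have imP p : genp p -> genp (im p) /\ cl (im p) = t (cl p).
  move: p; apply: (rep_ind (P := fun p => genp (im p) /\ cl (im p) = t (cl p)))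
    => [p g gp Gg [gi E] | p gp [gi E] | y ry].
  - have -> : im (conjp p g) = conjp (im p) g.
      by rewrite /im (h_conj _ gp Gg) (h_conj _ gp Gg).
    by rewrite !cl_conj //; split; first exact: genp_conj.
  - have -> : im (taup p) = taup (im p) by rewrite /im (h_tau _ gp) (h_tau _ gp).
    rewrite -(ttaE gi) -(ttaE gp) E; have [_ _ -> _] := tP (cl p).
    by split; first exact: genp_tau.
  by rewrite /im XP // ZP // -surjective_pairing !prK.
pose f (q : Gb) : Gb := eval (fun b : bool => if b then Z else X) (qrepr q).
have fE p q : genp p -> h p (f q) = h (im p) q.
  move=> gp; rewrite {2}/h /f; move: (qrepr q).
  apply: (ev_eq (f := fun u => h p (eval (fun b : bool => if b then Z else X) u)))
    => [u v||]; rewrite ?eval_gen //.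
  by rewrite evalM hM.
have fM : {morph f : q r / q * r}.
  move=> q r; apply: h_inj => p gp; have [gi _] := imP p gp.
  by rewrite hM // !fE // hM.
have f_inj : injective f.
  move=> q r eqf; apply: h_inj => k gk.
  (* With this choice [im p] is conjugate to the given pair [k]. *)
  pose p := pr (t^-1 (cl k)); have gp : genp p by apply: pr_gen.
  have [gi E] := imP p gp.
  have [|g Gg ->] := iffLR (clP gi gk); first by rewrite E prK permKV.
  by rewrite !h_conj // -!fE // eqf.
have As : perm f_inj \in Aut [set: Gb].
  rewrite inE; apply/andP; split; first by apply/subsetP => q; rewrite inE.
  by apply/morphicP => q r _ _; rewrite !permE fM.
(* Inverted, because [rho] acts through the inverse. *)
exists (perm f_inj)^-1; rewrite ?groupV //; apply/permP => y.
rewrite -{1}(prK y) rhoE ?groupV // invgK /act !permE !fE //.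
by have [gi E] := imP _ (pr_gen y); rewrite h_x // h_y // -surjective_pairing E prK.
Qed.

Lemma GT1_isog_symset : GT1 G \isog symgroup tth tde tta lab.
Proof.
have sA : GT1_aut G \subset Aut [set: Gb] by apply/subsetP => s /setIdP[].
have kerE : GT1_aut G :&: 'ker rho_morphism = Inn G.
  apply/setP => s; rewrite inE; apply/andP/idP => [[As /kerP rs1] | Is].
    by rewrite InnE ?(subsetP sA) //; apply/eqP/rs1/(subsetP sA).
  have As := Inn_Aut Is; have /eqP r1 : rho s == 1 by rewrite -InnE.
  split; last by apply/kerP.
  by rewrite (mem_GT1_aut As) r1; apply: (group1 (symgroup tth tde tta lab)).
have imE : rho_morphism @* GT1_aut G = symset tth tde tta lab.
  apply/setP => t; apply/morphimP/idP => [[s As Gs ->] | Kt].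
    by rewrite /= -mem_GT1_aut.
  by have [s As st] := rho_onto Kt; exists s; rewrite ?mem_GT1_aut ?st.
have := first_isog_loc rho_morphism sA.
by rewrite /= kerE imE.
Qed.
End GT1Perm.

(** * Decomposition of a centraliser of permutations into blocks *)

Section Products.
Variables (C : eqType) (HT : C -> finGroupType) (H : forall c, {group HT c}).

(** The factors are internal and known only up to isomorphism, through their codes. Groups with the
    same multiset of codes are then isomorphic, and no identification of large product types is
    involved. *)
Fixpoint prodof (L : seq C) (gT : finGroupType) (G : {group gT}) : Prop :=
  if L is c :: L' then
    exists A B : {group gT}, [/\ A \x B = G, A \isog H c & prodof L' B]
  else G :=: 1.

Lemma prodof_isog L (gT rT : finGroupType) (G : {group gT}) (G' : {group rT}) :
  G \isog G' -> prodof L G -> prodof L G'.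
Proof.
elim: L G G' => [|c L IHL] G G' isoG /=.
  by move=> G1; apply/eqP; rewrite -(isog_eq1 isoG) G1.
have /isogP[f injf defG'] := isoG.
move=> [A [B [defG isoA LB]]]; have [sAG sBG] := dprod_normal2 defG.
have {}sAG := normal_sub sAG; have {}sBG := normal_sub sBG.
exists (f @* A)%G, (f @* B)%G; split.
- by rewrite -defG' /= (injm_dprod _ _ defG).
- by apply: isog_trans isoA; rewrite isog_sym sub_isog.
by apply: IHL LB; rewrite sub_isog.
Qed.

Lemma prodof_cat L1 L2 (gT : finGroupType) (A B G : {group gT}) :
  A \x B = G -> prodof L1 A -> prodof L2 B -> prodof (L1 ++ L2) G.
Proof.
elim: L1 A G => [|c L1 IHL] A G /= defG.
  by move=> A1; rewrite A1 dprod1g in defG; rewrite -(val_inj defG).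
move=> [A1 [A2 [defA isoA1 LA2]]] LB.
have := defG; rewrite -defA -dprodA => /[dup] defG' /dprodP[[_ K _ defK] _ _ _].
rewrite defK in defG'; exists A1, K; split=> //.
exact: IHL defK LA2 LB.
Qed.

Lemma prodof_cat_inv L1 L2 (gT : finGroupType) (G : {group gT}) :
  prodof (L1 ++ L2) G ->
  exists A B : {group gT}, [/\ A \x B = G, prodof L1 A & prodof L2 B].
Proof.
elim: L1 G => [|c L1 IHL] G /=.
  by exists 1%G, G; rewrite dprod1g.
move=> [A1 [A2 [defG isoA1 /IHL[A [B [defA2 LA LB]]]]]].
have := defG; rewrite -defA2 dprodA => /[dup] defG' /dprodP[[K _ defK _] _ _ _].
rewrite defK in defG'; exists K, B; split=> //.
by exists A1, A.
Qed.

Lemma prodof_perm L L' (gT : finGroupType) (G : {group gT}) :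
  perm_eq L L' -> prodof L G -> prodof L' G.
Proof.
suff swap L1 L2 L3 : prodof (L1 ++ L2 ++ L3) G -> prodof (L2 ++ L1 ++ L3) G.
  move=> pL; rewrite -(@catCA_perm_subst _ _ (fun L => prodof L G) _ L L') //.
  by move=> L1 L2 L3; apply/propext; split; apply: swap.
move=> /prodof_cat_inv[A [K [defG LA /prodof_cat_inv[B [D [defK LB LD]]]]]].
move: defG; rewrite -defK dprodA (dprodC A) -dprodA => /[dup] defG.
case/dprodP=> [[_ K' _ defK'] _ _ _]; rewrite defK' in defG.
by apply: prodof_cat defG LB _; apply: prodof_cat defK' LA LD.
Qed.

Lemma prodof_uniq L (gT rT : finGroupType) (G : {group gT}) (G' : {group rT}) :
  prodof L G -> prodof L G' -> G \isog G'.
Proof.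
elim: L G G' => [|c L IHL] G G' /=.
  by move=> G1 G'1; apply: trivial_isog.
move=> [A [B [defG isoA LB]]] [A' [B' [defG' isoA' LB']]].
apply: (isog_dprod defG defG'); last exact: IHL LB LB'.
by apply: isog_trans isoA _; rewrite isog_sym.
Qed.

Lemma prodof_setX L1 L2 (gT rT : finGroupType) (A : {group gT}) (B : {group rT}) :
  prodof L1 A -> prodof L2 B -> prodof (L1 ++ L2) (A \X B).
Proof.
move=> LA LB; apply: prodof_cat (setX_dprod A B) _ _.
  by apply: prodof_isog LA; apply: isog_setX1.
by apply: prodof_isog LB; apply: isog_set1X.
Qed.

Lemma prodof_bigdprod (I : Type) (s : seq I) (gT : finGroupType) c
    (A : I -> {group gT}) (G : {group gT}) :
  (forall i, A i \isog H c) -> \big[dprod/1]_(i <- s) A i = G ->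
  prodof (nseq (size s) c) G.
Proof.
move=> isoA; elim: s G => [|i s IHs] G /=.
  by rewrite big_nil => <-.
rewrite big_cons => /[dup] defG /dprodP[[_ K _ defK] _ _ _].
by exists (A i), K; rewrite -defK; split=> //; apply: IHs.
Qed.

Lemma prodof_setXn n c : prodof (nseq n c) (H c ^X n).
Proof.
have := setXn_dprod (fun _ : 'I_n => H c).
rewrite -big_enum /= => defG.
rewrite -{1}[n]card_ord cardE.
apply: prodof_bigdprod defG => i.
by rewrite isog_sym; apply: (@isog_setXn _ (fun _ : 'I_n => HT c) i (H c)).
Qed.

Lemma prodof1 c (gT : finGroupType) (G : {group gT}) :
  G \isog H c -> prodof [:: c] G.
Proof. by move=> isoG; exists G, 1%G; rewrite dprodg1. Qed.
End Products.

Section CommutingPerms.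
Variables (X : finType) (nu : X -> X).
Definition centset := [set s : {perm X} | [forall x, s (nu x) == nu (s x)]].
Lemma centsetP (s : {perm X}) : reflect (forall x, s (nu x) = nu (s x)) (s \in centset).
Proof. by rewrite inE; apply: (iffP forallP) => sP x; apply/eqP/sP. Qed.
Lemma centset_group : group_set centset.
Proof.
apply/group_setP; split=> [|s t /centsetP sP /centsetP tP].
  by apply/centsetP => x; rewrite !perm1.
by apply/centsetP => x; rewrite !permM sP tP.
Qed.
Canonical centgroup := Group centset_group.
End CommutingPerms.

Section Blocks.
Variables (Y : finType) (W : {group {perm Y}}) (T S : eqType).
Variables (lab : Y -> T) (key : Y -> S).

Definition lperm := [set t in 'C(W) | [forall y, lab (t y) == lab y]].

Lemma lpermP (t : {perm Y}) :
  reflect ((forall w y, w \in W -> t (w y) = w (t y)) /\ forall y, lab (t y) = lab y)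
    (t \in lperm).
Proof.
rewrite inE; apply: (iffP andP) => [[/centP tW /forallP labt] | [tW labt]].
  by split=> [w y Ww | y]; [rewrite -!permM (tW w Ww) | exact: (eqP (labt y))].
split; last by apply/forallP => y; rewrite labt.
by apply/centP => w Ww; apply/permP => y; rewrite !permM tW.
Qed.

Lemma lperm_group : group_set lperm.
Proof.
apply/group_setP; split=> [|s t /lpermP[sW sl] /lpermP[tW tl]].
  by apply/lpermP; split=> [w y Ww | y]; rewrite !perm1.
by apply/lpermP; split=> [w y Ww | y]; rewrite !permM; [rewrite sW // tW | rewrite tl sl].
Qed.
Canonical lpermg := Group lperm_group.

Definition lperm_on (D : {set Y}) := [set t in lperm | perm_on D t].
Lemma lperm_on_group D : group_set (lperm_on D).
Proof.
apply/group_setP; split=> [|s t].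
  by apply/setIdP; rewrite group1 perm_on1.
move=> /setIdP[Ks sD] /setIdP[Kt tD]; apply/setIdP.
by rewrite groupM // perm_onM.
Qed.
Canonical lperm_ong D := Group (lperm_on_group D).

Lemma lperm_onT : lperm_on setT = lperm.
Proof.
by apply/setP => t; rewrite inE andb_idr // => _; apply/subsetP => y; rewrite inE.
Qed.

Definition wstable (D : {set Y}) := forall y, y \in D ->
  (forall w, w \in W -> w y \in D) /\ (forall t, t \in lperm -> t y \in D).

(** A permutation of the union is the product of its two restrictions; these still commute with [W]
    and keep labels because each part is stable under [W] and under [lperm]. *)
Lemma lperm_onU (D1 D2 : {set Y}) : wstable D1 -> wstable D2 -> [disjoint D1 & D2] ->
  lperm_on D1 \x lperm_on D2 = lperm_on (D1 :|: D2).
Proof.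
move=> st1 st2 dis.
have offD1 t y : perm_on D1 t -> y \in D2 -> t y = y.
  by move=> tD Dy; rewrite (out_perm tD) // (disjointFl dis).
have offD2 t y : perm_on D2 t -> y \in D1 -> t y = y.
  by move=> tD Dy; rewrite (out_perm tD) // (disjointFr dis).
have restr D (t : {perm Y}) : wstable D -> t \in lperm ->
  restr_perm D t \in lperm_on D.
  move=> stD Kt; have nD : t \in 'N(D | 'P).
    rewrite inE /= ?inE; apply/subsetP => y Dy; rewrite inE /=.
    by case: (stD y Dy) => _; apply.
  have [tW tl] := lpermP _ Kt.
  apply/setIdP; split; last exact: restr_perm_on.
  apply/lpermP; split=> [w y Ww | y]; last first.
    case Dy: (y \in D); first by rewrite restr_permE.
    by rewrite (out_perm (restr_perm_on _ _)) ?Dy.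
  case Dy: (y \in D); first by rewrite !restr_permE ?tW //; case: (stD y Dy) => ->.
  rewrite !(out_perm (restr_perm_on _ _)) ?Dy //.
  by apply/negP => /stD[/(_ w^-1)]; rewrite groupV permK Dy => /(_ Ww).
rewrite dprodE.
- apply/setP => t; apply/mulsgP/setIdP => [[t1 t2 /setIdP[K1 D1t] /setIdP[K2 D2t] ->] | [Kt tD]].
    rewrite groupM //; split=> //; apply: perm_onM.
      exact: subset_trans D1t (subsetUl _ _).
    exact: subset_trans D2t (subsetUr _ _).
  exists (restr_perm D1 t) (restr_perm D2 t); rewrite ?restr //.
  apply/permP => y; rewrite permM.
  have nD D : wstable D -> t \in 'N(D | 'P).
    move=> stD; rewrite inE /= ?inE; apply/subsetP => z Dz; rewrite inE /=.
    by case: (stD z Dz) => _; apply.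
  case D1y: (y \in D1).
    rewrite [restr_perm D1 t y]restr_permE ?nD // (offD2 _ _ (restr_perm_on _ _)) //.
    by case: (st1 y D1y) => _; apply.
  rewrite [restr_perm D1 t y](out_perm (restr_perm_on _ _)) ?D1y //.
  case D2y: (y \in D2); first by rewrite restr_permE ?nD.
  by rewrite !(out_perm (restr_perm_on _ _)) ?(out_perm tD) // ?inE ?D1y ?D2y.
- apply/centsP => t2 /setIdP[K2 D2t] t1 /setIdP[K1 D1t]; apply/permP => y.
  rewrite !permM; case D1y: (y \in D1).
    rewrite (offD2 t2 y) // (offD2 t2 (t1 y)) //.
    by case: (st1 y D1y) => _; apply.
  rewrite [in RHS](out_perm D1t) ?D1y //.
  case D2y: (y \in D2).
    by rewrite offD1 //; case: (st2 y D2y) => _; apply.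
  by rewrite (out_perm D2t) ?D2y // (out_perm D1t) ?D1y.
apply/trivgP/subsetP => t /setIP[/setIdP[_ D1t] /setIdP[_ D2t]].
apply/set1P/permP => y; rewrite perm1; case D1y: (y \in D1).
  by rewrite offD2.
by rewrite (out_perm D1t) ?D1y.
Qed.

Section OneBlock.
Variables (X : finType) (nu : X -> X) (b : X -> Y).
Hypotheses (b_inj : injective b)
  (b_ext : forall w x x', w \in W -> w (b x) = b x' ->
     forall s : {perm X}, s \in centset nu -> w (b (s x)) = b (s x'))
  (b_im : forall t x, t \in lperm -> exists x', t (b x) = b x')
  (b_nu : exists2 n, n \in W & forall x, b (nu x) = n (b x))
  (b_lab : forall w x x', w \in W -> lab (w (b x)) = lab (w (b x'))).

Definition sweep := [set y | [exists w in W, exists x, y == w (b x)]].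

Lemma sweepP y : reflect (exists2 w, w \in W & exists x, y = w (b x)) (y \in sweep).
Proof.
rewrite inE; apply: (iffP existsP) => [[w /andP[Ww /existsP[x /eqP->]]] | [w Ww [x ->]]].
  by exists w => //; exists x.
by exists w; rewrite Ww; apply/existsP; exists x.
Qed.

(** Spreads a permutation [s] of a block over the [W]-translates of the block. A point may be
    written [w (b x)] in several ways; [b_ext] makes the result independent of the one picked. *)
Definition transport (s : {perm X}) y :=
  if [pick c : {perm Y} * X | (c.1 \in W) && (y == c.1 (b c.2))] is Some c
  then c.1 (b (s c.2)) else y.

Lemma lift_in s w x : s \in centset nu -> w \in W -> transport s (w (b x)) = w (b (s x)).
Proof.
move=> cs Ww; rewrite /transport; case: pickP => [[v z] /= /andP[Wv /eqP E] | /(_ (w, x))].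
  have := @b_ext (w * v^-1) x z; rewrite groupM ?groupV // permM E permK.
  by move=> /(_ isT erefl _ cs); rewrite permM => <-; rewrite permKV.
by rewrite /= Ww eqxx.
Qed.

Lemma lift_out s y : y \notin sweep -> transport s y = y.
Proof.
move=> /sweepP Sy; rewrite /transport; case: pickP => // -[v z] /= /andP[Wv /eqP E].
by case: Sy; exists v => //; exists z.
Qed.

Lemma lift_comp s t : s \in centset nu -> t \in centset nu ->
  transport t \o transport s =1 transport (s * t).
Proof.
move=> cs ct y /=; have [/sweepP[w Ww [x ->]] | Sy] := boolP (y \in sweep).
  by rewrite !lift_in ?groupM // permM.
by rewrite !lift_out.
Qed.

Lemma lift1 y : transport 1 y = y.
Proof.
have [/sweepP[w Ww [x ->]] | Sy] := boolP (y \in sweep); last by rewrite lift_out.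
by rewrite lift_in ?group1 // perm1.
Qed.

Definition liftp (s : {perm X}) : {perm Y} :=
  odflt 1 [pick t : {perm Y} | [forall y, t y == transport s y]].

Lemma liftpE s y : s \in centset nu -> liftp s y = transport s y.
Proof.
move=> cs; have cs' : s^-1 \in centset nu by rewrite groupV.
have lK : cancel (transport s) (transport s^-1).
  by move=> z; have := lift_comp cs cs' z; rewrite /= => ->; rewrite mulgV lift1.
rewrite /liftp; case: pickP => [t /forallP/(_ y)/eqP-> // | /(_ (perm (can_inj lK)))].
by case/negP; apply/forallP => z; rewrite permE.
Qed.

Lemma liftpM : {in centset nu &, {morph liftp : s t / s * t}}.
Proof.
move=> s t cs ct; apply/permP => y.
by rewrite permM !liftpE ?groupM // -(lift_comp cs ct).
Qed.
Canonical liftp_morphism := Morphism liftpM.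

(** A permutation supported on the translates maps the block to itself by [b_im], commutes there
    with [nu], which is induced by an element of [W], and is determined by this restriction.
    Conversely [transport] extends. *)
Lemma block_isog : lperm_on sweep \isog centset nu.
Proof.
rewrite isog_sym; apply/isogP; exists liftp_morphism.
  apply/injmP => s t cs ct /= /permP eq_st; apply/permP => x; apply: b_inj.
  have := eq_st (b x); rewrite !liftpE //.
  by have := fun s cs => @lift_in s 1 x cs (group1 W); rewrite perm1 => E; rewrite !E // !perm1.
have W1 x : b x = (1 : {perm Y}) (b x) by rewrite perm1.
apply/setP => t; apply/morphimP/setIdP => [[s _ cs ->] | [Kt tS]] /=.
  split; last first.
    apply/subsetP => y; rewrite inE; apply: contraR => Sy.
    by rewrite liftpE // lift_out.
  apply/lpermP; split=> [w y Ww | y].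
    rewrite !liftpE //; have [/sweepP[v Wv [x ->]] | Sy] := boolP (y \in sweep).
      by rewrite -permM !lift_in ?groupM // permM.
    rewrite !lift_out //; apply: contra Sy => /sweepP[v Wv [x E]].
    apply/sweepP; exists (v * w^-1); rewrite ?groupM ?groupV //.
    by exists x; rewrite permM -E permK.
  rewrite liftpE //; have [/sweepP[v Wv [x ->]] | Sy] := boolP (y \in sweep).
    by rewrite lift_in //; apply: b_lab.
  by rewrite lift_out.
have [tW tl] := lpermP _ Kt.
have f_ex x : exists x', t (b x) == b x'.
  by have [x' E] := b_im x Kt; exists x'; rewrite E.
pose f x := xchoose (f_ex x).
have fE x : b (f x) = t (b x) by rewrite (eqP (xchooseP (f_ex x))).
have f_inj : injective f.
  by move=> x x' eqf; apply: b_inj; apply: (@perm_inj _ t); rewrite -!fE eqf.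
have cf : perm f_inj \in centset nu.
  have [n Wn nE] := b_nu.
  by apply/centsetP => x; apply: b_inj; rewrite !permE nE !fE nE tW.
exists (perm f_inj) => //; apply/permP => y; rewrite liftpE //.
have [/sweepP[v Wv [x ->]] | Sy] := boolP (y \in sweep).
  by rewrite lift_in // permE fE tW.
by rewrite lift_out // (out_perm tS).
Qed.
End OneBlock.
End Blocks.

(* The code [(false, m)] stands for S_m and [(true, m)] for C_2 wr S_m, the centraliser of
   a free involution on 2m points. *)
Definition wr_type (c : bool * nat) : finType :=
  if c.1 then ('I_c.2 * bool)%type : finType else 'I_c.2 : finType.
Definition wr_flip (c : bool * nat) : wr_type c -> wr_type c :=
  match c with
  | (true, m) => fun x : 'I_m * bool => (x.1, ~~ x.2)
  | (false, m) => id
  end.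
Definition wreath (c : bool * nat) : {group {perm wr_type c}} := centgroup (@wr_flip c).

Section Decomposition.
Variables (Y : finType) (W : {group {perm Y}}) (T S : eqType).
Variables (lab : Y -> T) (key : Y -> S).
Notation K := (lperm W lab).
Hypotheses
  (key_lab : forall y z, key y = key z -> lab y = lab z)
  (key_W : forall w y z, w \in W -> key y = key z -> key (w y) = key (w z))
  (key_K : forall t y, t \in K -> key (t y) = key y)
  (key_stab : forall w y z, w \in W -> key y = key z -> w y = y -> w z = z).

Definition block y := [set z | key z == key y].
Definition wsweep y := [set z | [exists w in W, key (w z) == key y]].

(** Conditions at the single point [y] are enough: equal keys mean equal stabilisers, so an element
    of [W] behaves in the same way at all points of the block. *)
Definition block_type y (c : bool * nat) : Prop :=
  if c.1 then #|block y| = (c.2).*2 /\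
    exists2 n, n \in W & [/\ key (n y) = key y, n y != y &
      forall w, w \in W -> key (w y) = key y -> w y = y \/ w y = n y]
  else #|block y| = c.2 /\
    forall w, w \in W -> key (w y) = key y -> w y = y.

Lemma wsweepP z y : reflect (exists2 w, w \in W & key (w z) = key y) (z \in wsweep y).
Proof.
rewrite inE; apply: (iffP existsP) => [[w /andP[Ww /eqP E]] | [w Ww E]]; exists w => //.
by rewrite Ww E eqxx.
Qed.

Lemma wsweep_stable y : wstable W lab (wsweep y).
Proof.
move=> z /wsweepP[v Wv E]; split=> [w Ww | t Kt]; apply/wsweepP.
  by exists (w^-1 * v); rewrite ?groupM ?groupV // permM permK.
exists v => //; rewrite -E; have [tW _] := lpermP _ _ _ Kt.
by rewrite -tW // key_K.
Qed.

Lemma sweep_block (X : finType) (b : X -> Y) y : b @: setT = block y ->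
  sweep W b = wsweep y.
Proof.
move=> bB; apply/setP => z; apply/sweepP/wsweepP => [[w Ww [x ->]] | [w Ww E]].
  exists w^-1; rewrite ?groupV // permK; apply/eqP.
  by have: b x \in block y by [rewrite -bB imset_f]; rewrite inE.
have: w z \in block y by rewrite inE E.
rewrite -bB => /imsetP[x _ wz]; exists w^-1; rewrite ?groupV //.
by exists x; rewrite -wz permK.
Qed.

Section Block.
Variables (X : finType) (b : X -> Y) (y : Y).
Hypothesis bB : b @: setT = block y.

Lemma block_key x : key (b x) = key y.
Proof. by apply/eqP; have: b x \in block y by [rewrite -bB imset_f]; rewrite inE. Qed.

Lemma block_im t x : t \in K -> exists x', t (b x) = b x'.
Proof.
move=> Kt; have: t (b x) \in block y by rewrite inE key_K // block_key.
by rewrite -bB => /imsetP[x' _ ->]; exists x'.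
Qed.

Lemma block_lab w x x' : w \in W -> lab (w (b x)) = lab (w (b x')).
Proof. by move=> Ww; apply/key_lab/key_W; rewrite // !block_key. Qed.
End Block.

(** An element of [W] that maps one point of the block into the block either fixes all its points or
    acts on all of them as [n]. In the second case [n] is an involution without fixed points on the
    block, and its centraliser is the wreath product. *)
Lemma free_block y c : block_type y c -> lperm_on W lab (wsweep y) \isog wreath c.
Proof.
case: c => [[] m] [/= cardB].
  case=> n Wn [nk nz nP].
  have n_block z : z \in block y -> n z \in block y.
    by rewrite !inE => /eqP zy; rewrite -nk; apply/eqP/key_W.
  have n2 z : z \in block y -> n (n z) = z.
    rewrite inE => /eqP /esym zy; rewrite -permM.
    have kk : key ((n * n) y) = key y by rewrite permM (key_W Wn nk) nk.
    apply: (key_stab (groupM Wn Wn) zy).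
    (* The other possibility, that [n * n] sends [y] to [n y], would make [n] fix [y]. *)
    case: (nP _ (groupM Wn Wn) kk) => //; rewrite permM => /perm_inj/eqP.
    by rewrite (negPf nz).
  have n_neq z : z \in block y -> n z != z.
    rewrite inE => /eqP zy; apply: contra nz => /eqP nzz.
    by apply/eqP; apply: (key_stab Wn zy).
  (* [R] takes the point of smaller rank in each orbit of [n] on the block; the boolean of the
     parametrisation then says whether [n] is applied. *)
  pose R := [set z in block y | enum_rank z < enum_rank (n z)].
  have RB z : z \in R -> z \in block y by case/setIdP.
  pose b (x : 'I_#|R| * bool) := if x.2 then n (enum_val x.1) else enum_val x.1.
  have evB (i : 'I_#|R|) : enum_val i \in block y by apply: RB; apply: enum_valP.
  have nR (i : 'I_#|R|) : n (enum_val i) \notin R.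
    rewrite inE n2 ?evB // negb_and -leqNgt; apply/orP; right.
    by have /setIdP[_ /ltnW] := enum_valP i.
  have b_inj : injective b.
    move=> [i [] ] [j []]; rewrite /b /= => E.
    - by move/perm_inj/enum_val_inj: E => ->.
    - by case/negP: (nR i); rewrite E enum_valP.
    - by case/negP: (nR j); rewrite -E enum_valP.
    by move/enum_val_inj: E => ->.
  have bB : b @: setT = block y.
    apply/setP => z; apply/imsetP/idP => [[[i []] _ ->] | Bz]; rewrite /b /=.
    - by rewrite n_block.
    - by [].
    have [Rz | nRz] := boolP (z \in R).
      by exists (enum_rank_in Rz z, false); rewrite // enum_rankK_in.
    have Rnz : n z \in R.
      rewrite inE n_block // n2 //= ltn_neqAle leqNgt.
      move: nRz; rewrite inE Bz /= => ->; rewrite andbT.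
      by rewrite (inj_eq val_inj) (inj_eq enum_rank_inj) n_neq.
    by exists (enum_rank_in Rnz (n z), true); rewrite //= enum_rankK_in // n2.
  have mR : m = #|R|.
    apply: double_inj; rewrite -cardB -bB card_imset // cardsT card_prod card_ord card_bool.
    by rewrite muln2.
  rewrite mR -(sweep_block bB).
  apply: (block_isog (nu := @wr_flip (true, #|R|))) => //.
  - move=> w x x' Ww E s /centsetP cs.
    have kx := block_key bB x; have ks := block_key bB (s x).
    have wP z : z \in block y -> w z = z \/ w z = n z.
      rewrite inE => /eqP /esym zy; have kw : key (w y) = key y.
        by rewrite -(block_key bB x') -E; apply: key_W; rewrite ?kx.
      case: (nP w Ww kw) => wy; [left; exact: key_stab zy wy | right].
      have: (w * n^-1) z = z.
        by apply: (key_stab _ zy); rewrite ?groupM ?groupV // permM wy permK.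
      by rewrite permM => {2}<-; rewrite permKV.
    have bn z : b (wr_flip (c := (true, #|R|)) z) = n (b z).
      by case: z => i []; rewrite /b /= ?n2.
    have bBx z : b z \in block y by rewrite -bB imset_f.
    case: (wP _ (bBx x)) => wx.
      move: E; rewrite wx => /b_inj <-.
      have wy : forall z, z \in block y -> w z = z.
        move=> z; rewrite inE => /eqP zy; apply: key_stab wx => //.
        by rewrite kx zy.
      exact: wy.
    move: E; rewrite wx -bn => /b_inj <-; rewrite cs bn.
    have: (w * n^-1) (b (s x)) = b (s x).
      apply: (key_stab (y := b x)); rewrite ?groupM ?groupV ?kx ?ks //.
      by rewrite permM wx permK.
    by rewrite permM => {2}<-; rewrite permKV.
  - by move=> t x; apply: block_im bB _ _.
  - by exists n => // -[i []]; rewrite /b /= ?n2.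
  by move=> w x x'; apply: block_lab bB _ _ _.
move=> wP; rewrite -cardB; pose b := @enum_val Y (mem (block y)).
have bB : b @: setT = block y.
  apply/setP => z; apply/imsetP/idP => [[i _ ->] | Bz]; first exact: enum_valP.
  by exists (enum_rank_in Bz z); rewrite // /b enum_rankK_in.
have b_inj : injective b by apply: enum_val_inj.
rewrite -(sweep_block bB).
apply: (block_isog (nu := @wr_flip (false, #|block y|))) => //.
- move=> w x x' Ww E s _; have kx := block_key bB x.
  have wy z : z \in block y -> w z = z.
    rewrite inE => /eqP /esym zy; apply: key_stab zy _ => //; apply: wP => //.
    by rewrite -[in RHS](block_key bB x') -E; apply: key_W; rewrite ?kx.
  have bBx z : b z \in block y by rewrite -bB imset_f.
  by move: E; rewrite !wy // => /b_inj->.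
- by move=> t x; apply: block_im bB _ _.
- by exists 1 => // x; rewrite perm1.
by move=> w x x'; apply: block_lab bB _ _ _.
Qed.

(** By the hypotheses, [s] meets each family of [W]-translates of blocks exactly once, so the sweeps
    partition [Y] and each gives one direct factor. *)
Lemma lperm_prod (s : seq Y) (code : Y -> bool * nat) :
  uniq s -> {in s, forall y, block_type y (code y)} ->
  {in s &, forall y z, forall w, w \in W -> key (w z) = key y -> y = z} ->
  (forall z, exists2 y, y \in s & exists2 w, w \in W & key (w z) = key y) ->
  prodof wreath (map code s) (lpermg W lab).
Proof.
move=> us typ inj cov.
pose D (r : seq Y) := [set z | has (fun y => z \in wsweep y) r].
have defT : lpermg W lab :=: lperm_ong W lab (D s).
  rewrite /= -lperm_onT; congr lperm_on; apply/esym/setP => z; rewrite !inE.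
  by have [y sy /wsweepP yz] := cov z; apply/hasP; exists y.
rewrite (val_inj defT : lpermg W lab = lperm_ong W lab (D s)) => {defT cov}.
elim: s us typ inj => [|y s IHs] /= us typ inj.
  apply/trivgP/subsetP => t /setIdP[_ tD]; apply/set1P/permP => z.
  by rewrite perm1 (out_perm tD) // inE.
move/andP: us => [s'y us].
have Dcons : D (y :: s) = wsweep y :|: D s by apply/setP => z; rewrite !inE /= inE.
have stD r : wstable W lab (D r).
  move=> z; rewrite inE => /hasP[x rx /(wsweep_stable)[zW zK]].
  by split=> [w /zW|t /zK] xz; rewrite inE; apply/hasP; exists x.
exists (lperm_ong W lab (wsweep y)), (lperm_ong W lab (D s)); split.
- rewrite /= Dcons; apply: lperm_onU => //; first exact: wsweep_stable.
  rewrite -setI_eq0; apply/eqP/setP => z; rewrite [RHS]inE; apply/negP.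
  case/setIP=> /wsweepP[v Wv vz]; rewrite inE => /hasP[x sx /wsweepP[w Ww wz]].
  have E : x = y.
    apply: (inj x y _ _ (v^-1 * w)); rewrite ?inE ?eqxx ?sx ?orbT ?groupM ?groupV //.
    rewrite -wz permM; apply: key_W => //; rewrite -(permK v z); apply: key_W; rewrite ?groupV //.
  by rewrite -E sx in s'y.
- by apply/free_block/typ; rewrite inE eqxx.
apply: IHs => // [z sz | z x sz sx]; first by apply: typ; rewrite inE sz orbT.
by apply: inj; rewrite inE ?sz ?sx orbT.
Qed.
End Decomposition.

(** * Wreath products with a group of order 2 *)

Section SmallGroups.
Lemma isog_Cyc p (gT : finGroupType) (G : {group gT}) : prime p -> #|G| = p -> G \isog Cyc p.
Proof.
move=> pr cG; have oZ : #|Cyc p| = p by rewrite cardsT card_ord Zp_cast ?prime_gt1.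
rewrite isog_cyclic_card ?prime_cyclic ?cG ?oZ //=.
Qed.

Lemma isog_Cyc2 (gT : finGroupType) (t : gT) : t != 1 -> t * t = 1 -> <[t]> \isog Cyc 2.
Proof. by move=> n1 t2; apply: isog_Cyc => //; apply: nt_prime_order; rewrite // expgS. Qed.

Lemma mem_cycle2 (gT : finGroupType) (t x : gT) : t * t = 1 -> x \in <[t]> -> x = 1 \/ x = t.
Proof.
move=> t2 /cycleP[k ->]; rewrite -[k]odd_double_half expgD -mul2n expgM.
have -> : t ^+ 2 = 1 by rewrite expgS.
by rewrite expg1n mulg1; case: odd; [right | left].
Qed.

Lemma abelem2_setX (aT bT : finGroupType) (A : {group aT}) (B : {group bT}) :
  2.-abelem A -> 2.-abelem B -> 2.-abelem (A \X B)%G.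
Proof.
move=> /(abelemP (isT : prime 2))[/centsP cA eA] /(abelemP (isT : prime 2))[/centsP cB eB].
apply/(abelemP (isT : prime 2)); split=> [|[a b]].
  apply/centsP => -[a b] + [a' b'] /=; rewrite !inE /= => /andP[Aa Bb] /andP[Aa' Bb'].
  by congr pair; [apply: cA | apply: cB].
rewrite inE /= => /andP[/eA Aa /eB Bb].
by rewrite -[LHS]/((a ^+ 2, b ^+ 2)) Aa Bb.
Qed.

Lemma abelem_Cyc2 : 2.-abelem (Cyc 2).
Proof. by apply: prime_abelem; rewrite // cardsT card_ord. Qed.

Lemma card_Cyc2 : #|Cyc 2| = 2. Proof. by rewrite cardsT card_ord. Qed.

(** The presentation makes the group an image of the dihedral group of order 8. The product [x * y]
    has order 4, and if it generated the whole group then [x] and [y] would commute. *)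
Lemma dihedral8 (gT : finGroupType) (x y : gT) : x * x = 1 -> y * y = 1 ->
  x * y <> y * x -> (x * y) ^+ 4 = 1 -> #|<<[set x; y]>>| = 8 /\ <<[set x; y]>> \isog [set: 'D_8].
Proof.
move=> x2 y2 nxy xy4; pose D := <<[set x; y]>>%G.
have Dx : x \in D by rewrite mem_gen ?set21. have Dy : y \in D by rewrite mem_gen ?set22.
have homD : D \homg [set: 'D_8].
  rewrite (@Grp'_dihedral 4) //; apply/existsP; exists (x, y).
  by rewrite /= !xpair_eqE joing_idl joing_idr -[x ^+ 2]/(x * x) -[y ^+ 2]/(y * y) x2 y2 xy4 !eqxx.
have c8 : #|[set: 'D_8]| = 8 by apply: (@card_dihedral 4).
suff cD : #|D| = 8 by split=> //; rewrite isogEcard homD c8 cD.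
have o4 : #[x * y] = 4.
  have d4 : #[x * y] %| 4 by rewrite order_dvdn xy4.
  have n2 : (x * y) ^+ 2 != 1.
    apply/eqP => E; apply: nxy; apply: (mulgI (x * y)); rewrite -[LHS]/((x * y) ^+ 2) E.
    by rewrite mulgA -(mulgA x) y2 mulg1 x2.
  have : ~~ (#[x * y] %| 2) by rewrite order_dvdn.
  by move: d4 (dvdn_leq (isT : 0 < 4) d4); case: #[x * y] => [|[|[|[|[|]]]]].
have d8 : #|D| %| 8 by rewrite -c8 card_homg.
have d4 : 4 %| #|D| by rewrite -o4 cardSg // cycle_subG groupM.
have [k ck] := dvdnP d4; rewrite ck in d8 *.
have k2 : k <= 2 by rewrite -(@leq_pmul2r 4) // (dvdn_leq _ d8).
case: k k2 => [|[|[|]]] // _ in d8 ck *.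
have /eqP E : <[x * y]> == D by rewrite eqEcard cycle_subG groupM //= -[#|<[_]>|]/#[_] o4 ck.
have /centsP cD : abelian D by rewrite -E cycle_abelian.
by case: nxy; apply: cD.
Qed.
End SmallGroups.

Section Splitting.
Variables (gT rT : finGroupType) (G H : {group gT}) (f : gT -> rT).
Hypotheses (fM : {in G &, {morph f : x y / x * y}}) (sHG : H \subset G).
Hypotheses (fH1 : forall x, x \in H -> f x = 1 -> x = 1)
  (fH : forall x, x \in G -> exists2 h, h \in H & f h = f x).

(** [f] is injective on [H] and has the same image on [H] as on [G], so [H] is a complement of the
    kernel. *)
Lemma sdprod_ker : exists K : {group gT}, K ><| H = G /\
  forall x, (x \in K) = (x \in G) && (f x == 1).
Proof.
pose phi := Morphism fM.
have kE x : (x \in 'ker phi) = (x \in G) && (f x == 1) by rewrite !inE.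
exists ('ker phi)%G; split=> //.
have nK : H \subset 'N('ker phi) := subset_trans sHG (ker_norm phi).
have tK : 'ker phi :&: H = 1.
  apply/trivgP/subsetP => x /setIP[]; rewrite kE inE => /andP[_ /eqP fx] Hx.
  by rewrite (fH1 Hx fx).
rewrite (sdprodE nK tK); apply/eqP; rewrite eqEsubset mul_subG ?subsetIl //; apply/subsetP => x Gx.
have [h Hh E] := fH Gx; have Gh := subsetP sHG _ Hh.
rewrite -(mulgKV h x) mem_mulg // kE groupM ?groupV //=.
have fV : f h^-1 = (f h)^-1 by apply: (morphV phi).
by rewrite fM ?groupV // fV E mulgV.
Qed.
End Splitting.

Lemma sdprod_ker2 (gT : finGroupType) (G : {group gT}) (f : gT -> bool) t :
  {in G &, {morph f : x y / x * y >-> x (+) y}} -> t \in G -> t * t = 1 -> f t ->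
  exists K : {group gT}, [/\ K ><| <[t]> = G, <[t]> \isog Cyc 2, #|G| = #|K|.*2 &
  forall x, (x \in K) = (x \in G) && ~~ f x].
Proof.
move=> fM Gt t2 ft; have f1 : f 1 = false by have := fM 1 1 (group1 _) (group1 _); rewrite mulg1; case: (f 1).
have n1 : t != 1 by apply: contraTneq ft => ->; rewrite f1.
have [||x Gx|K [dK kE]] := @sdprod_ker _ bool G <[t]>%G f fM.
- by rewrite cycle_subG.
- by move=> x /(mem_cycle2 t2)[] // ->; rewrite ft.
- by case: (boolP (f x)) => fx; [exists t; rewrite ?cycle_id // ft | exists 1; rewrite ?group1 // f1].
have isoC := isog_Cyc2 n1 t2.
exists K; split=> // [|x]; last by rewrite kE; case: (f x).
by rewrite -(sdprod_card dK) (card_isog isoC) card_Cyc2 muln2.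
Qed.

Section Hyperoctahedral.
Variable m : nat.
Local Notation X := ('I_m * bool)%type.
(** The signed permutations of [m] coordinates, the Weyl group of type B_m. Below, [es] gives the
    sign changes, [ps] the unsigned permutations and [top] the quotient map onto S_m. *)
Definition hyp : {group {perm X}} := wreath (true, m).
Local Notation W := hyp.
Implicit Types (w : {perm X}) (s : {perm 'I_m}) (e : {ffun 'I_m -> bool}).

Lemma hypP w : reflect (forall x, w (x.1, ~~ x.2) = ((w x).1, ~~ (w x).2)) (w \in W).
Proof. exact: (centsetP (fun x : X => (x.1, ~~ x.2)) w). Qed.

Lemma es_subproof e : involutive (fun x : X => (x.1, x.2 (+) e x.1)).
Proof. by case=> i b; rewrite /= -addbA addbb addbF. Qed.
Definition es e : {perm X} := perm (inv_inj (es_subproof e)).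
Lemma esE e x : es e x = (x.1, x.2 (+) e x.1). Proof. by rewrite permE. Qed.
Lemma ps_subproof s : injective (fun x : X => (s x.1, x.2)).
Proof. by move=> [i b] [j c] /= [/perm_inj -> ->]. Qed.
Definition ps s : {perm X} := perm (ps_subproof (s := s)).
Lemma psE s x : ps s x = (s x.1, x.2). Proof. by rewrite permE. Qed.

Lemma es_in e : es e \in W.
Proof. by apply/hypP => x; rewrite !esE /= addNb. Qed.
Lemma ps_in s : ps s \in W.
Proof. by apply/hypP => x; rewrite !psE. Qed.
Lemma psM : {morph ps : s t / s * t}.
Proof. by move=> s t; apply/permP => x; rewrite permM !psE permM. Qed.
Canonical ps_morphism := @Morphism _ _ [set: {perm 'I_m}] ps (in2W psM).
Lemma ps1 : ps 1 = 1. Proof. exact: (morph1 [morphism of ps]). Qed.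
Lemma ps_inj : injective ps.
Proof. by move=> s t E; apply/permP => i; have := psE s (i, true); rewrite E psE => -[->]. Qed.
Lemma esM e e' : es e * es e' = es [ffun i => e i (+) e' i].
Proof. by apply/permP => x; rewrite permM !esE ffunE /= addbA. Qed.
Lemma es_ps s e : ps s * es e = es [ffun i => e (s i)] * ps s.
Proof. by apply/permP => x; rewrite !permM !(psE, esE) ffunE. Qed.
Definition top w : {perm 'I_m} :=
  odflt 1 [pick s : {perm 'I_m} | [forall i, s i == (w (i, false)).1]].
Lemma topE w i b : w \in W -> (w (i, b)).1 = top w i.
Proof.
move/hypP=> Ww; have bE : (w (i, b)).1 = (w (i, false)).1 by case: b; rewrite // (Ww (i, false)).
rewrite bE /top; case: pickP => [s /forallP/(_ i)/eqP-> // | no].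
have inj : injective (fun i => (w (i, false)).1).
  move=> j k E; case: (eqVneq (w (j, false)).2 (w (k, false)).2) => E2.
    have: w (j, false) = w (k, false) by rewrite [LHS]surjective_pairing E E2 -surjective_pairing.
    by move/perm_inj => [].
  have: w (j, false) = w (k, true).
    rewrite (Ww (k, false)) [LHS]surjective_pairing E; congr pair.
    by move: E2; do 2! case: (w _).2.
  by move/perm_inj.
by have /forallP[] := no (perm inj) => j; rewrite permE.
Qed.
Lemma topM : {in W &, {morph top : w v / w * v}}.
Proof.
move=> w v Ww Wv; apply/permP => i; rewrite -(topE _ false) ?groupM // !permM.
by rewrite -(topE _ false Ww) -(topE _ (w (i, false)).2 Wv) -surjective_pairing.
Qed.
Lemma top_ps s : top (ps s) = s.
Proof. by apply/permP => i; rewrite -(topE _ false) ?ps_in // psE. Qed.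
Lemma top_es e : top (es e) = 1.
Proof. by apply/permP => i; rewrite -(topE _ false) ?es_in // esE perm1. Qed.

Lemma hyp_decomp w : w \in W -> exists e, w = es e * ps (top w).
Proof.
move=> Ww; exists [ffun i => (w (i, false)).2]; apply/permP => -[i b].
rewrite permM esE psE ffunE [LHS]surjective_pairing (topE _ _ Ww); congr pair.
by case: b; rewrite //= (hypP _ Ww (i, false)).
Qed.

Lemma card_hyp : #|W| = (2 ^ m * m`!)%N.
Proof.
have -> : W :=: (fun p => es p.1 * ps p.2) @: setT.
  apply/setP => w; apply/idP/imsetP => [/hyp_decomp[e E] | [[e s] _ ->]].
    by exists (e, top w).
  by rewrite groupM ?es_in ?ps_in.
rewrite card_in_imset => [|[e s] [e' s'] _ _ /= E].
  by rewrite cardsT card_prod card_ffun card_bool card_ord card_Sn.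
have st : s = s'.
  by have := congr1 top E; rewrite !topM ?es_in ?ps_in // !top_es !top_ps !mul1g.
move: E; rewrite st => /mulIg E; congr pair; apply/ffunP => i.
by have := congr1 (fun w : {perm X} => (w (i, false)).2) E; rewrite !esE.
Qed.

(** A transposition of coordinates acts on signed points as two disjoint transpositions, one for
    each sign. *)
Lemma odd_ps s : odd_perm (ps s) = false.
Proof.
have [ts -> _] := prod_tpermP s.
elim: ts => [|[i j] ts IHts]; first by rewrite big_nil ps1 odd_perm1.
rewrite big_cons psM odd_permM IHts addbF /=.
have -> : ps (tperm i j) = tperm (i, false) (j, false) * tperm (i, true) (j, true).
  apply/permP => -[k b]; rewrite permM psE /=.
  have inj (c : bool) : (tperm i j k, c) = tperm (i, c) (j, c) (k, c).
    by apply: (inj_tperm (f := fun i => (i, c))) => x y [].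
  have nt c : ~~ c = b -> tperm (i, c) (j, c) (k, b) = (k, b).
    by move=> <-; rewrite tpermD //; apply/eqP => -[_]; case: c.
  case: b nt => nt; first by rewrite (nt false) // -inj.
  by rewrite -(inj false) [tperm (i, true) _ _]tpermD //; apply/eqP => -[].
by rewrite odd_permM !odd_tperm !xpair_eqE !andbT addbb.
Qed.

Definition unit_sign i : {ffun 'I_m -> bool} := [ffun j => j == i].
Lemma odd_unit_sign i : odd_perm (es (unit_sign i)).
Proof.
have -> : es (unit_sign i) = tperm (i, false) (i, true).
  apply/permP => -[j b]; rewrite esE ffunE /=; case: tpermP => [[-> ->]|[-> ->]|].
  - by rewrite eqxx.
  - by rewrite eqxx.
  case: (eqVneq j i) => [->|_ _ _]; last by rewrite addbF.
  by case: b.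
by rewrite odd_tperm xpair_eqE andbF.
Qed.

Lemma es_sq e : es e * es e = 1.
Proof. by apply/permP => x; rewrite permM !esE /= -addbA addbb addbF perm1; case: x. Qed.

(** Permutations of coordinates are even and a single sign change is odd, so these are the elements
    with an even number of sign changes: the Weyl group of type D_m. *)
Definition even_hyp := (W :&: 'Alt_X)%G.
Lemma even_hypE w : (w \in even_hyp) = (w \in W) && ~~ odd_perm w.
Proof. by rewrite in_setI Alt_even. Qed.

Lemma even_hyp_sdprod (i : 'I_m) : exists L : {group {perm X}},
  [/\ even_hyp ><| L = W, L \isog Cyc 2 & #|W| = #|even_hyp|.*2].
Proof.
have [||||K [dK iC cK kE]] := @sdprod_ker2 _ W (@odd_perm _) (es (unit_sign i)).
- by move=> w v _ _; apply: odd_permM.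
- exact: es_in.
- exact: es_sq.
- exact: odd_unit_sign.
have defK : K = even_hyp by apply/val_inj/setP => w; rewrite even_hypE kE.
by exists <[es (unit_sign i)]>%G; rewrite -defK.
Qed.

(** The sign of [top] splits off a transposition of coordinates, then [top] splits off the
    alternating group. What remains consists of sign changes, so it is elementary abelian and known
    by its order. *)
Lemma even_hyp_form (i j : 'I_m) (gT : finGroupType) (E : {group gT}) :
  i != j -> 2.-abelem E -> #|E| = (2 ^ m.-1)%N ->
  form_sdprod (form_sdprod (form_of E) 'Alt_('I_m)) (Cyc 2) _ even_hyp.
Proof.
move=> ij aE cE; have tM : {in even_hyp &, {morph top : w v / w * v}}.
  by move=> w v /setIP[Ww _] /setIP[Wv _]; apply: topM.
have ps_even s : ps s \in even_hyp by rewrite even_hypE ps_in odd_ps.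
have [||||K [dK iC cK kE]] := @sdprod_ker2 _ even_hyp (fun w => odd_perm (top w)) (ps (tperm i j)).
- by move=> w v Ww Wv; rewrite tM // odd_permM.
- exact: ps_even.
- by rewrite -psM tperm2 ps1.
- by rewrite top_ps odd_tperm.
have KW w : w \in K -> w \in W by rewrite kE even_hypE => /andP[/andP[]].
have altK : (ps @* 'Alt_('I_m)) \subset K.
  apply/subsetP => _ /morphimP[s _ + ->]; rewrite Alt_even => es.
  by rewrite kE ps_even top_ps.
have psI (A : {group {perm 'I_m}}) : ps @* A \isog A.
  by rewrite isog_sym sub_isog ?subsetT //; apply/injmP => s t _ _; apply: ps_inj.
have [|//|||N [dN nE]] := @sdprod_ker _ _ K (ps @* 'Alt_('I_m))%G top.
- by move=> w v /KW Ww /KW Wv; apply: topM.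
- by move=> _ /morphimP[s _ _ ->] /=; rewrite top_ps => ->; exact: ps1.
- move=> w; rewrite kE => /andP[_ ew]; exists (ps (top w)); last by rewrite top_ps.
  by apply: mem_morphim; [exact: in_setT | rewrite Alt_even].
have NW w : w \in N -> exists e, w = es e.
  rewrite nE => /andP[/KW /hyp_decomp[e we] /eqP tw].
  by exists e; rewrite we tw ps1 mulg1.
have aN : 2.-abelem N.
  apply/(abelemP (isT : prime 2)); split.
    apply/centsP => w /NW[e ->] v /NW[e' ->]; rewrite /commute !esM; congr es.
    by apply/ffunP => k; rewrite !ffunE addbC.
  by move=> w /NW[e ->]; apply: es_sq.
exists K, <[ps (tperm i j)]>%G; split=> //.
exists N, (ps @* 'Alt_('I_m))%G; split; [exact: dN | | exact: psI].
rewrite /form_of (isog_abelem_card _ aN) aE cE eqn_leq.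
have c1 := card_hyp; have [L [_ _ c2]] := even_hyp_sdprod i.
have c3 := sdprod_card dN; have c4 := card_isog (psI 'Alt_('I_m)%G).
have m1 : 1 < m by move: ij (ltn_ord i) (ltn_ord j); rewrite -val_eqE /=; lia.
have := @card_Alt 'I_m; rewrite card_ord => /(_ m1) c5.
have c6 : (2 ^ m = 2 * 2 ^ m.-1)%N by rewrite -expnS prednK // ltnW.
(* Two steps of index 2 lead from [hyp m] to [K], which accounts for the factor 4; on the other side
   [2 ^ m] and [m!] give one factor 2 each. *)
have c7 : (4 * (#|N| * #|'Alt_('I_m)|) = 4 * (2 ^ m.-1 * #|'Alt_('I_m)|))%N.
  rewrite -[in LHS]c4 c3; move: c1; rewrite c2 cK c6 -c5 => c1; lia.
have a0 : 0 < #|'Alt_('I_m)| by rewrite cardG_gt0.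
suff -> : #|N| = (2 ^ m.-1)%N by rewrite leqnn.
by apply/eqP; rewrite -(eqn_pmul2r a0) -(@eqn_pmul2l 4) // c7.
Qed.
End Hyperoctahedral.

Section Involutions.
Variables (gT : finGroupType) (G K : {group gT}) (z : gT).
Hypotheses (sKG : K \subset G) (Gz : z \in G) (Kz : z \notin K) (z2 : z * z = 1)
  (cG : #|G| = #|K|.*2).

Lemma cycle_notin : #|<[z]>| = 2 /\ K :&: <[z]> = 1.
Proof.
have z1 : z != 1 by apply: (contraNneq _ Kz) => ->; rewrite group1.
split; first by rewrite (card_isog (isog_Cyc2 z1 z2)) card_Cyc2.
apply/trivgP/subsetP => x /setIP[Kx /(mem_cycle2 z2)[->|xz]]; first exact: set11.
by move: Kz; rewrite -xz Kx.
Qed.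

Lemma mul_cycle_notin : K * <[z]> = G.
Proof.
have [c2 tK] := cycle_notin; apply/eqP; rewrite eqEcard mul_subG ?cycle_subG //=.
by rewrite TI_cardMg // c2 muln2 cG.
Qed.

Lemma sdprod_index2 : K ><| <[z]> = G.
Proof.
have [_ tK] := cycle_notin.
have /normal_norm nK : K <| G.
  by apply: index2_normal => //; rewrite -divgS // cG -muln2 mulKn ?cardG_gt0.
by rewrite (sdprodE _ tK) ?mul_cycle_notin // cycle_subG (subsetP nK).
Qed.

Lemma dprod_index2 : z \in 'C(K) -> <[z]> \x K = G.
Proof.
move=> zC; have [_ tK] := cycle_notin; have cK : <[z]> \subset 'C(K) by rewrite cycle_subG.
by rewrite dprodC dprodE // mul_cycle_notin.
Qed.
End Involutions.

(** The square of [es e * ps s] is the sign change by the sum of [e] and its translate under [s],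
    hence has square 1; the two involutions do not commute because [e] is not invariant under
    [s]. *)
Lemma hyp_dihedral m (e : {ffun 'I_m -> bool}) (s : {perm 'I_m}) i : s * s = 1 -> e (s i) != e i ->
  #|<<[set es e; ps s]>>| = 8 /\ <<[set es e; ps s]>> \isog [set: 'D_8].
Proof.
move=> s2 ei; have p2 : ps s * ps s = 1 by rewrite -psM s2 ps1.
apply: dihedral8 => //; first exact: es_sq.
  rewrite es_ps => /mulIg E; case/eqP: ei.
  have := congr1 (fun w : {perm 'I_m * bool} => (w (i, false)).2) E.
  by rewrite !esE ffunE.
have t2 : (es e * ps s) ^+ 2 = es [ffun j => e j (+) [ffun i => e (s i)] j].
  rewrite -[LHS]/((es e * ps s) * (es e * ps s)) mulgA -(mulgA (es e)) es_ps.
  by rewrite mulgA -(mulgA _ (ps s)) p2 mulg1 esM.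
by rewrite (expgD _ 2 2) t2 es_sq.
Qed.

Lemma es_central m (w : {perm 'I_m * bool}) : w \in hyp m -> commute (es [ffun => true]) w.
Proof.
move/hypP => Ww; apply/permP => x; rewrite !permM !esE !ffunE !addbT.
by rewrite -Ww.
Qed.

(** * C_2 wr S_3 as C_2 x S_4 *)

Local Notation X3 := ('I_3 * bool)%type.
(** The six signed points are read as the pairs in {0, 1, 2, 3}: [(i, false)] is {i, 3} and
    [(i, true)] is its complement. [pu] and [pv] give the two members of a pair, and [pt] recovers
    the point from them. *)
Definition pu (p : X3) : 'I_4 :=
  if p.2 then (if p.1 == 0 :> nat then @Ordinal 4 1 isT else @Ordinal 4 0 isT) else lift ord_max p.1.
Definition pv (p : X3) : 'I_4 :=
  if p.2 then (if p.1 == 2 :> nat then @Ordinal 4 1 isT else @Ordinal 4 2 isT) else ord_max.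
Definition pt (x y : 'I_4) : X3 :=
  match nat_of_ord x, nat_of_ord y with
  | 1, 3 | 3, 1 => (@Ordinal 3 1 isT, false) | 2, 3 | 3, 2 => (@Ordinal 3 2 isT, false)
  | 1, 2 | 2, 1 => (@Ordinal 3 0 isT, true) | 0, 2 | 2, 0 => (@Ordinal 3 1 isT, true)
  | 0, 1 | 1, 0 => (@Ordinal 3 2 isT, true)
  | _, _ => (@Ordinal 3 0 isT, false)
  end.

Lemma ptC x y : pt x y = pt y x.
Proof. by case: x => -[|[|[|[|x]]]] // ?; case: y => -[|[|[|[|y]]]] // ?. Qed.
Lemma ptP x y : x != y -> (pu (pt x y), pv (pt x y)) \in [:: (x, y); (y, x)].
Proof. by case: x => -[|[|[|[|x]]]] // ?; case: y => -[|[|[|[|y]]]] // ?. Qed.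
Lemma ptK p : pt (pu p) (pv p) = p.
Proof. by apply/eqP; case: p => i []; case: i => -[|[|[|i]]] // ?. Qed.
Lemma pu_neq p : pu p != pv p. Proof. by case: p => i []; case: i => -[|[|[|i]]] // ?. Qed.
Lemma pt_compl x y z t : uniq [:: x; y; z; t] =
  [&& x != y, z != t & pt z t == ((pt x y).1, ~~ (pt x y).2)].
Proof.
by case: x => -[|[|[|[|x]]]] // ?; case: y => -[|[|[|[|y]]]] // ?; case: z => -[|[|[|[|z]]]] // ?; case: t => -[|[|[|[|t]]]] // ?.
Qed.

Section FourPoints.
Implicit Types (s : {perm 'I_4}) (p : X3).
Definition pairact_fun s p := pt (s (pu p)) (s (pv p)).
Lemma pairact_pt s x y : x != y -> pairact_fun s (pt x y) = pt (s x) (s y).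
Proof.
rewrite /pairact_fun => /ptP; rewrite !inE => /orP[] /eqP[-> ->] //.
exact: ptC.
Qed.
Lemma pairact_funM s t p : pairact_fun t (pairact_fun s p) = pairact_fun (s * t) p.
Proof. by rewrite pairact_pt ?(inj_eq perm_inj) ?pu_neq // /pairact_fun !permM. Qed.
Lemma pairact_fun1 p : pairact_fun 1 p = p.
Proof. by rewrite /pairact_fun !perm1 ptK. Qed.
Lemma pairact_inj s : injective (pairact_fun s).
Proof.
by apply: (can_inj (g := pairact_fun s^-1)) => p; rewrite pairact_funM mulgV pairact_fun1.
Qed.
Definition pairact s := perm (@pairact_inj s).
Lemma pairactE s x y : x != y -> pairact s (pt x y) = pt (s x) (s y).
Proof. by move=> xy; rewrite permE pairact_pt. Qed.
Lemma pairactM : {morph pairact : s t / s * t}.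
Proof. by move=> s t; apply/permP => p; rewrite permM !permE pairact_funM. Qed.
Canonical pairact_morphism := @Morphism _ _ [set: {perm 'I_4}] pairact (in2W pairactM).

Lemma pairact_hyp s : pairact s \in hyp 3.
Proof.
apply/hypP => p; pose q := (p.1, ~~ p.2).
have : uniq [:: pu p; pv p; pu q; pv q] by rewrite pt_compl !pu_neq !ptK eqxx.
rewrite -(map_inj_uniq (@perm_inj _ s)) [map _ _]/= pt_compl.
by case/and3P=> _ _ /eqP; rewrite !permE.
Qed.

Lemma neq2_4 (x y : 'I_4) : exists2 z, z != x & z != y.
Proof.
case: (pickP (fun z => (z != x) && (z != y))) => [z /andP[] | no]; first by exists z.
have : #|[set x; y]| < #|'I_4| by rewrite cards2 card_ord; case: eqP.
suff -> : [set x; y] = [set: 'I_4] by rewrite cardsT ltnn.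
by apply/setP => z; rewrite !inE; have := no z; case: eqP; case: eqP.
Qed.

Lemma pairact_faithful s : pairact s = 1 -> s = 1.
Proof.
move=> E; apply/permP => x; rewrite perm1; apply/eqP/negPn/negP => sx.
have [y yx ysx] := neq2_4 x (s x); have xy : x != y by rewrite eq_sym.
have Ep : pt (s x) (s y) = pt x y by rewrite -(pairactE s xy) E perm1.
have := ptP xy; have := @ptP (s x) (s y); rewrite (inj_eq perm_inj) Ep => /(_ xy).
rewrite !inE => /orP[] /eqP[-> ->] /orP[] /eqP[E1 E2].
- by rewrite E1 eqxx in sx.
- by rewrite E1 eqxx in ysx.
- by rewrite E2 eqxx in ysx.
by rewrite E2 eqxx in sx.
Qed.

(** If [s] took every pair to its complement, then [s x] would avoid every pair {x, y}, in
    particular the one with [y = s x]. *)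
Lemma pairact_neg s : pairact s <> es [ffun => true].
Proof.
move=> E; pose x : 'I_4 := ord0.
have H y : x != y -> s x != x /\ s x != y.
  move=> xy; have := pairactE s xy; rewrite E esE ffunE addbT => /esym/eqP pE.
  have : uniq [:: x; y; s x; s y] by rewrite pt_compl xy (inj_eq perm_inj) xy pE.
  rewrite /= !inE !negb_or => /andP[/and3P[_ xa _] /andP[/andP[ya _] _]].
  by split; rewrite eq_sym.
have [y yx _] := neq2_4 x x; rewrite eq_sym in yx; have [sx _] := H y yx.
by have [|_] := H (s x); rewrite ?eqxx // eq_sym.
Qed.

(** The faithful image of S_4 acting on pairs has order 24, half of 48, and does not contain the
    central element that changes all signs. *)
Lemma hyp3_dprod : exists A B : {group {perm X3}},
  [/\ A \x B = hyp 3, A \isog Cyc 2 & B \isog 'Sym_('I_4)].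
Proof.
pose B := (pairact @* 'Sym_('I_4))%G; pose z : {perm X3} := es [ffun => true].
have isoB : B \isog 'Sym_('I_4).
  rewrite isog_sym sub_isog ?subsetT //; apply/subsetP => s; rewrite !inE => /eqP.
  by move/pairact_faithful->.
have cB : #|B| = 24 by rewrite (card_isog isoB) cardsT card_Sn.
have zB : z \notin B by apply/negP => /morphimP[s _ _ /esym/pairact_neg].
have sB : B \subset hyp 3 by apply/subsetP => _ /morphimP[s _ _ ->]; apply: pairact_hyp.
have z2 : z * z = 1 by apply: es_sq.
exists <[z]>%G, B; split=> //; last first.
  by apply: isog_Cyc2 => //; apply: contraNneq zB => ->; rewrite group1.
apply: (dprod_index2 sB _ zB z2); first exact: es_in.
  by rewrite cB card_hyp.
by apply/centP => w /(subsetP sB); apply: es_central.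
Qed.
End FourPoints.

(** * C_2 wr S_4 as an iterated semidirect product *)

Section HyperFour.
Local Notation X4 := ('I_4 * bool)%type.
Implicit Types (w : {perm X4}) (s : {perm 'I_4}) (t : {perm 'I_3}).

(* The action of S_4 on the three splittings of {0, 1, 2, 3} into two pairs. *)
Definition split4 s : {perm 'I_3} := top (pairact s).
Lemma split4M : {morph split4 : s t / s * t}.
Proof. by move=> s t; rewrite /split4 pairactM topM ?pairact_hyp. Qed.

Lemma split4E s i : split4 s i = (pt (s (lift ord_max i)) (s ord_max)).1.
Proof. by rewrite -(topE _ false (pairact_hyp s)) permE. Qed.

Definition lift4 t : {perm 'I_4} := lift_perm ord_max ord_max t.
Lemma lift4M : {morph lift4 : s t / s * t}.
Proof. by move=> s t; rewrite /lift4 lift_permM. Qed.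
Lemma split4_lift t : split4 (lift4 t) = t.
Proof.
apply/permP => i; rewrite split4E /lift4 lift_perm_lift lift_perm_id.
by have /(congr1 fst) := ptK (t i, false).
Qed.

Definition splithyp w := split4 (top w).
Lemma splithypM : {in hyp 4 &, {morph splithyp : w v / w * v}}.
Proof. by move=> w v Ww Wv; rewrite /splithyp topM // split4M. Qed.
Lemma splithyp_ps s : splithyp (ps s) = split4 s. Proof. by rewrite /splithyp top_ps. Qed.
Lemma splithyp_es (e : {ffun 'I_4 -> bool}) : splithyp (es e) = 1.
Proof. by rewrite /splithyp top_es; apply: (mulgI (split4 1)); rewrite -split4M !mulg1. Qed.

Local Notation o k := (@Ordinal 4 k isT).
(** Generators of the Klein four-group, which fixes the three splittings. *)
Definition kleina : {perm 'I_4} := tperm (o 0) (o 1) * tperm (o 2) (o 3).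
Definition kleinb : {perm 'I_4} := tperm (o 0) (o 2) * tperm (o 1) (o 3).

Lemma ord4P (i : 'I_4) : [\/ i = o 0, i = o 1, i = o 2 | i = o 3].
Proof.
case: i => -[|[|[|[|i]]]] // ?;
  by [constructor 1; apply/val_inj | constructor 2; apply/val_inj
     | constructor 3; apply/val_inj | constructor 4; apply/val_inj].
Qed.

Lemma kleinaE : [/\ kleina (o 0) = o 1, kleina (o 1) = o 0, kleina (o 2) = o 3 & kleina (o 3) = o 2].
Proof. by split; apply/val_inj; rewrite /= permM !permE /= ?permE. Qed.
Lemma kleinbE : [/\ kleinb (o 0) = o 2, kleinb (o 1) = o 3, kleinb (o 2) = o 0 & kleinb (o 3) = o 1].
Proof. by split; apply/val_inj; rewrite /= permM !permE /= ?permE. Qed.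

Lemma klein_rel : [/\ kleina * kleina = 1, kleinb * kleinb = 1 & kleina * kleinb = kleinb * kleina].
Proof.
have [a0 a1 a2 a3] := kleinaE; have [b0 b1 b2 b3] := kleinbE.
split; apply/permP => i.
- by rewrite permM perm1; case: (ord4P i) => ->; rewrite ?(a0, a1, a2, a3).
- by rewrite permM perm1; case: (ord4P i) => ->; rewrite ?(b0, b1, b2, b3).
by rewrite permM [RHS]permM; case: (ord4P i) => ->; rewrite ?(a0, a1, a2, a3, b0, b1, b2, b3).
Qed.

Lemma split4_klein : split4 kleina = 1 /\ split4 kleinb = 1.
Proof.
have [a0 a1 a2 a3] := kleinaE; have [b0 b1 b2 b3] := kleinbE.
have m3 : ord_max = o 3 by apply/val_inj.
have l (k : 'I_3) j : nat_of_ord k = nat_of_ord j -> lift (o 3) k = j :> 'I_4.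
  by move=> E; apply/val_inj; rewrite /= /bump leqNgt ltn_ord add0n.
split; apply/permP => i; rewrite perm1 split4E m3 ?a3 ?b3; apply/eqP;
  case: i => -[|[|[|i]]] // lti; [rewrite (l _ (o 0)) | rewrite (l _ (o 1)) | rewrite (l _ (o 2))
    | rewrite (l _ (o 0)) | rewrite (l _ (o 1)) | rewrite (l _ (o 2))] => //;
  by rewrite ?(a0, a1, a2, b0, b1, b2).
Qed.

Definition sign02 : {ffun 'I_4 -> bool} := [ffun i => (i == o 0) || (i == o 2)].
Definition sign01 : {ffun 'I_4 -> bool} := [ffun i => (i == o 0) || (i == o 1)].

(** The factors split off from the outside are a sign change, then a transposition and the 3-cycles
    of the quotient S_3 acting on splittings. The remaining group [P] of order 32 is the central
    product of two dihedral groups of order 8, [<<x, a>>] and [<<u, b>>], which share the element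
    changing all signs. *)
Lemma hyp4_form :
  form_sdprod (form_sdprod (form_sdprod (form_sdprod (form_of (Cyc 2 \X 'D_8)) (Cyc 2))
    (Cyc 3)) (Cyc 2)) (Cyc 2) _ (hyp 4).
Proof.
have [a0 a1 a2 a3] := kleinaE; have [b0 b1 b2 b3] := kleinbE.
have [aa bb ab] := klein_rel; have [fa fb] := split4_klein.
pose E0 := even_hyp 4; have [L [dE iL cE]] := even_hyp_sdprod (o 0).
have EW w : w \in E0 -> w \in hyp 4 by case/setIP.
have psE0 s : ps s \in E0 by rewrite even_hypE ps_in odd_ps.
pose t01 : {perm 'I_3} := tperm ord0 (@Ordinal 3 1%N isT).
have [||||M [dM iM cM ME]] := @sdprod_ker2 _ E0 (fun w => odd_perm (splithyp w)) (ps (lift4 t01)).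
- by move=> w v /EW Ww /EW Wv; rewrite splithypM // odd_permM.
- exact: psE0.
- by rewrite -psM -lift4M tperm2 /lift4 lift_perm1 ps1.
- by rewrite splithyp_ps split4_lift odd_tperm.
have MW w : w \in M -> w \in hyp 4 by rewrite ME => /andP[/EW].
pose g t := ps (lift4 t).
have gM : {in [set: {perm 'I_3}] &, {morph g : s t / s * t}}.
  by move=> s t _ _; rewrite /g lift4M psM.
pose gm := Morphism gM; pose H := (gm @* 'Alt_('I_3))%G.
have gs t : splithyp (g t) = t by rewrite splithyp_ps split4_lift.
have ginj : injective g by apply: can_inj gs.
have iH : H \isog Cyc 3.
  apply: isog_Cyc => //; rewrite card_injm ?subsetT //; last by apply/injmP => s t _ _; apply: ginj.
  by have := @card_Alt 'I_3; rewrite card_ord => /(_ isT); set c := #|_|; rewrite !factS fact0; lia.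
(* [P] consists of the even signed permutations that fix the three splittings: 8 sign changes times
   the Klein four-group. *)
have [|||| P [dP PE]] := @sdprod_ker _ _ M H splithyp.
- by move=> w v /MW Ww /MW Wv; apply: splithypM.
- apply/subsetP => _ /morphimP[t _ + ->]; rewrite Alt_even => et.
  by rewrite ME psE0 /= gs.
- by move=> _ /morphimP[t _ _ ->] /=; rewrite gs => ->; rewrite -[1]/(1 : {perm 'I_3}) /g /lift4 lift_perm1 ps1.
- move=> w; rewrite ME => /andP[_ ew]; exists (g (splithyp w)); last exact: gs.
  by apply: mem_morphim; [exact: in_setT | rewrite Alt_even].
exists E0, L; split=> //; exists M, <[ps (lift4 t01)]>%G; split=> //; exists P, H; split=> //.
have cP : #|P| = 32.
  have c4 : #|hyp 4| = 384 by rewrite card_hyp.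
  have c3 : #|Cyc 3| = 3 by rewrite cardsT card_ord.
  have c5 : #|E0| = #|even_hyp 4| by [].
  have c6 : (#|P| * 3)%N = #|M| by rewrite -(sdprod_card dP) (card_isog iH) c3.
  have c7 : #|M|.*2.*2 = 384 by rewrite -cM -c4 cE c5.
  by apply/eqP; rewrite -(@eqn_pmul2r 3) // c6 -[#|M|]doubleK -[#|M|.*2]doubleK c7.
(* [kleina] preserves [sign01] and [kleinb] preserves [sign02], but not the other way round: this
   gives two noncommuting pairs that centralise each other. *)
pose x := es sign02; pose a := ps kleina; pose u := es sign01; pose b := ps kleinb.
have [cD iD] : #|<<[set x; a]>>| = 8 /\ <<[set x; a]>> \isog [set: 'D_8].
  by apply: (hyp_dihedral (i := o 0) aa); rewrite !ffunE a0.
pose D := <<[set x; a]>>%G.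
have commE (e : {ffun 'I_4 -> bool}) s : e = [ffun i => e (s i)] -> commute (es e) (ps s).
  by move=> ee; rewrite /commute es_ps -ee.
have ua : commute u a.
  apply: commE; apply/ffunP => i; rewrite !ffunE.
  by case: (ord4P i) => ->; rewrite ?(a0, a1, a2, a3).
have ux : commute u x.
  by rewrite /commute !esM; congr es; apply/ffunP => i; rewrite !ffunE addbC.
have bx : commute x b.
  apply: commE; apply/ffunP => i; rewrite !ffunE.
  by case: (ord4P i) => ->; rewrite ?(b0, b1, b2, b3).
have ba : commute a b by rewrite /commute -!psM ab.
have ub : ~ commute u b.
  move=> E; have := congr1 (fun w : {perm X4} => (w (o 0, false)).2) E.
  by rewrite !permM !(esE, psE) /= !ffunE b0.
have DC v : commute v x -> commute v a -> v \in 'C(D).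
  by move=> vx va; rewrite /D /= cent_gen; apply/centP => w /set2P[] ->.
have Du : u \in 'C(D) by apply: DC.
have Db : b \in 'C(D) by apply: DC; apply: commute_sym.
(* [b] centralises [D] but does not commute with [u]. *)
have uD : u \notin D by apply/negP => /(centP Db)/commute_sym.
have uu : u * u = 1 := es_sq _.
have [cu tu] := cycle_notin uD uu.
have cDu : D \subset 'C(<[u]>) by rewrite centsC cycle_subG.
have dK : <[u]> \x D = <[u]> <*> D by rewrite dprodEY // setIC.
pose K := (<[u]> <*> D)%G.
have cK : #|K| = 16 by rewrite -(dprod_card dK) cu cD.
have PE' w : w \in E0 -> splithyp w = 1 -> w \in P.
  by move=> Ew fw; rewrite PE ME Ew fw odd_perm1 eqxx.
have esEven (e : {ffun 'I_4 -> bool}) i j : i != j -> e = [ffun k => (k == i) || (k == j)] -> es e \in P.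
  move=> ij ee; apply: PE'; last exact: splithyp_es.
  rewrite even_hypE es_in /=; have -> : es e = es (unit_sign i) * es (unit_sign j).
    rewrite esM ee; congr es; apply/ffunP => k; rewrite !ffunE.
    by case: eqP => // ->; rewrite (negbTE ij).
  by rewrite odd_permM !odd_unit_sign.
have KP : K \subset P.
  rewrite join_subG cycle_subG gen_subG; apply/andP; split; first exact: (esEven _ (o 0) (o 1)).
  apply/subsetP => w /set2P[] ->; first exact: (esEven _ (o 0) (o 2)).
  by apply: PE'; rewrite ?psE0 // splithyp_ps.
have bP : b \in P by apply: PE'; rewrite ?psE0 // splithyp_ps.
have KC : K \subset 'C[u].
  have cDu1 : D \subset 'C[u] by rewrite -cent_cycle.
  by rewrite join_subG cycle_subG cent1id /=.
(* [K] centralises [u], and [b] does not. *)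
have bK : b \notin K by apply/negP => /(subsetP KC)/cent1P/commute_sym.
have bsq : b * b = 1 by rewrite -psM bb ps1.
exists K, <[b]>%G; split.
- by apply: sdprod_index2 => //; rewrite cK cP.
- apply: (isog_dprod dK (setX_dprod (Cyc 2) [set: 'D_8]%G)).
    have n1 : u != 1 by apply: contraNneq uD => ->; rewrite group1.
    exact: isog_trans (isog_Cyc2 n1 uu) (isog_setX1 _ _).
  exact: isog_trans iD (isog_set1X _ _).
by apply: isog_Cyc2 => //; apply: contraNneq bK => ->; rewrite group1.
Qed.
End HyperFour.

(** * SL_3(F_3) as a type of matrices of digits *)
(* Closed boolean tests on this model are decided by conversion alone; row vectors
   are multiplied by matrices on the right, as in MathComp. *)
Inductive f3 := Z3 | O3 | T3.
Inductive v3 := V (x y z : f3).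
Inductive m3 := M (u v w : v3).
Definition add3 x y := match x with
 | Z3 => y
 | O3 => match y with Z3 => O3 | O3 => T3 | T3 => Z3 end
 | T3 => match y with Z3 => T3 | O3 => Z3 | T3 => O3 end end.
Definition opp3 x := match x with Z3 => Z3 | O3 => T3 | T3 => O3 end.
Definition mul3 x y := match x with Z3 => Z3 | O3 => y | T3 => opp3 y end.
Definition vadd u v := let: V a b c := u in let: V a' b' c' := v in V (add3 a a') (add3 b b') (add3 c c').
Definition vopp u := let: V a b c := u in V (opp3 a) (opp3 b) (opp3 c).
Definition vscale x v := match x with Z3 => V Z3 Z3 Z3 | O3 => v | T3 => vopp v end.
Definition vm v A := let: V x y z := v in let: M a b c := A in vadd (vscale x a) (vadd (vscale y b) (vscale z c)).
Definition mm A B := let: M a b c := A in M (vm a B) (vm b B) (vm c B).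
Definition dot u v := let: V a b c := u in let: V a' b' c' := v in add3 (mul3 a a') (add3 (mul3 b b') (mul3 c c')).
Definition cross u v := let: V a b c := u in let: V a' b' c' := v in
  V (add3 (mul3 b c') (opp3 (mul3 c b'))) (add3 (mul3 c a') (opp3 (mul3 a c'))) (add3 (mul3 a b') (opp3 (mul3 b a'))).
Definition det3 A := let: M a b c := A in dot a (cross b c).
Definition trm A := let: M (V a b c) (V a' b' c') (V a'' b'' c'') := A in M (V a a' a'') (V b b' b'') (V c c' c'').
(** The matrix of cofactors, which is the inverse transpose in determinant 1. *)
Definition tau3 A := let: M a b c := A in M (cross b c) (cross c a) (cross a b).
Definition inv3 A := trm (tau3 A).
Definition one3 := M (V O3 Z3 Z3) (V Z3 O3 Z3) (V Z3 Z3 O3).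
Definition eqf x y := match x, y with Z3,Z3 | O3,O3 | T3,T3 => true | _,_ => false end.
Definition eqv u v := let: V a b c := u in let: V a' b' c' := v in if eqf a a' then if eqf b b' then eqf c c' else false else false.
Definition eqm A B := let: M a b c := A in let: M a' b' c' := B in if eqv a a' then if eqv b b' then eqv c c' else false else false.
Definition f3s := [:: Z3; O3; T3].
Definition v3s := [seq V x p.1 p.2 | x <- f3s, p <- [seq (y, z) | y <- f3s, z <- f3s]].
Definition allG := [seq A <- [seq M u p.1 p.2 | u <- v3s, p <- [seq (v, w) | v <- v3s, w <- v3s]] | eqf (det3 A) O3].

Lemma eqfP : Equality.axiom eqf. Proof. by case=> [] []; constructor. Qed.
Lemma eqvP : Equality.axiom eqv.
Proof.
case=> a b c [a' b' c'] /=.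
case: eqfP => [->|?]; last by constructor; case.
case: eqfP => [->|?]; last by constructor; case.
by case: eqfP => [->|?]; constructor => //; case.
Qed.
Lemma eqmP : Equality.axiom eqm.
Proof.
case=> a b c [a' b' c'] /=.
case: eqvP => [->|?]; last by constructor; case.
case: eqvP => [->|?]; last by constructor; case.
by case: eqvP => [->|?]; constructor => //; case.
Qed.
HB.instance Definition _ := hasDecEq.Build f3 eqfP.
HB.instance Definition _ := hasDecEq.Build v3 eqvP.
HB.instance Definition _ := hasDecEq.Build m3 eqmP.

Lemma mem_v3s v : v \in v3s. Proof. by case: v => [[] [] []]. Qed.
Definition isl : pred m3 := fun A => eqf (det3 A) O3.
Lemma islP A : reflect (det3 A = O3) (A \in isl). Proof. exact: eqfP. Qed.
Lemma mem_allG A : (A \in allG) = (A \in isl).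
Proof.
rewrite mem_filter andb_idr // => _; case: A => u v w.
apply/allpairsPdep; exists u, (v, w); split; rewrite ?mem_v3s //.
by apply/allpairsPdep; exists v, w; split; rewrite ?mem_v3s.
Qed.

Section Interpretation.
Local Open Scope ring_scope.
Import GRing.Theory.

Definition fz (x : f3) : 'F_3 := match x with Z3 => 0 | O3 => 1 | T3 => -1 end.
Definition vget (v : v3) (j : nat) := let: V x y z := v in nth Z3 [:: x; y; z] j.
Definition mget (A : m3) (i : nat) := let: M u v w := A in nth (V Z3 Z3 Z3) [:: u; v; w] i.
Definition mx_of (A : m3) : 'M['F_3]_3 := \matrix_(i, j) fz (vget (mget A i) j).

Lemma fzD x y : fz (add3 x y) = fz x + fz y. Proof. by apply/eqP; case: x; case: y. Qed.
Lemma fzN x : fz (opp3 x) = - fz x. Proof. by apply/eqP; case: x. Qed.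
Lemma fzM x y : fz (mul3 x y) = fz x * fz y. Proof. by apply/eqP; case: x; case: y. Qed.
Lemma fz_inj : injective fz.
Proof. by move=> x y /eqP; case: x; case: y. Qed.
Definition zf (a : 'F_3) : f3 := match val a with 0%N => Z3 | 1%N => O3 | _ => T3 end.
Lemma zfK : cancel zf fz.
Proof. by case=> [[|[|[|m]]] lt3] //; apply/val_inj. Qed.

Lemma vget_add u v j : fz (vget (vadd u v) j) = fz (vget u j) + fz (vget v j).
Proof. by case: u => a b c; case: v => a' b' c'; case: j => [|[|[|j]]] /=; rewrite ?fzD ?nth_nil ?addr0. Qed.
Lemma vget_scale x v j : fz (vget (vscale x v) j) = fz x * fz (vget v j).
Proof.
by case: v => a b c; case: j => [|[|[|j]]]; case: x => /=; rewrite ?nth_nil ?mul0r ?mulr0 ?mul1r ?mulN1r ?fzN ?oppr0.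
Qed.

Lemma mget_mm A B i : (i < 3)%N -> mget (mm A B) i = vm (mget A i) B.
Proof. by case: A => u v w; case: i => [|[|[|i]]]. Qed.

Lemma vget_vm v B j : fz (vget (vm v B) j) = \sum_(k < 3) fz (vget v k) * fz (vget (mget B k) j).
Proof.
case: v => x y z; case: B => a b c; rewrite !big_ord_recl big_ord0 addr0 /=.
by rewrite !vget_add !vget_scale.
Qed.

Lemma mx_ofM A B : mx_of (mm A B) = mx_of A *m mx_of B.
Proof.
apply/matrixP => i j; rewrite !mxE mget_mm // vget_vm.
by apply: eq_bigr => k _; rewrite !mxE.
Qed.

Lemma mx_of_inj : injective mx_of.
Proof.
move=> A B /matrixP AB; have E i j (li : (i < 3)%N) (lj : (j < 3)%N) : vget (mget A i) j = vget (mget B i) j.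
  by apply: fz_inj; have := AB (Ordinal li) (Ordinal lj); rewrite !mxE.
case: A B E {AB} => [[a b c] [d e f] [g h i]] [[a' b' c'] [d' e' f'] [g' h' i']] E.
have /= -> := E 0 0 isT isT; have /= -> := E 0 1 isT isT; have /= -> := E 0 2 isT isT.
have /= -> := E 1 0 isT isT; have /= -> := E 1 1 isT isT; have /= -> := E 1 2 isT isT.
by have /= -> := E 2 0 isT isT; have /= -> := E 2 1 isT isT; have /= -> := E 2 2 isT isT.
Qed.
Lemma mx_of_onto (g : 'M['F_3]_3) : exists A, mx_of A = g.
Proof.
pose c i j := zf (g (inord i) (inord j)).
exists (M (V (c 0 0) (c 0 1) (c 0 2)) (V (c 1 0) (c 1 1) (c 1 2)) (V (c 2 0) (c 2 1) (c 2 2)))%N.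
apply/matrixP => i j; rewrite mxE.
have -> : g i j = fz (c i j) by rewrite zfK !inord_val.
by congr fz; case: i => [[|[|[|i]]] //= ?]; case: j => [[|[|[|j]]] //= ?].
Qed.
End Interpretation.

Import GroupScope GRing.Theory.
Section Determinant.
Local Open Scope ring_scope.
Import GRing.Theory.

Lemma det_mx33 (R : comNzRingType) (A : 'M[R]_3) (a := fun i j => A (inord i) (inord j)) :
  \det A = a 0%N 0%N * (a 1%N 1%N * a 2%N 2%N - a 1%N 2%N * a 2%N 1%N)
    + a 0%N 1%N * (a 1%N 2%N * a 2%N 0%N - a 1%N 0%N * a 2%N 2%N)
    + a 0%N 2%N * (a 1%N 0%N * a 2%N 1%N - a 1%N 1%N * a 2%N 0%N).
Proof.
have E (i j : 'I_3) : A i j = a i j by rewrite /a !inord_val.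
rewrite (expand_det_row _ ord0) !big_ord_recl big_ord0 /cofactor.
rewrite !(expand_det_row _ ord0) !big_ord_recl !big_ord0 /cofactor !det_mx11 !mxE !E /=.
clearbody a; rewrite /bump /= ?addn0 ?add0n; ring.
Qed.

Lemma fz_det A : fz (det3 A) = \det (mx_of A).
Proof.
rewrite det_mx33 !mxE !inordK //; case: A => [[a b c] [d e f] [g h i]] /=.
by rewrite !fzD !fzM !fzD !fzM !fzN !fzM addrA.
Qed.
End Determinant.

Lemma mm_assoc : associative mm.
Proof. by move=> A B C; apply: mx_of_inj; rewrite !mx_ofM mulmxA. Qed.

Lemma inv3_check : all (fun A => eqm (mm (inv3 A) A) one3 && eqf (det3 (inv3 A)) O3) allG.
Proof. by vm_cast_no_check (erefl true). Qed.

Definition cgens := [:: M (V O3 O3 Z3) (V Z3 O3 Z3) (V Z3 Z3 O3); M (V Z3 O3 Z3) (V Z3 Z3 O3) (V O3 Z3 Z3)].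
(** A matrix of determinant 1 commuting with both elements of [cgens] is the identity. So the centre
    is trivial and the quotient defining PSL changes nothing. *)
Lemma center_check : all (fun A => all (fun g => eqm (mm A g) (mm g A)) cgens ==> eqm A one3) allG
   && all (fun g => eqf (det3 g) O3) cgens.
Proof. by vm_cast_no_check (erefl true). Qed.

Definition glT : finGroupType := {'GL_3['F_3]}.
Definition slG : {group glT} := SL 3 'F_3.
Definition psl : {group coset_of 'Z(slG)} := PSL 3 'F_3.
Definition toSL (A : m3) : glT := insubd (1%g : {'GL_3['F_3]}) (mx_of A).
Definition toG (A : m3) := coset 'Z(slG) (toSL A).

Section Embedding.
Local Open Scope group_scope.

Lemma val_toSL A : A \in isl -> val (toSL A : {'GL_3['F_3]}) = mx_of A.
Proof.
move/islP=> dA; apply: insubdK.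
by rewrite -topredE /= unitmxE -fz_det dA unitr1.
Qed.

Opaque toSL mx_of.

Lemma mm_in : {in isl &, forall A B, mm A B \in isl}.
Proof.
move=> A B /islP dA /islP dB; apply/islP/fz_inj.
by rewrite fz_det mx_ofM det_mulmx -!fz_det dA dB /= mulr1.
Qed.

Lemma toSLM : {in isl &, {morph toSL : A B / mm A B >-> A * B}}.
Proof.
move=> A B GA GB; apply: val_inj.
by rewrite val_toSL ?mm_in // mx_ofM -(val_toSL GA) -(val_toSL GB).
Qed.

Lemma toSL_inj : {in isl &, injective toSL}.
Proof.
move=> A B GA GB eqAB; apply: mx_of_inj.
by rewrite -(val_toSL GA) eqAB val_toSL.
Qed.

Lemma toSL_onto g : reflect (exists2 A, A \in isl & toSL A = g) (g \in slG).
Proof.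
apply: (iffP idP) => [|[A GA <-]]; last first.
  by rewrite inE val_toSL // -fz_det; have /islP-> := GA.
rewrite inE => /eqP dg; have {}dg : (\det (val (g : {'GL_3['F_3]})) = 1)%R by [].
have [A defA] := mx_of_onto (val (g : {'GL_3['F_3]})); have GA : A \in isl.
  by apply/islP/fz_inj; rewrite fz_det defA dg.
by exists A => //; apply: val_inj; rewrite val_toSL.
Qed.

Lemma inv3_in A : A \in isl -> inv3 A \in isl.
Proof. by rewrite -mem_allG => /(allP inv3_check)/andP[]. Qed.
Lemma mm_inv A : A \in isl -> mm (inv3 A) A = one3.
Proof. by rewrite -mem_allG => /(allP inv3_check)/andP[/eqmP]. Qed.
Lemma one3_in : one3 \in isl. Proof. by []. Qed.
Lemma mx_of1 : mx_of one3 = 1%:M%R.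
Proof.
by apply/matrixP => i j; rewrite !mxE; case: i => [[|[|[|i]]] ?] //; case: j => [[|[|[|j]]] ?] //.
Qed.
Lemma mm1 A : mm A one3 = A.
Proof. by apply: mx_of_inj; rewrite mx_ofM mx_of1 mulmx1. Qed.
Lemma m1m A : mm one3 A = A.
Proof. by apply: mx_of_inj; rewrite mx_ofM mx_of1 mul1mx. Qed.

Lemma toSL1 : toSL one3 = 1.
Proof. by apply: (mulgI (toSL one3)); rewrite -toSLM ?one3_in // mm1 mulg1. Qed.

Lemma toSL_in A : A \in isl -> toSL A \in slG.
Proof. by move=> GA; apply/toSL_onto; exists A. Qed.

Lemma center_slG : 'Z(slG) = 1.
Proof.
apply/trivgP/subsetP => _ /setIP[/toSL_onto[A GA <-] /centP cA].
apply/set1P; have /andP[/allP cc /allP cg] := center_check.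
suff comm : all (fun g : m3 => eqm (mm A g) (mm g A)) cgens.
  by have := cc A (etrans (mem_allG A) GA); rewrite comm => /eqmP->; apply: toSL1.
apply/allP => g /cg g1; have Gg : g \in isl by [].
apply/eqmP/(toSL_inj (mm_in GA Gg) (mm_in Gg GA)).
rewrite (toSLM GA Gg) (toSLM Gg GA).
exact: (cA _ (toSL_in Gg)).
Qed.

Lemma toGM : {in isl &, {morph toG : A B / mm A B >-> A * B}}.
Proof.
move=> A B GA GB; rewrite /toG (toSLM GA GB) morphM //.
all: by apply: (subsetP (normal_norm (center_normal _))); apply: toSL_in.
Qed.

Lemma toG_inj : {in isl &, injective toG}.
Proof.
move=> A B GA GB; rewrite /toG => eqAB; apply: (toSL_inj GA GB).
have nZ C : C \in isl -> toSL C \in 'N('Z(slG)).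
  by move=> GC; apply: (subsetP (normal_norm (center_normal _))); apply: toSL_in.
have : toSL A * (toSL B)^-1 \in 'Z(slG).
  by rewrite -mem_rcoset; apply/(rcoset_kercosetP (nZ _ GA) (nZ _ GB)).
by rewrite center_slG => /set1P/eqP; rewrite -eq_mulgV1 => /eqP.
Qed.

Lemma toGP g : reflect (exists2 A, A \in isl & toG A = g) (g \in psl).
Proof.
apply: (iffP morphimP) => [[x _ /toSL_onto[A GA <-] ->] | [A GA <-]]; first by exists A.
exists (toSL A) => //; last exact: toSL_in.
by apply: (subsetP (normal_norm (center_normal _))); apply: toSL_in.
Qed.

End Embedding.

(** * Conjugacy classes, normal forms of pairs and generation, by computation *)

Local Open Scope nat_scope.
Definition cmpf x y := match x, y with Z3,Z3 | O3,O3 | T3,T3 => Eq | Z3,_ => Lt | _,Z3 => Gt | O3,T3 => Lt | T3,O3 => Gt end.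
Definition cmpv u v := let: V a b c := u in let: V a' b' c' := v in match cmpf a a' with Eq => match cmpf b b' with Eq => cmpf c c' | r => r end | r => r end.
Definition cmpm A B := let: M a b c := A in let: M a' b' c' := B in match cmpv a a' with Eq => match cmpv b b' with Eq => cmpv c c' | r => r end | r => r end.
Definition lev u v := match cmpv u v with Gt => false | _ => true end.
Definition lem A B := match cmpm A B with Gt => false | _ => true end.

Definition tr3 A := let: M (V a _ _) (V _ b _) (V _ _ c) := A in add3 a (add3 b c).
(* [A ^ 2 = quad A] means [(A - 1) ^ 2 = 0], since 3 = 0. *)
Definition quad A := let: M a b c := A in
  M (vopp (vadd a (V O3 Z3 Z3))) (vopp (vadd b (V Z3 O3 Z3))) (vopp (vadd c (V Z3 Z3 O3))).
(* A complete invariant of conjugacy classes: [T3] flags the identity, [O3] the other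
   elements with a minimal polynomial of degree at most 2, [Z3] the regular ones, which
   are determined by the traces of [A] and of its inverse. *)
Definition lab A := if eqm A one3 then V T3 Z3 Z3 else
  let A2 := mm A A in
  V (if eqm A2 one3 then O3 else if eqm A2 (quad A) then O3 else Z3) (tr3 A) (tr3 (inv3 A)).
(** The label of the inverse, and also of the inverse transpose: the two traces change places. *)
Definition tlab l := let: V f s t := l in V f t s.
Definition rows v a := let va := vm v a in M v va (vm va a).
(* The bases (v, va, va^2) of determinant 1; each conjugates [a] to its companion matrix. *)
Definition cands a := [seq (g, inv3 g) | g <- [seq g <- [seq rows v a | v <- v3s] | eqf (det3 g) O3]].
Definition cj gg b := mm (mm gg.1 b) gg.2.
Definition minm x y := if lem x y then x else y.
(* For regular [p.1], a canonical representative of the conjugacy class of the pair. *)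
Definition nform (p : m3 * m3) := match cands p.1 with nil => p | g :: gs =>
  (cj g p.1, foldl (fun m h => minm m (cj h p.2)) (cj g p.2) gs) end.
Definition eqp (p q : m3 * m3) := if eqm p.1 q.1 then eqm p.2 q.2 else false.

Definition sq A := mm A A.
Definition base4 a b := [:: mm a b; a; b; mm a (inv3 b)].
Definition mulset s t := [seq mm x y | x <- s, y <- t].
Definition words0 a b := let s := base4 a b in s ++ mulset s s.
Definition words a b := let s := base4 a b in let s2 := mulset s s in let s4 := mulset s2 s2 in s ++ s2 ++ s4 ++ mulset s4 s.
(* The label of a class of elements of order 13, and that of the involutions. *)
Definition L13 := V Z3 Z3 T3.
Definition L2 := V O3 T3 T3.
Definition C13 := M (V Z3 O3 Z3) (V Z3 Z3 O3) (V O3 O3 Z3).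

(* Sets of matrices, as tries on their nine entries. *)
Inductive trie := TE | TL | TN (a b c : trie).
Fixpoint tmem (p : seq f3) t := match p, t with
  | nil, TL => true
  | x :: p', TN a b c => tmem p' match x with Z3 => a | O3 => b | T3 => c end
  | _, _ => false end.
Fixpoint tadd (p : seq f3) t := match p with
  | nil => TL
  | x :: p' => let: (a, b, c) := match t with TN a b c => (a, b, c) | _ => (TE, TE, TE) end in
     match x with Z3 => TN (tadd p' a) b c | O3 => TN a (tadd p' b) c | T3 => TN a b (tadd p' c) end end.
Definition digits A := let: M (V a b c) (V a' b' c') (V a'' b'' c'') := A in [:: a;b;c;a';b';c';a'';b'';c''].
(* The fuel is a list because [allG] is at hand and large numerals in [nat] are slow. *)
Fixpoint bfs (fuel : seq m3) x0 y0 (todo : seq m3) t := match fuel, todo with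
  | _ :: fuel', x :: r => if tmem (digits x) t then bfs fuel' x0 y0 r t
     else bfs fuel' x0 y0 (mm x x0 :: mm x y0 :: r) (tadd (digits x) t)
  | _, _ => t end.
Definition T13 := M (V Z3 Z3 O3) (V Z3 T3 Z3) (V O3 Z3 Z3).

Lemma digits_inj : injective digits.
Proof. by case=> [[a b c] [d e f] [g h i]] [[a' b' c'] [d' e' f'] [g' h' i']] [] *; subst. Qed.
Lemma size_digits A : size (digits A) = 9. Proof. by case: A => [[a b c] [d e f] [g h i]]. Qed.

Lemma tmem_add p q t : size p = size q -> tmem p (tadd q t) -> p = q \/ tmem p t.
Proof.
elim: q p t => [|x q IHq] [|y p] t //=; first by left.
move=> [sz]; have E : tmem p TE = false by case: (p).
case: t => [||a b c]; case: x; case: y => //=; rewrite ?E //; try by right.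
all: by case/(IHq _ _ sz) => [->|h]; [left | right; move: h; rewrite ?E].
Qed.

(** This is the only property of the search to be proved: that the closure exhausts the group is
    read off the computed trie. *)
Lemma bfs_sound (P : m3 -> Prop) x0 y0 :
  (forall a, P a -> P (mm a x0)) -> (forall a, P a -> P (mm a y0)) ->
  forall fuel todo t, {in todo, forall a, P a} -> (forall a, tmem (digits a) t -> P a) ->
  forall a, tmem (digits a) (bfs fuel x0 y0 todo t) -> P a.
Proof.
move=> Px Py; elim=> [|f fuel IHf] //= [|x r] t Pr Pt //=.
case: ifP => _; first by apply: IHf => // a ra; apply: Pr; rewrite inE ra orbT.
have Px' : P x by apply: Pr; rewrite inE eqxx.
apply: IHf => [a | a].
  by rewrite !inE => /or3P[/eqP->|/eqP->|ra]; auto; apply: Pr; rewrite inE ra orbT.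
have sz : size (digits a) = size (digits x) by rewrite !size_digits.
by case/(tmem_add sz) => [/digits_inj->|/Pt].
Qed.

(** The group has 5616 elements and each new one pushes two products, so at most [2 * 5616 + 1]
    steps occur, within the fuel. *)
Definition fullcl x0 y0 := let t := bfs (allG ++ allG ++ allG ++ [:: one3]) x0 y0 [:: one3] TE in
  all (fun a => tmem (digits a) t) allG.

Lemma fullcl_ind (P : m3 -> Prop) x0 y0 : fullcl x0 y0 ->
  (forall a, P a -> P (mm a x0)) -> (forall a, P a -> P (mm a y0)) -> P one3 ->
  forall a, a \in isl -> P a.
Proof.
move=> /allP full Px Py P1 a Ga.
have := full a; rewrite mem_allG => /(_ Ga); apply: bfs_sound => //.
  by move=> b; rewrite inE => /eqP->.
by case=> [[a1 a2 a3] [b1 b2 b3] [c1 c2 c3]].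
Qed.

Definition conj3 g A := mm (mm g A) (inv3 g).

Lemma conj3_in g A : g \in isl -> A \in isl -> conj3 g A \in isl.
Proof. by move=> Gg GA; apply: mm_in (mm_in Gg GA) (inv3_in Gg). Qed.

Lemma mm_invr A : A \in isl -> mm A (inv3 A) = one3.
Proof.
move=> GA; apply: mx_of_inj; rewrite mx_ofM mx_of1; apply: mulmx1C.
by rewrite -mx_ofM mm_inv // mx_of1.
Qed.

Lemma mmK A B : A \in isl -> mm (inv3 A) (mm A B) = B.
Proof. by move=> GA; rewrite mm_assoc mm_inv // m1m. Qed.
Lemma inv3M A B : A \in isl -> B \in isl -> inv3 (mm A B) = mm (inv3 B) (inv3 A).
Proof.
move=> GA GB; rewrite -[LHS]mm1 -(mm_invr GA) -{2}[A](mm1) -(mm_invr GB).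
by rewrite -!mm_assoc (mm_assoc A B) mmK ?mm_in // -?mm_assoc.
Qed.

Lemma conj3M g h A : g \in isl -> h \in isl ->
  conj3 (mm g h) A = conj3 g (conj3 h A).
Proof. by move=> Gg Gh; rewrite /conj3 inv3M // !mm_assoc. Qed.

Lemma trmK : involutive trm. Proof. by case=> [[a b c] [d e f] [g h i]]. Qed.
Lemma trmM A B : trm (mm A B) = mm (trm B) (trm A).
Proof.
have trE C : mx_of (trm C) = ((mx_of C)^T)%R.
  apply/matrixP => i j; rewrite !mxE; congr fz.
  case: C => [[a b c] [d e f] [g h k]].
  by case: i => [[|[|[|i]]] ?] //; case: j => [[|[|[|j]]] ?].
by apply: mx_of_inj; rewrite mx_ofM !trE mx_ofM trmx_mul.
Qed.

Lemma tau3E A : tau3 A = trm (inv3 A). Proof. by rewrite /inv3 trmK. Qed.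
Lemma tau3M A B : A \in isl -> B \in isl -> tau3 (mm A B) = mm (tau3 A) (tau3 B).
Proof. by move=> GA GB; rewrite !tau3E inv3M // trmM. Qed.

(** The companion matrix of [X^3 - t X^2 + s X - 1]; in determinant 1 the trace [s] of the inverse
    is the second coefficient of the characteristic polynomial. *)
Definition compl l := let: V f t s := l in M (V Z3 O3 Z3) (V Z3 Z3 O3) (V O3 (opp3 s) t).
Definition flag l := let: V f t s := l in f.
Definition D2 := M (V O3 Z3 Z3) (V Z3 T3 Z3) (V Z3 Z3 T3).
Definition D3 := M (V O3 O3 Z3) (V Z3 O3 Z3) (V Z3 Z3 O3).
(** For [D2] and for [D3] alike, the second and third rows of a matrix [g] with [g a = D g] are
    eigenvectors of [a] for 1 or -1; this narrows the search. *)
Definition conj_search a D :=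
  let E := [seq v <- v3s | let w := vm v a in if eqv w v then true else eqv w (vopp v)] in
  has (fun v2 => has (fun v3 => has (fun v1 => let g := M v1 v2 v3 in
    if eqf (det3 g) O3 then eqm (mm g a) (mm D g) else false) v3s) E) E.
Definition class_test a := let l := lab a in
  match flag l with
  | Z3 => let cs := cands a in if nilp cs then false else all (fun gg => eqm (cj gg a) (compl l)) cs
  | O3 => conj_search a (if eqv l L2 then D2 else D3)
  | T3 => true end.
(** Conjugation is tested only by [C13] and [T13], which generate by [full13]; invariance under all
    of the group follows by induction. *)
Definition lab_test a := let l := lab a in
  if eqv (lab (conj3 C13 a)) l then if eqv (lab (conj3 T13 a)) l then
  if eqv (lab (inv3 a)) (tlab l) then if eqv (lab (tau3 a)) (tlab l) then
  if eqf (det3 (tau3 a)) O3 then eqm (tau3 (tau3 a)) a else false else false else false else false else false.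

Lemma class_check : all class_test allG. Proof. by exact_no_check (erefl true). Qed.
Lemma lab_check : all lab_test allG. Proof. by exact_no_check (erefl true). Qed.
Lemma full13 : fullcl C13 T13. Proof. by exact_no_check (erefl true). Qed.

(** The powers 1, 2, 4, 7 and 3. An element of order 13 is conjugate to its cube, and 1, 2, 4, 7
    represent the units modulo 13 up to powers of 3, so one of these powers lies in the class [L13].
    The powers 2, 3, 4 make involutions from elements of order 4, 6, 8. *)
Definition pows w := let w2 := sq w in let w4 := sq w2 in [:: w; w2; w4; mm w (mm w2 w4); mm w w2].
Definition hasl l s := has (fun w => has (fun u => eqv (lab u) l) (pows w)) s.
(** Products of at most three conjugates of [a], all in its normal closure. *)
Definition nwords a :=
  let s := [seq conj3 g a | g <- [:: one3; C13; sq C13; sq (sq C13); T13; mm C13 T13; mm T13 C13; mm T13 (mm C13 T13); mm (sq C13) T13; sq (sq (sq C13))]] in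
  let s2 := mulset s s in s ++ s2 ++ mulset s s2.
Definition norm_test a := if eqm a one3 then true else
  let ws := nwords a in if hasl L13 ws then hasl L2 ws else false.
(** The involutions up to the centraliser of [C13], so that few closures have to be computed. *)
Definition inv_Ts := undup [seq (nform (C13, t)).2 | t <- [seq t <- allG | eqv (lab t) L2]].
Lemma gen_check : all (fullcl C13) inv_Ts. Proof. by exact_no_check (erefl true). Qed.

Definition comps := [seq M (V Z3 O3 Z3) (V Z3 Z3 O3) (V O3 x y) | x <- f3s, y <- f3s].
Lemma norm_check : all norm_test (D2 :: D3 :: comps). Proof. by exact_no_check (erefl true). Qed.

Definition natcmp m n := if m < n then Lt else if m == n then Eq else Gt.
Definition fcode x := match x with Z3 => 0 | O3 => 1 | T3 => 2 end.
Definition vcode v := let: V a b c := v in fcode a * 9 + (fcode b * 3 + fcode c).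
Definition mcode A := let: M u v w := A in vcode u * 729 + (vcode v * 27 + vcode w).

(** The tests compare matrices digit by digit; the proofs use the numbers [mcode], whose base 27
    digits are the rows, so that minima are minima in [nat]. *)
Lemma natcmp_lex B a b a' b' : b < B -> b' < B ->
  natcmp (a * B + b) (a' * B + b') = match natcmp a a' with Eq => natcmp b b' | r => r end.
Proof.
move=> bB b'B; rewrite /natcmp; case: (ltngtP a a') => [lt|lt|->].
- by have -> : a * B + b < a' * B + b' by nia.
- have -> : (a * B + b < a' * B + b') = false by nia.
  by have -> : (a * B + b == a' * B + b') = false by nia.
by rewrite ltn_add2l eqn_add2l.
Qed.

Lemma cmpvE u v : cmpv u v = natcmp (vcode u) (vcode v).
Proof. by case: u => [[] [] []]; case: v => [[] [] []]. Qed.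
Lemma vcode_lt v : vcode v < 27. Proof. by case: v => [[] [] []]. Qed.
Lemma cmpmE A B : cmpm A B = natcmp (mcode A) (mcode B).
Proof.
case: A => a b c; case: B => a' b' c' /=; rewrite !cmpvE !(natcmp_lex, vcode_lt) //.
- by have := vcode_lt b; have := vcode_lt c; lia.
- by have := vcode_lt b'; have := vcode_lt c'; lia.
Qed.
Lemma vcode_inj : injective vcode.
Proof. by case=> [[] [] []] [[] [] []]. Qed.
Lemma mcode_inj : injective mcode.
Proof.
case=> a b c [a' b' c'] /= E; have := vcode_lt b; have := vcode_lt b'.
have := vcode_lt c; have := vcode_lt c' => *.
by congr M; apply: vcode_inj; lia.
Qed.
Lemma lemE A B : lem A B = (mcode A <= mcode B).
Proof. by rewrite /lem cmpmE /natcmp; case: ltngtP. Qed.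
Lemma levE u v : lev u v = (vcode u <= vcode v).
Proof. by rewrite /lev cmpvE /natcmp; case: ltngtP. Qed.

Lemma minl_in x s : foldl minm x s \in x :: s.
Proof.
elim: s x => [|y s IHs] x /=; first by rewrite inE.
rewrite inE; have := IHs (minm x y); rewrite /minm; case: ifP => _; rewrite !inE.
  by case/orP=> ->; rewrite ?orbT.
by case/orP=> ->; rewrite ?orbT.
Qed.
Lemma minl_le x s y : y \in x :: s -> mcode (foldl minm x s) <= mcode y.
Proof.
elim: s x y => [|z s IHs] x y /=; first by rewrite inE => /eqP->.
have le_min : mcode (minm x z) <= mcode x /\ mcode (minm x z) <= mcode z.
  by rewrite /minm lemE; case: (leqP (mcode x)) => xz; split=> //; apply: ltnW.
rewrite !inE => /or3P[/eqP->|/eqP->|sy].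
- by apply: leq_trans _ (proj1 le_min); apply: IHs; rewrite inE eqxx.
- by apply: leq_trans _ (proj2 le_min); apply: IHs; rewrite inE eqxx.
by apply: IHs; rewrite inE sy orbT.
Qed.
Definition reg a := eqf (flag (lab a)) Z3.
Definition conjp3 g (p : m3 * m3) := (conj3 g p.1, conj3 g p.2).
Definition isl2 (p : m3 * m3) := (p.1 \in isl) && (p.2 \in isl).

Lemma candsP a gg : reflect (exists v, [/\ rows v a \in isl & gg = (rows v a, inv3 (rows v a))])
  (gg \in cands a).
Proof.
apply: (iffP mapP) => [[g] | [v [Gv ->]]].
  by rewrite mem_filter => /andP[Gg /mapP[v _ defg]] ->; exists v; rewrite -defg.
exists (rows v a) => //; rewrite mem_filter; apply/andP; split=> //.
by apply/mapP; exists v; rewrite ?mem_v3s.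
Qed.

Lemma vmA v A B : vm v (mm A B) = vm (vm v A) B.
Proof. by have [] := mm_assoc (M v v v) A B. Qed.
Lemma vm1 v : vm v one3 = v. Proof. by have [] := mm1 (M v v v). Qed.

(** Hence the candidates for [h a h^-1] are those for [a] times [h^-1], and both pairs have the same
    normalised conjugates; this is why [nform] is invariant. *)
Lemma rows_conj v h a : h \in isl -> rows v (conj3 h a) = mm (rows (vm v h) a) (inv3 h).
Proof.
move=> Gh; rewrite /rows /conj3 /= !vmA.
have hK u : vm (vm u (inv3 h)) h = u by rewrite -vmA mm_inv // vm1.
have Vh : vm (vm v h) (inv3 h) = v by rewrite -vmA mm_invr // vm1.
by rewrite !hK Vh.
Qed.

Lemma class_testP a : a \in isl -> class_test a.
Proof. by rewrite -mem_allG => /(allP class_check). Qed.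

Lemma cands_compl a gg : a \in isl -> reg a -> gg \in cands a -> cj gg a = compl (lab a).
Proof.
move=> /class_testP; rewrite /class_test /reg; case: (flag _) => //= + _.
by case: ifP => // _ /allP ca /ca/eqmP.
Qed.

Lemma cands_nil a : a \in isl -> reg a -> ~~ nilp (cands a).
Proof.
by move=> /class_testP; rewrite /class_test /reg; case: (flag _) => //=; case: ifP.
Qed.

Lemma nformE p : isl2 p -> reg p.1 -> exists2 x, nform p = (compl (lab p.1), x) &
  x \in [seq cj g p.2 | g <- cands p.1] /\
  {in [seq cj g p.2 | g <- cands p.1], forall y, mcode x <= mcode y}.
Proof.
case/andP=> G1 G2 r1; have := cands_nil G1 r1; have := cands_compl G1 r1; rewrite /nform.
case: (cands p.1) => // g gs cc _; rewrite cc ?inE ?eqxx //.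
have -> : foldl (fun m h => minm m (cj h p.2)) (cj g p.2) gs =
  foldl minm (cj g p.2) [seq cj h p.2 | h <- gs].
  by elim: gs (cj g p.2) {cc} => //= h gs IHgs x.
by eexists; first reflexivity; split; [apply: minl_in | apply: minl_le].
Qed.

Lemma nform_conj p : isl2 p -> reg p.1 -> exists2 g, g \in isl & nform p = conjp3 g p.
Proof.
move=> Gp r1; have [x -> [/mapP[gg cg ->] _]] := nformE Gp r1.
have /andP[G1 _] := Gp; rewrite -(cands_compl G1 r1 cg).
by have /candsP[v [Gv ->]] := cg; exists (rows v p.1).
Qed.

Lemma lab_conj g a : g \in isl -> a \in isl -> lab (conj3 g a) = lab a.
Proof.
have labt a' : a' \in isl -> lab (conj3 C13 a') = lab a' /\ lab (conj3 T13 a') = lab a'.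
  rewrite -mem_allG => /(allP lab_check); rewrite /lab_test.
  by case: eqvP => // E1; case: eqvP.
move=> Gg; move: a; have: g \in isl /\ {in isl, forall a, lab (conj3 g a) = lab a}; last by case.
move: g Gg; apply: (fullcl_ind full13) => [g [Gg IH]|g [Gg IH]|].
- split=> [|a Ga]; first exact: mm_in Gg _.
  by rewrite conj3M // IH ?conj3_in //; case: (labt a Ga).
- split=> [|a Ga]; first exact: mm_in Gg _.
  by rewrite conj3M // IH ?conj3_in //; case: (labt a Ga).
split=> // a Ga; congr lab; rewrite /conj3 m1m.
by have -> : inv3 one3 = one3 by []; rewrite mm1.
Qed.

Lemma nform_inv p h : isl2 p -> reg p.1 -> h \in isl -> nform (conjp3 h p) = nform p.
Proof.
case/andP=> G1 G2 r1 Gh.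
have Gp : isl2 p by rewrite /isl2 G1 G2.
have Gp' : isl2 (conjp3 h p) by rewrite /isl2 !conj3_in.
have r1' : reg (conjp3 h p).1 by rewrite /reg lab_conj.
have [x -> [xin xmin]] := nformE Gp r1; have [y -> [yin ymin]] := nformE Gp' r1'.
rewrite /= lab_conj //; congr pair; apply: mcode_inj; apply/eqP.
have E : [seq cj g (conjp3 h p).2 | g <- cands (conjp3 h p).1] =i [seq cj g p.2 | g <- cands p.1].
  have Gh' := inv3_in Gh.
  move=> z; apply/mapP/mapP => -[gg /candsP[v [Gv ->]] ->].
    move: Gv; rewrite /= rows_conj // => Gv.
    have Gr : rows (vm v h) p.1 \in isl.
      by rewrite -[rows _ _]mm1 -(mm_inv Gh) mm_assoc; apply: mm_in.
    exists (rows (vm v h) p.1, inv3 (rows (vm v h) p.1)); first by apply/candsP; exists (vm v h).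
    rewrite [LHS](_ : _ = conj3 (mm (rows (vm v h) p.1) (inv3 h)) (conj3 h p.2)).
      by rewrite -conj3M // -mm_assoc mm_inv // mm1.
    by [].
  have E : rows (vm v (inv3 h)) (conj3 h p.1) = mm (rows v p.1) (inv3 h).
    by rewrite rows_conj // -vmA mm_inv // vm1.
  exists (mm (rows v p.1) (inv3 h), inv3 (mm (rows v p.1) (inv3 h))).
    by apply/candsP; exists (vm v (inv3 h)); rewrite E mm_in.
  rewrite [RHS](_ : _ = conj3 (mm (rows v p.1) (inv3 h)) (conj3 h p.2)) //.
  by rewrite -conj3M ?mm_in // -mm_assoc mm_inv // mm1.
by rewrite eqn_leq ymin ?xmin // -?E // E.
Qed.

Local Open Scope group_scope.

(** * Tests of generation and enumeration of generating pairs *)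

Definition gentest0 (p : m3 * m3) := let s := words0 p.1 p.2 in if hasl L13 s then hasl L2 s else false.
Definition gentest (p : m3 * m3) := let s := words p.1 p.2 in if hasl L13 s then hasl L2 s else false.
Definition v0 := V Z3 Z3 Z3.
Definition eigen v A := let w := vm v A in if eqv w v then true else eqv w (vopp v).
(** A common fixed point in the projective plane; applied to [taup3 p], a common fixed line. *)
Definition ngred (p : m3 * m3) := has (fun v => if eqv v v0 then false else if eigen v p.1 then eigen v p.2 else false) v3s.
Fixpoint close n (a b : m3) todo seen := match n with 0 => seen | n'.+1 => match todo with nil => seen | x :: todo' =>
  if has (eqm x) seen then close n' a b todo' seen else close n' a b (mm x a :: mm x b :: todo') (x :: seen) end end.
(** Proper subgroups fixing no point and no line lie in 13:3 or in S_4, so they have at most 39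
    elements. Each element pushes two products, hence 79 steps are enough for [close], and the test
    then checks that the result is closed. *)
Definition ngsmall (p : m3 * m3) := let s := close 80 p.1 p.2 [:: one3] nil in
  if has (eqm one3) s then if all (fun x => if has (eqm (mm x p.1)) s then has (eqm (mm x p.2)) s else false) s
   then ~~ all (fun x => has (eqm x) s) allG else false else false.
Definition taup3 (p : m3 * m3) := (tau3 p.1, tau3 p.2).
Definition nongen p := if ngred p then true else if ngred (taup3 p) then true else ngsmall p.

Lemma eigen_check : all (fun v => if eqv v v0 then true else has (fun g => ~~ eigen v g) allG) v3s.
Proof. by exact_no_check (erefl true). Qed.

Definition repl l := match flag l with Z3 => compl l | _ => if eqv l L2 then D2 else D3 end.

Lemma flagT3 a : flag (lab a) = T3 -> a = one3.
Proof. by rewrite /lab; case: (eqmP a one3) => // _ /=; case: ifP => // _; case: ifP. Qed.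

Lemma compl_comps l : compl l \in comps. Proof. by case: l => [[] [] []]. Qed.

Lemma rep_conj a : a \in isl -> a <> one3 ->
  exists2 g, g \in isl & conj3 g a = repl (lab a).
Proof.
move=> Ga an1; have := class_testP Ga; rewrite /class_test /repl.
case E: (flag (lab a)) => [||/=]; last by move/flagT3: E.
  case Ec: (cands a) => [|gg cs] //= /andP[/eqmP c1 _].
  have /candsP[v [Gv defg]] : gg \in cands a by rewrite Ec inE eqxx.
  by exists (rows v a); rewrite // -c1 defg.
set D := (if eqv (lab a) L2 then D2 else D3); case/hasP=> v2 _ /hasP[v3 _ /hasP[v1 _]].
set g := M v1 v2 v3.
change ((eqf (det3 g) O3) && eqm (mm g a) (mm D g) -> exists2 g, g \in isl & conj3 g a = D).
case/andP=> Gg /eqmP ga; exists g => //.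
by rewrite /conj3 ga -mm_assoc mm_invr // mm1.
Qed.

Lemma repl_reps a : a <> one3 -> repl (lab a) \in D2 :: D3 :: comps.
Proof.
move=> an1; rewrite /repl; case E: (flag (lab a)); last by move/flagT3: E.
  by rewrite 2!in_cons compl_comps !orbT.
by case: ifP; rewrite 2!in_cons eqxx ?orbT.
Qed.

Lemma class_lab a b : a \in isl -> b \in isl -> lab a = lab b ->
  exists2 g, g \in isl & b = conj3 g a.
Proof.
move=> Ga Gb lab_ab; have [a1|an1] := eqVneq a one3.
  exists one3 => //; rewrite a1; apply: flagT3.
  by rewrite -lab_ab a1.
have [b1|bn1] := eqVneq b one3.
  by case/eqP: an1; apply: flagT3; rewrite lab_ab b1.
have [g Gg gE] := rep_conj Ga (elimN eqP an1); have [h Gh hE] := rep_conj Gb (elimN eqP bn1).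
exists (mm (inv3 h) g); first exact: mm_in (inv3_in Gh) Gg.
rewrite conj3M ?inv3_in // gE lab_ab -hE -conj3M ?inv3_in // mm_inv //.
by rewrite /conj3 m1m; have -> : inv3 one3 = one3 by []; rewrite mm1.
Qed.

Section Orbits.
Variables (X : Type) (th de ta : X -> X).
Definition orb6 x := [:: x; th x; de x; th (de x); de (th x); th (de (th x))].
Definition orb12 x := orb6 x ++ orb6 (ta x).
End Orbits.
(** The third label is that of the inverse of the product, so [theta] and [delta] permute the three
    labels by transpositions, as in [sth] and [sde]. *)
Definition lab3 (p : m3 * m3) := M (lab p.1) (lab p.2) (tlab (lab (mm p.1 p.2))).
Definition sth t := let: M a b c := t in M b a c.
Definition sde t := let: M a b c := t in M c b a.
Definition sta t := let: M a b c := t in M (tlab a) (tlab b) (tlab c).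
(* Every W-orbit of generating pairs has a point with a minimal triple of labels, and the
   first component of such a pair is regular. *)
Definition labmin t := all (lem t) (orb12 sth sde sta t).
Definition labG := [seq (A, lab A) | A <- allG].
(** The last test says that [b] is least among its conjugates by the candidates of [a], that is,
    [(a, b)] is its own normal form. *)
Definition Rtest a la cs (bl : m3 * v3) :=
  let: (b, lb) := bl in
  if lev la lb then let lc := tlab (lab (mm a b)) in
       if lev lb lc then if labmin (M la lb lc) then all (fun g => lem b (cj g b)) cs else false else false else false.
Definition Rlist := flatten [seq [seq (a, bl.1) | bl <- [seq bl <- labG | Rtest a (lab a) (cands a) bl]] | a <- comps].
(** [gentest0] spares most pairs the costly test [nongen]. That every pair kept does generate is
    checked by [gen_Plist], with the longer list [words]. *)
Definition isgen p := if gentest0 p then true else ~~ nongen p.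
Definition Plist := [seq p <- Rlist | isgen p].

Lemma gen_Plist : all gentest Plist. Proof. by exact_no_check (erefl true). Qed.
Lemma comps_check : all (fun a => [&& eqf (det3 a) O3, reg a, eqm (compl (lab a)) a & eqm (rows (V O3 Z3 Z3) a) one3]) comps.
Proof. by exact_no_check (erefl true). Qed.
(** An element that is not regular has a plane of eigenvectors for 1 or -1, and two planes in
    dimension 3 meet. So two such elements have a common eigenvector; the first is taken among
    representatives of classes. *)
Lemma derog_check : all (fun a => all (fun b => if eqf (flag (lab b)) Z3 then true else ngred (a, b)) allG) [:: one3; D2; D3].
Proof. by exact_no_check (erefl true). Qed.

(* The relations of a pair of elements of order 4 whose product has order 6. *)
Definition evw (p : m3 * m3) (w : seq bool) := foldr (fun b x => mm (if b then p.2 else p.1) x) one3 w.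
Definition rels : seq (seq bool) :=
  let xy n := flatten (nseq n [:: false; true]) in
  [:: nseq 4 false; nseq 2 false; nseq 4 true; nseq 2 true; xy 6; xy 2; xy 3;
      flatten (nseq 4 [:: false; false; false; true; true; true; false; true])].
Definition relpat p := [seq eqm (evw p w) one3 | w <- rels].
Definition P0 := (M (V Z3 O3 Z3) (V Z3 Z3 O3) (V O3 T3 O3), M (V Z3 O3 O3) (V T3 O3 Z3) (V Z3 T3 Z3)).
(** Elements of order 4 form one class, and so do those of order 6. The pattern of relations of [P0]
    therefore forces its triple of labels, which is minimal, so any generating pair with this
    pattern shows up in [Plist]. *)
Definition ordlab_test a :=
  let a2 := sq a in let a3 := mm a a2 in
  if eqm a2 one3 then true else
  if eqm (sq a2) one3 then eqv (lab a) (V Z3 O3 O3) else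
  if eqm (sq a3) one3 then if eqm a3 one3 then true else eqv (lab a) (V Z3 T3 T3) else true.
Lemma ordlab_check : all ordlab_test allG. Proof. by exact_no_check (erefl true). Qed.
(** [relpat] depends only on the relations of a pair; this test is what turns equality of relations
    into conjugacy up to [tau]. *)
Definition rigid_test q := (relpat q == relpat P0) ==> eqp q P0 || eqp q (nform (taup3 P0)).
Lemma rigid_check : all rigid_test Plist. Proof. by exact_no_check (erefl true). Qed.
Lemma P0_check : gentest P0 && (lab3 P0 == M (V Z3 O3 O3) (V Z3 O3 O3) (V Z3 T3 T3)) && labmin (lab3 P0).
Proof. by exact_no_check (erefl true). Qed.
Definition mth (p : m3 * m3) := (p.2, p.1).
Definition mde (p : m3 * m3) := (inv3 (mm p.1 p.2), p.2).
Definition orbp := orb12 mth mde taup3.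
(** The pattern of the stabiliser among the twelve words. Different labels already mean different
    classes; for equal ones [nform] decides. *)
Definition bits p := let l := lab3 p in [seq (if eqm (lab3 q) l then eqp (nform q) p else false) | q <- orbp p].
Fixpoint leb (s t : seq bool) := match s, t with
  | true :: s', true :: t' | false :: s', false :: t' => leb s' t'
  | true :: _, false :: _ => false
  | _, _ => true end.
Fixpoint eqbs (s t : seq bool) := match s, t with
  | true :: s', true :: t' | false :: s', false :: t' => eqbs s' t'
  | nil, nil => true
  | _, _ => false end.
Definition key3 p := (lab3 p, bits p).
Definition eqk (k k' : m3 * seq bool) := if eqm k.1 k'.1 then eqbs k.2 k'.2 else false.
(** Imposed on all of [Plist], this forces two points of a W-orbit with the same minimal triple to
    have equal patterns, by antisymmetry of [leb]. *)
Definition sel p := let l := lab3 p in let b := bits p in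
  all (fun q => if eqm (lab3 q) l then leb b (bits (nform q)) else true) (orbp p).
Fixpoint kreps (s : seq ((m3 * m3) * (m3 * seq bool))) := match s with
  | nil => nil
  | x :: s' => let r := kreps s' in if has (fun y => eqk x.2 y.2) r then r else x :: r end.
Definition kcount (kp : seq ((m3 * m3) * (m3 * seq bool))) k := count (fun x => eqk k x.2) kp.
Definition nbrs (x : (m3 * m3) * (m3 * seq bool)) :=
  [seq nform q | q <- orbp x.1 & if eqm (lab3 q) x.2.1 then eqbs (bits (nform q)) x.2.2 else false].
Definition code3 kp (x : (m3 * m3) * (m3 * seq bool)) : bool * nat :=
  let m := kcount kp x.2 in if all (eqp x.1) (nbrs x) then (false, m) else (true, m./2).
(** Guarantees that a W-orbit meets the block in one point or in exactly two, [x.1] and [n]; in the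
    latter case the block has even size, so halving in [code3] is exact. *)
Definition code_ok kp (x : (m3 * m3) * (m3 * seq bool)) :=
  let nb := nbrs x in if all (eqp x.1) nb then true else
  if odd (kcount kp x.2) then false else
  has (fun n => if eqp x.1 n then false else all (fun z => if eqp x.1 z then true else eqp n z) nb) nb.
Definition keyed := [seq (p, key3 p) | p <- Plist].
(* Factors are numbered: 2 is C_2, 3 to 9 the symmetric groups, 22 is D_8, and 24, 25, 26
   are B, C, A; an unexpected code gives 0, which is not in [target]. *)
Definition facs (c : bool * nat) : seq nat := match c with
  | (false, 1) => [::] | (false, m) => if 1 < m < 10 then [:: m] else [:: 0]
  | (true, 1) => [:: 2] | (true, 2) => [:: 22] | (true, 3) => [:: 2; 4]
  | (true, 4) => [:: 24] | (true, 5) => [:: 2; 25] | (true, 6) => [:: 26]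
  | _ => [:: 0] end.
Definition target : seq nat := nseq 26 2 ++ nseq 6 22 ++ nseq 4 3 ++ nseq 21 4 ++ nseq 12 6
  ++ nseq 6 7 ++ nseq 3 8 ++ nseq 11 9 ++ nseq 3 26 ++ nseq 8 24 ++ nseq 5 25.
Fixpoint puniq (s : seq (m3 * m3)) := match s with
  | nil => true | p :: s' => if has (eqp p) s' then false else puniq s' end.
Definition final_test kp := let r := kreps kp in
  [&& all (fun x => sel x.1) kp, puniq (map fst kp), all (code_ok kp) r
    & perm_eq (flatten [seq facs (code3 kp x) | x <- r]) target].
Lemma final_check : final_test keyed. Proof. by exact_no_check (erefl true). Qed.
Lemma eqpP p q : reflect (p = q) (eqp p q).
Proof.
case: p q => a b [c d]; rewrite /eqp /=; case: eqmP => [->|n]; last by constructor; case.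
by apply: (iffP (eqmP _ _)) => [->|[]].
Qed.
Lemma rigid_Plist p : p \in Plist -> relpat p = relpat P0 -> p = P0 \/ p = nform (taup3 P0).
Proof.
move=> /(allP rigid_check)/implyP rp /eqP/rp/orP[/eqpP|/eqpP]; by [left | right].
Qed.
Lemma relpat0 : relpat P0 = [:: true; false; true; false; true; false; false; true].
Proof. by []. Qed.
Lemma isl2_P0 : isl2 P0. Proof. by []. Qed.
Lemma lab3_P0 : lab3 P0 = M (V Z3 O3 O3) (V Z3 O3 O3) (V Z3 T3 T3).
Proof. by have /andP[/andP[_ /eqP]] := P0_check. Qed.
Lemma labmin_P0 : labmin (lab3 P0). Proof. by have /andP[] := P0_check. Qed.
Lemma gentest_P0 : gentest P0. Proof. by have /andP[/andP[]] := P0_check. Qed.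
Lemma lab_C13 : lab C13 = L13. Proof. by []. Qed.
Lemma conj3_1 : conj3 one3 one3 = one3. Proof. by []. Qed.
Lemma conj3E g a : conj3 g a = mm (mm g a) (inv3 g). Proof. by []. Qed.
Lemma inv3_1 : inv3 one3 = one3. Proof. by []. Qed.

Opaque mm inv3 conj3 lab nform hasl.

Section Closure.
Variable P : m3 -> Prop.
Hypotheses (Pm : forall a b, P a -> P b -> P (mm a b)) (Pv : forall a, P a -> P (inv3 a)).

Lemma mulset_ind s t : {in s, forall a, P a} -> {in t, forall a, P a} ->
  {in mulset s t, forall a, P a}.
Proof. by move=> Ps Pt _ /allpairsP[[a b] [/Ps Pa /Pt Pb ->]]; apply: Pm. Qed.

Lemma cat_ind s t : {in s, forall a, P a} -> {in t, forall a, P a} ->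
  {in s ++ t, forall a, P a}.
Proof. by move=> Ps Pt a; rewrite mem_cat => /orP[/Ps|/Pt]. Qed.

Lemma base4_ind a b : P a -> P b -> {in base4 a b, forall c, P c}.
Proof. by move=> Pa Pb c; rewrite !inE => /or4P[] /eqP->; auto. Qed.

Lemma words_ind a b : P a -> P b -> {in words a b, forall c, P c}.
Proof.
move=> Pa Pb; have P4 := base4_ind Pa Pb; have P2 := mulset_ind P4 P4.
have P3 := mulset_ind P2 P2.
by apply: cat_ind => //; apply: cat_ind => //; apply: cat_ind => //; apply: mulset_ind.
Qed.

Lemma hasl_ind l s : {in s, forall a, P a} -> hasl l s -> exists2 u, P u & lab u = l.
Proof.
Transparent hasl.
move=> Ps /hasP[w /Ps Pw /hasP[u uw /eqvP lu]]; exists u => //.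
have P2 : P (sq w) by apply: Pm. have P4 : P (sq (sq w)) by apply: Pm.
by move: uw; rewrite !inE => /orP[/eqP->|/or4P[] /eqP->]; auto.
Opaque hasl.
Qed.
End Closure.

(** * The group W generated by theta, delta and tau *)

Section OrbitGroup.
Variables (Y : finType) (th de ta : Y -> Y).
Hypotheses (thK : involutive th) (deK : involutive de) (taK : involutive ta)
  (braid : forall y, th (de (th y)) = de (th (de y)))
  (ta_th : forall y, ta (th y) = th (ta y)) (ta_de : forall y, ta (de y) = de (ta y)).

Definition pth := perm (inv_inj thK).
Definition pde := perm (inv_inj deK).
Definition pta := perm (inv_inj taK).
Definition orbgroup := <<[set pth; pde; pta]>>%G.
Definition orbwords : seq {perm Y} :=
  let wl := [:: 1; pth; pde; pde * pth; pth * pde; pth * pde * pth] in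
  wl ++ [seq pta * w | w <- wl].

Lemma orbgroup_gen : [/\ pth \in orbgroup, pde \in orbgroup & pta \in orbgroup].
Proof. by split; rewrite mem_gen // !inE eqxx ?orbT. Qed.

(** Involutivity, the braid relation and commutation with [pta] show that right multiplication by a
    generator maps the twelve words to themselves. Their set contains 1 and is stable under the
    whole group. *)
Lemma orbgroupE w : (w \in orbgroup) = (w \in orbwords).
Proof.
have hh : pth * pth = 1 by apply/permP => y; rewrite permM !permE /= thK.
have dd : pde * pde = 1 by apply/permP => y; rewrite permM !permE /= deK.
have tt : pta * pta = 1 by apply/permP => y; rewrite permM !permE /= taK.
have br : pde * pth * pde = pth * pde * pth.
  by apply/permP => y; rewrite !permM !permE /= braid.
have th' : pth * pta = pta * pth by apply/permP => y; rewrite !permM !permE /= ta_th.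
have td : pde * pta = pta * pde by apply/permP => y; rewrite !permM !permE /= ta_de.
have hhx x : x * pth * pth = x by rewrite -mulgA hh mulg1.
have ddx x : x * pde * pde = x by rewrite -mulgA dd mulg1.
have brx x : x * pde * pth * pde = x * pth * pde * pth by rewrite -!mulgA (mulgA pde) br !mulgA.
have thx x : x * pth * pta = x * pta * pth by rewrite -!mulgA th'.
have tdx x : x * pde * pta = x * pta * pde by rewrite -!mulgA td.
pose nf := (mulg1, mul1g, mulgA, hh, dd, tt, br, th', td, (hhx, ddx, brx, thx, tdx)).
have [Wh Wd Wt] := orbgroup_gen; apply/idP/idP => [|]; last first.
  rewrite mem_cat => /orP[|/mapP[u + ->]].
    by rewrite !inE => /or4P[| | |/or3P[]] /eqP->; rewrite ?groupM.
  by rewrite !inE => /or4P[| | |/or3P[]] /eqP->; rewrite ?groupM.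
pose S := [set u in orbwords].
have stab p : (forall u, u \in orbwords -> u * p \in orbwords) -> p \in 'C[S | 'Rs].
  move=> up; apply/astab1P; rewrite /= rcosetE; apply/eqP; rewrite eqEcard card_rcoset leqnn andbT.
  by apply/subsetP => _ /rcosetP[u + ->]; rewrite !in_set; apply: up.
have WS : orbgroup \subset 'C[S | 'Rs].
  rewrite gen_subG; apply/subsetP => p /setUP[/set2P[]|/set1P] ->; apply: stab => u;
    rewrite !inE => /or4P[| | |/or4P[| | |/or4P[| | |/or3P[]]]] /eqP->.
  all: try by rewrite ?nf /= ?eqxx ?orbT.
move=> Ww; have /astab1P/= := subsetP WS _ Ww; rewrite rcosetE => Sw.
suff: w \in S by rewrite inE.
by rewrite -Sw; apply/rcosetP; exists 1; rewrite ?mul1g // !inE eqxx.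
Qed.

Lemma orb12E y : orb12 th de ta y = [seq w y | w : {perm Y} <- orbwords].
Proof. by rewrite /orb12 /orb6 /orbwords /= !(permM, permE) /=. Qed.

Lemma orbgroup_ind (P : {perm Y} -> Prop) : P 1 -> P pth -> P pde -> P pta ->
  (forall u v, P u -> P v -> P (u * v)) -> forall w, w \in orbgroup -> P w.
Proof.
move=> P1 Ph Pd Pt PM w; rewrite orbgroupE mem_cat => /orP[|/mapP[u + ->]];
  by rewrite !inE => /or4P[| | |/or3P[]] /eqP->; auto.
Qed.

Section Labels.
Variables (T U : eqType) (lab : Y -> T) (L : Y -> U) (sth sde sta : U -> U).
Hypotheses (Lth : forall y, L (th y) = sth (L y)) (Lde : forall y, L (de y) = sde (L y))
  (Lta : forall y, L (ta y) = sta (L y)).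

Lemma symset_lperm : symgroup th de ta lab = lpermg orbgroup lab.
Proof.
apply/val_inj/setP => s /=; have [Wh Wd Wt] := orbgroup_gen.
apply/symsetP/lpermP => [sP | [sW sl] y]; last first.
  by have := sW _ y Wh; have := sW _ y Wd; have := sW _ y Wt; rewrite !permE => -> -> ->.
split=> [w y Ww | y]; last by have [] := sP y.
move: y; pattern w; apply: orbgroup_ind Ww => [y|y|y|y|u v us vs y]; rewrite ?permM ?vs ?us ?perm1 //;
  by rewrite !permE; have [] := sP y.
Qed.

Lemma orbgroup_label w : w \in orbgroup -> exists f, forall y, L (w y) = f (L y).
Proof.
move=> Ww; pattern w; apply: orbgroup_ind Ww => [|||| u v [f uf] [g vg]].
- by exists id => y; rewrite perm1.
- by exists sth => y; rewrite permE.
- by exists sde => y; rewrite permE.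
- by exists sta => y; rewrite permE.
by exists (g \o f) => y; rewrite permM vg uf.
Qed.

Lemma orb12_label y : orb12 sth sde sta (L y) = [seq L ((w : {perm Y}) y) | w <- orbwords].
Proof. by rewrite (map_comp L) -orb12E /orb12 /orb6 /= !(Lth, Lde, Lta). Qed.

(** The booleans record which of the twelve words fix [y], hence the stabiliser of [y]. *)
Definition orbkey y := (L y, [seq z == y | z <- orb12 th de ta y]).

Lemma orbkeyP y z : reflect (L y = L z /\ forall w, w \in orbgroup -> (w y == y) = (w z == z))
  (orbkey y == orbkey z).
Proof.
have E x : [seq t == x | t <- orb12 th de ta x] = [seq (w : {perm Y}) x == x | w <- orbwords].
  by rewrite orb12E -map_comp.
rewrite /orbkey !E; apply: (iffP eqP) => [k | [-> H]].
  split=> [|w]; first exact: (congr1 fst k).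
  by have /eq_in_map H := congr1 snd k; rewrite orbgroupE => /H.
by congr pair; apply/eq_in_map => w; rewrite -orbgroupE => /H.
Qed.

(** The triple of [w y] is a function of that of [y], and the stabiliser of [w y] is a conjugate by
    [w] of that of [y]. *)
Lemma orbkey_orb w y z : w \in orbgroup -> orbkey y = orbkey z -> orbkey (w y) = orbkey (w z).
Proof.
move=> Ww /eqP/orbkeyP[Lyz st]; apply/eqP/orbkeyP; split=> [|v Wv].
  by have [f fE] := orbgroup_label Ww; rewrite !fE Lyz.
have E x : (v (w x) == w x) = ((w * v * w^-1) x == x).
  by rewrite !permM (canF_eq (permK w^-1)) invgK.
by rewrite !E st // !groupM ?groupV.
Qed.

Lemma orbkey_stab w y z : w \in orbgroup -> orbkey y = orbkey z -> w y = y -> w z = z.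
Proof. by move=> Ww /eqP/orbkeyP[_ st] wy; apply/eqP; rewrite -st // wy eqxx. Qed.

Lemma orbkey_lperm : (forall t y, t \in lperm orbgroup lab -> L (t y) = L y) ->
  forall t y, t \in lperm orbgroup lab -> orbkey (t y) = orbkey y.
Proof.
move=> LK t y Kt; apply/eqP/orbkeyP; split=> [|w Ww]; first exact: LK.
by have /lpermP[tW _] := Kt; rewrite -tW // (inj_eq perm_inj).
Qed.

Lemma orbkey_lab : (forall y z, L y = L z -> lab y = lab z) ->
  forall y z, orbkey y = orbkey z -> lab y = lab z.
Proof. by move=> LL y z [/LL]. Qed.
End Labels.
End OrbitGroup.

Local Open Scope nat_scope.
Opaque P0 keyed target words Plist Rlist nongen gentest0 labG.
Lemma eqbsP : Equality.axiom eqbs.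
Proof.
move=> s t; apply: (iffP idP) => [|<-]; last by elim: s => //= -[].
by elim: s t => [|[] s IHs] [|[] t] //= /IHs->.
Qed.

Lemma eqkP : Equality.axiom eqk.
Proof.
move=> [l s] [l' s']; rewrite /eqk /=; case: eqmP => [->|n]; last by constructor; case.
by apply: (iffP (eqbsP _ _)) => [->|[]].
Qed.

Lemma leb_anti s t : size s = size t -> leb s t -> leb t s -> s = t.
Proof. by elim: s t => [|[] s IHs] [|[] t] //= [/IHs st] /st /[apply] ->. Qed.

Lemma puniqP s : puniq s -> uniq s.
Proof.
elim: s => //= p s IHs; case: ifP => // ps /IHs->; rewrite andbT.
by apply: contraFN ps => sp; apply/hasP; exists p => //; apply/eqpP.
Qed.

Section Kreps.
Implicit Types s : seq ((m3 * m3) * (m3 * seq bool)).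

Lemma kreps_sub s : {subset kreps s <= s}.
Proof.
elim: s => //= x s IHs y; case: ifP => _; rewrite !inE.
  by move/IHs => ->; rewrite orbT.
by case/orP => [->|/IHs->] //; rewrite orbT.
Qed.

Lemma kreps_cover s x : x \in s -> exists2 y, y \in kreps s & y.2 = x.2.
Proof.
elim: s => //= z s IHs; rewrite inE => /orP[/eqP->|/IHs[y ys yx]].
  case: ifP => [/hasP[y ry /eqkP E]|_]; last by exists z; rewrite ?inE ?eqxx.
  by exists y.
by exists y => //; case: ifP => // _; rewrite inE ys orbT.
Qed.

Lemma kreps_uniq s : uniq (map snd (kreps s)).
Proof.
elim: s => //= x s IHs; case: ifP => //= /negbT xs; rewrite IHs andbT.
apply: contra xs => /mapP[y ys E]; apply/hasP; exists y => //.
by apply/eqkP.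
Qed.
End Kreps.

Section Keyed.
Variables (T K : eqType) (f : T -> K) (P : seq T).
Lemma graphP (x : T * K) : x \in [seq (p, f p) | p <- P] <-> x.1 \in P /\ x.2 = f x.1.
Proof.
split=> [/mapP[p Pp ->] // | [Pp E]].
by apply/mapP; exists x.1; rewrite // -E; case: x {Pp E}.
Qed.
End Keyed.

Lemma keyedP x : x \in keyed <-> x.1 \in Plist /\ x.2 = key3 x.1.
Proof. exact: (graphP key3 Plist). Qed.

Lemma final_testP (P : seq (m3 * m3)) : let kp := [seq (p, key3 p) | p <- P] in final_test kp ->
  [/\ {in P, forall p, sel p}, uniq P, {in kreps kp, forall x, code_ok kp x},
     perm_eq (flatten [seq facs (code3 kp x) | x <- kreps kp]) target
   & forall k, kcount kp k = size [seq p <- P | k == key3 p]].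
Proof.
move=> kp /and4P[/allP sP /puniqP uP /allP codeP tP]; split=> [p Pp||||k].
- exact: (sP (p, key3 p) (map_f (fun p => (p, key3 p)) Pp)).
- by move: uP; rewrite -map_comp map_id.
- exact: codeP.
- exact: tP.
by rewrite /kcount count_map size_filter; apply: eq_count => p; apply/eqkP/eqP.
Qed.
Lemma final : [/\ {in Plist, forall p, sel p}, uniq Plist, {in kreps keyed, forall x, code_ok keyed x},
     perm_eq (flatten [seq facs (code3 keyed x) | x <- kreps keyed]) target
   & forall k, kcount keyed k = size [seq p <- Plist | k == key3 p]].
Proof. exact: final_testP final_check. Qed.

Lemma uniq_map_inj (T U : eqType) (f : T -> U) s : uniq (map f s) -> {in s &, injective f}.
Proof.
elim: s => //= x s IHs /andP[nx us] y z; rewrite !inE => /orP[/eqP->|ys] /orP[/eqP->|zs] // E.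
- by case/negP: nx; rewrite E map_f.
- by case/negP: nx; rewrite -E map_f.
exact: IHs.
Qed.

Lemma nth_index_map_in (T U : eqType) (x0 : T) (f : T -> U) s : uniq (map f s) ->
  {in s, forall x, nth x0 s (index (f x) (map f s)) = x}.
Proof.
move=> us x sx; have ix : index (f x) (map f s) < size s.
  by rewrite -(size_map f) index_mem map_f.
apply: (uniq_map_inj us); rewrite ?mem_nth //.
by rewrite -(nth_map x0 (f x)) // nth_index ?map_f.
Qed.

Lemma map_factor (T U V : eqType) (f : T -> U) (g : T -> V) (h : U -> V) s :
  (forall x, x \in s -> h (f x) = g x) -> map g s = map h (map f s).
Proof. by move=> E; rewrite -map_comp; apply/eq_in_map => x /E. Qed.

Local Open Scope group_scope.

(** * The factors *)

Record any_group := AnyGroup { any_type : finGroupType; any_set : {group any_type} }.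
Definition factor (n : nat) : any_group :=
  if n == 2 then AnyGroup (Cyc 2) else if n == 22 then AnyGroup [set: 'D_8]%G
  else if n == 24 then AnyGroup (hyp 4) else if n == 25 then AnyGroup (even_hyp 5)
  else if n == 26 then AnyGroup (hyp 6) else AnyGroup ('Sym_('I_n))%G.
Definition facgroup n := any_set (factor n).
Local Notation prodfac := (@prodof _ (any_type \o factor) facgroup).

Lemma wreath_sym m : wreath (false, m) \isog 'Sym_('I_m).
Proof.
suff -> : wreath (false, m) :=: [set: {perm 'I_m}] by apply: isog_refl.
by apply/setP => s; rewrite [RHS]inE; apply/(centsetP (@wr_flip (false, m))).
Qed.

(** For 5 coordinates the central element changes an odd number of signs, so it lies outside
    [even_hyp 5]. *)
Lemma hyp5_dprod : exists A : {group {perm 'I_5 * bool}}, A \x even_hyp 5 = hyp 5 /\ A \isog Cyc 2.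
Proof.
pose o k lt := @Ordinal 5 k lt; pose z := es [ffun _ : 'I_5 => true].
have [L [_ _ cW]] := even_hyp_sdprod (o 0%N isT).
have zE : z = es (unit_sign (o 0%N isT)) * es (unit_sign (o 1%N isT)) * es (unit_sign (o 2 isT))
     * es (unit_sign (o 3 isT)) * es (unit_sign (o 4 isT)).
  rewrite !esM; congr es; apply/ffunP => i; rewrite !ffunE -!val_eqE /=.
  by case: i => -[|[|[|[|[|i]]]]].
have oz : odd_perm z by rewrite zE !odd_permM !odd_unit_sign.
have zE0 : z \notin even_hyp 5 by rewrite even_hypE oz andbF.
have sE : even_hyp 5 \subset hyp 5 by apply: subsetIl.
have z2 : z * z = 1 := es_sq _.
exists <[z]>%G; split.
  apply: (dprod_index2 sE) => //; first exact: es_in.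
  by apply/centP => w /(subsetP sE); apply: es_central.
by apply: isog_Cyc2 => //; apply: contraNneq zE0 => ->; rewrite group1.
Qed.

Lemma hyp2_dihedral : hyp 2 \isog [set: 'D_8].
Proof.
pose i0 : 'I_2 := ord0; pose i1 : 'I_2 := ord_max.
have s2 : tperm i0 i1 * tperm i0 i1 = 1 by rewrite tperm2.
have [|cD iD] := @hyp_dihedral 2 (unit_sign i0) (tperm i0 i1) i0 s2; first by rewrite tpermL !ffunE.
have -> : hyp 2 = <<[set es (unit_sign i0); ps (tperm i0 i1)]>>%G.
  apply/esym/eqP; rewrite -val_eqE /= eqEcard cD gen_subG card_hyp leqnn andbT.
  by apply/subsetP => w /set2P[] ->; [apply: es_in | apply: ps_in].
exact: iD.
Qed.

Lemma prodof_wreath c : 0%N \notin facs c -> prodfac (facs c) (wreath c).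
Proof.
case: c => -[] m.
- case: m => [|[|[|[|[|[|[|m]]]]]]] // _.
  + by apply: prodof1; apply: isog_Cyc => //; apply: (@card_hyp 1).
  + by apply: prodof1; apply: hyp2_dihedral.
  + by have [A [B [defW iA iB]]] := hyp3_dprod; exists A, B; split=> //; apply: prodof1.
  + by apply: prodof1; apply: isog_refl.
  + by have [A [defW iA]] := hyp5_dprod; exists A, (even_hyp 5); split=> //; apply: prodof1; apply: isog_refl.
  by apply: prodof1; apply: isog_refl.
case: m => [|[|[|m]]] //.
- move=> _ /=; have /card_isog := wreath_sym 1; rewrite cardsT card_Sn => c1.
  by apply/eqP; rewrite trivg_card1 c1.
- move=> _; apply: prodof1; apply: isog_Cyc => //.
  by rewrite (card_isog (wreath_sym 2)) cardsT card_Sn.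
rewrite /facs; case: ifP => // /andP[_ m10] _; apply: prodof1.
move: m10; do 7! [case: m => [|m]; first by move=> _; apply: wreath_sym].
by move=> m10; exfalso; lia.
Qed.

Lemma prodof_flatten (gT : finGroupType) (G : {group gT}) cs :
  0%N \notin flatten (map facs cs) -> prodof wreath cs G -> prodfac (flatten (map facs cs)) G.
Proof.
elim: cs gT G => //= c cs IHcs gT G; rewrite mem_cat negb_or => /andP[c0 cs0].
move=> [A [B [defG iA LB]]]; apply: prodof_cat defG _ (IHcs _ _ cs0 LB).
by apply: prodof_isog (prodof_wreath c0); rewrite isog_sym.
Qed.

(** * Generating pairs of SL_3(F_3) *)
(* The group is abstract here, so that conversion never unfolds the quotient PSL. *)
Section Model.
Variables (gT : finGroupType) (G : {group gT}) (toG : m3 -> gT).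
Hypotheses (toGM : forall a b, a \in isl -> b \in isl -> toG (mm a b) = toG a * toG b)
  (toG_inj : forall a b, a \in isl -> b \in isl -> toG a = toG b -> a = b)
  (toGP : forall g, reflect (exists2 a, a \in isl & toG a = g) (g \in G)).

Lemma toG_in a : a \in isl -> toG a \in G. Proof. by move=> Ga; apply/toGP; exists a. Qed.
Lemma toG1 : toG one3 = 1.
Proof. by apply: (mulgI (toG one3)); rewrite -toGM // mm1 mulg1. Qed.
Lemma toGV a : a \in isl -> toG (inv3 a) = (toG a)^-1.
Proof. by move=> Ga; apply: (mulIg (toG a)); rewrite -toGM ?inv3_in // mm_inv // toG1 mulVg. Qed.
Lemma toG_conj g a : g \in isl -> a \in isl -> toG (conj3 g a) = toG a ^ (toG g)^-1.
Proof.
by move=> Gg Ga; rewrite !toGM ?toGV ?inv3_in ?mm_in // /conjg invgK mulgA.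
Qed.

Definition inH (H : {set gT}) a := a \in isl /\ toG a \in H.
Lemma inHM (H : {group gT}) a b : inH H a -> inH H b -> inH H (mm a b).
Proof. by move=> [Ga Ha] [Gb Hb]; split; [apply: mm_in | rewrite toGM ?groupM]. Qed.
Lemma inHV (H : {group gT}) a : inH H a -> inH H (inv3 a).
Proof. by move=> [Ga Ha]; split; [apply: inv3_in | rewrite toGV ?groupV]. Qed.

Lemma labP3 a b : a \in isl -> b \in isl -> (lab a = lab b <-> toG b \in toG a ^: G).
Proof.
move=> Ga Gb; split=> [/class_lab[]// g Gg -> | /imsetP[_ /toGP[g Gg <-] E]].
  by rewrite toG_conj // memJ_class // groupV toG_in.
have -> : b = conj3 (inv3 g) a; last by rewrite lab_conj ?inv3_in.
by apply: toG_inj; rewrite ?conj3_in ?inv3_in // toG_conj ?inv3_in // toGV // invgK.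
Qed.

(* An element of class 13A and an involution always generate. *)
Lemma gen_13_2 (H : {group gT}) s t : inH H s -> inH H t -> lab s = L13 -> lab t = L2 ->
  G \subset H.
Proof.
move=> [Gs Hs] [Gt Ht] ls lt.
have Gst : isl2 (s, t) by rewrite /isl2 Gs.
have rs : reg s by rewrite /reg ls.
have GC : C13 \in isl by [].
have rC : reg C13 by rewrite /reg lab_C13.
have [g Gg E] := nform_conj Gst rs.
have g1 : (nform (s, t)).1 = conj3 g s by rewrite E.
have [x nf _] := nformE Gst rs.
have {}g1 : conj3 g s = C13 by rewrite -g1 nf ls.
have {}nf : nform (s, t) = nform (C13, conj3 g t).
  by rewrite -g1; apply/esym/(nform_inv (p := (s, t)) Gst rs Gg).
have Ggt : conj3 g t \in isl by apply: conj3_in.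
have [h Gh Eh] := nform_conj (p := (C13, conj3 g t)) (introT andP (conj GC Ggt)) rC.
have h1 : (nform (C13, conj3 g t)).1 = conj3 h C13 by rewrite Eh.
have h2 : (nform (C13, conj3 g t)).2 = conj3 h (conj3 g t) by rewrite Eh.
(* At this point [s] has become [C13] and [t] one of the involutions in [inv_Ts], whose closures are
   known. *)
have Tin : (nform (C13, conj3 g t)).2 \in inv_Ts.
  rewrite mem_undup; apply/mapP; exists (conj3 g t) => //.
  by rewrite mem_filter mem_allG Ggt lab_conj // lt.
have := allP gen_check _ Tin; set T := _.2 => full.
have hC : conj3 h C13 = C13.
  by have [y ny _] := nformE (p := (C13, conj3 g t)) (introT andP (conj GC Ggt)) rC; rewrite -h1 ny lab_C13.
have Ghg : mm h g \in isl by apply: mm_in.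
pose x0 := toG (mm h g); have Gx0 : x0 \in G by apply: toG_in.
have GT : T \in isl by rewrite /T h2; apply: conj3_in.
have EC : toG C13 = toG s ^ x0^-1.
  have E1 : conj3 (mm h g) s = C13 by rewrite (conj3M _ Gh Gg) g1; exact: hC.
  by rewrite -[in LHS]E1; exact: (toG_conj Ghg Gs).
have ET : toG T = toG t ^ x0^-1.
  have E1 : conj3 (mm h g) t = T by rewrite (conj3M _ Gh Gg); exact: esym h2.
  by rewrite -[in LHS]E1; exact: (toG_conj Ghg Gt).
have [K defK] : exists K : {group gT}, K :=: H :^ x0^-1 by exists (H :^ x0^-1)%G.
have KC : inH K C13 by split; [exact: GC | rewrite EC defK memJ_conjg].
have KT : inH K T by split; [exact: GT | rewrite ET defK memJ_conjg].
rewrite -(conjGid Gx0) sub_conjg -defK; apply/subsetP => _ /toGP[a Ga <-].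
have [] // : inH K a; move: a Ga; apply: (fullcl_ind full) => [a Ka | a Ka |].
- exact: inHM.
- exact: inHM.
by split; rewrite ?toG1 ?group1.
Qed.

Lemma hasl_full (H : {group gT}) s : {in s, forall a, inH H a} ->
  hasl L13 s -> hasl L2 s -> G \subset H.
Proof.
move=> Hs h13 h2; have [u Hu lu] := hasl_ind (@inHM H) Hs h13.
have [v Hv lv] := hasl_ind (@inHM H) Hs h2.
exact: gen_13_2 Hu Hv lu lv.
Qed.

(** A nontrivial normal subgroup contains one of the class representatives in [D2 :: D3 :: comps];
    products of its conjugates reach an element labelled [L13] and an involution, which generate. *)
Lemma model_simple : simple G.
Proof.
have G1 : G :!=: 1.
  apply/trivgPn; exists (toG C13); rewrite ?toG_in //.
  by apply/eqP; rewrite -toG1 => /(toG_inj (isT : C13 \in isl) one3_in).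
apply/simpleP; split=> // H nHG; have [sHG nH] := andP nHG.
have [H1|/trivgPn[h Hh h1]] := eqVneq (gval H) 1; [by left | right].
apply/eqP; rewrite eqEsubset sHG.
have /toGP[a Ga ha] := subsetP sHG _ Hh.
have an1 : a <> one3 by move=> a1; case/eqP: h1; rewrite -ha a1 toG1.
have Hconj g b : g \in isl -> inH H b -> inH H (conj3 g b).
  move=> Gg [Gb Hb]; split; first exact: conj3_in.
  by rewrite toG_conj // memJ_norm // (subsetP nH) // groupV toG_in.
have Ha : inH H a by split; rewrite ?ha.
have [g Gg gE] := rep_conj Ga an1; have := allP norm_check _ (repl_reps an1).
rewrite -gE; have Hb := Hconj g a Gg Ha; have bn1 : conj3 g a <> one3.
  move=> b1; case: an1; apply: (toG_inj Ga one3_in); apply: (conjg_inj (toG g)^-1).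
  by rewrite -(toG_conj Gg Ga) b1 toG1 conj1g.
move: (conj3 g a) Hb bn1 => b Hb bn1.
rewrite /norm_test; case: eqmP => [/bn1 [] | _].
case: ifP => // l13 l2; apply: hasl_full l13 l2.
have Hs : {in [seq conj3 g b | g <- [:: one3; C13; sq C13; sq (sq C13); T13; mm C13 T13; mm T13 C13; mm T13 (mm C13 T13); mm (sq C13) T13; sq (sq (sq C13))]], forall a, inH H a}.
  move=> _ /mapP[x xin ->]; apply: Hconj => //.
  by move: x xin; apply/allP.
have H2 := mulset_ind (@inHM H) Hs Hs.
exact: (cat_ind Hs (cat_ind H2 (mulset_ind (@inHM H) Hs H2))).
Qed.

Definition tp (p : m3 * m3) := (toG p.1, toG p.2).
Definition gen3 (p : m3 * m3) := isl2 p && genp G (tp p).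

Lemma gentest_sound p : isl2 p -> gentest p -> gen3 p.
Proof.
move=> Gp; have /andP[G1 G2] := Gp; rewrite /gentest /gen3 Gp /=.
case: ifP => // h13 h2; rewrite /genp eqEsubset; apply/andP; split.
  by rewrite gen_subG; apply/subsetP => _ /set2P[] ->; apply: toG_in.
apply: (hasl_full (H := <<[set toG p.1; toG p.2]>>%G) _ h13 h2).
by apply: (words_ind (@inHM _) (@inHV _)); split=> //; rewrite mem_gen // !inE eqxx ?orbT.
Qed.

(** In a finite group the products of generators, without inverses, already fill the generated
    subgroup. *)
Lemma gen3_ind (Q : m3 -> Prop) p : gen3 p -> Q one3 ->
  (forall x, x \in isl -> Q x -> Q (mm x p.1)) -> (forall x, x \in isl -> Q x -> Q (mm x p.2)) ->
  forall a, a \in isl -> Q a.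
Proof.
case/andP=> /andP[G1 G2] /eqP gp Q1 Qx Qy a Ga.
suff [b [Gb ab Qb]] : exists b, [/\ b \in isl, toG a = toG b & Q b] by rewrite (toG_inj Ga Gb ab).
have /gen_prodgP[n [c cP ->]] : toG a \in <<[set toG p.1; toG p.2]>> by rewrite gp toG_in.
elim: n c cP => [|n IHn] c cP.
  by exists one3; rewrite big_ord0 toG1.
rewrite big_ord_recr /=; have [|b [Gb -> Qb]] := IHn (fun i => c (widen_ord (leqnSn n) i)).
  by move=> i; apply: cP.
have /set2P[] := cP ord_max => ->; [exists (mm b p.1) | exists (mm b p.2)].
  by split; [apply: mm_in | rewrite toGM | apply: Qx].
by split; [apply: mm_in | rewrite toGM | apply: Qy].
Qed.

Lemma eigenP v a : reflect (vm v a = v \/ vm v a = vopp v) (eigen v a).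
Proof.
rewrite /eigen; case: eqvP => [->|nv]; first by constructor; left.
by apply: (iffP (eqvP _ _)) => [->|[|]]; [right | |].
Qed.

Lemma voppK : involutive vopp. Proof. by case=> [[] [] []]. Qed.
Lemma vopp_add u v : vopp (vadd u v) = vadd (vopp u) (vopp v).
Proof. by case: u => [[] [] []]; case: v => [[] [] []]. Qed.
Lemma vscale_opp x v : vscale (opp3 x) v = vopp (vscale x v).
Proof. by case: x; rewrite //= voppK. Qed.
Lemma vm_opp v a : vm (vopp v) a = vopp (vm v a).
Proof. by case: v => x y z; case: a => a b c; rewrite /= !vscale_opp !vopp_add. Qed.

Lemma eigenM v a b : eigen v a -> eigen v b -> eigen v (mm a b).
Proof.
move=> /eigenP va /eigenP vb; apply/eigenP; rewrite vmA.
by case: va => ->; case: vb => E; rewrite ?vm_opp E ?voppK; auto.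
Qed.
Lemma eigen1 v : eigen v one3. Proof. by apply/eigenP; left; apply: vm1. Qed.

Lemma eigen_ex v : v <> v0 -> exists2 a, a \in isl & ~~ eigen v a.
Proof.
move=> v_n0; have := allP eigen_check _ (mem_v3s v).
by case: eqvP => // _ /hasP[a]; rewrite mem_allG; exists a.
Qed.

Lemma tau3_in a : a \in isl -> tau3 a \in isl.
Proof.
rewrite -mem_allG => /(allP lab_check); rewrite /lab_test.
by do 5! [case: ifP => // _].
Qed.
Lemma tau3K a : a \in isl -> tau3 (tau3 a) = a.
Proof.
rewrite -mem_allG => /(allP lab_check); rewrite /lab_test.
by do 5! [case: ifP => // _]; move/eqmP.
Qed.
Lemma lab_tau3 a : a \in isl -> lab (tau3 a) = tlab (lab a).
Proof.
rewrite -mem_allG => /(allP lab_check); rewrite /lab_test.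
by do 3! [case: ifP => // _]; case: ifP => // /eqvP.
Qed.
Lemma lab_inv a : a \in isl -> lab (inv3 a) = tlab (lab a).
Proof.
rewrite -mem_allG => /(allP lab_check); rewrite /lab_test.
by do 2! [case: ifP => // _]; case: ifP => // /eqvP.
Qed.

Lemma ngred_sound p : gen3 p -> ~~ ngred p.
Proof.
move=> gp; apply/hasP => -[v _]; case: eqvP => // v_n0; case: ifP => // v1 v2.
have [a Ga] := eigen_ex v_n0; case/negP; move: a Ga.
by apply: (gen3_ind gp) => [|x _ vx|x _ vx]; [apply: eigen1 | apply: eigenM..].
Qed.

Transparent nongen.
(** Each certificate is a property true at 1 and kept by right multiplication by the two components,
    yet false somewhere in the group. *)
Lemma nongen_sound p : gen3 p -> ~~ nongen p.
Proof.
move=> gp; have /andP[/andP[G1 G2] _] := gp.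
rewrite /nongen (negPf (ngred_sound gp)); case: ifP => [/hasP[v _] | _].
  case: eqvP => // v_n0; case: ifP => // v1 v2.
  have [a Ga] := eigen_ex v_n0; rewrite -(tau3K Ga); case/negP.
  move: (tau3 a) (tau3_in Ga) => {a Ga}; apply: (gen3_ind gp) => [|x Gx vx|x Gx vx].
  - exact: eigen1.
  - by rewrite tau3M //; apply: eigenM.
  by rewrite tau3M //; apply: eigenM.
rewrite /ngsmall; set s := close _ _ _ _ _; case: ifP => // s1.
case: ifP => // /allP sM; rewrite negbK; apply/allP => a; rewrite mem_allG; move: a.
have hasE x : has (eqm x) s = (x \in s).
  by apply/hasP/idP => [[y sy /eqmP->] // | sx]; exists x => //; apply/eqmP.
by apply: (gen3_ind gp) => // x _; rewrite hasE => /sM; case: ifP.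
Qed.

Opaque nongen.
Lemma tp_conj g p : g \in isl -> isl2 p -> tp (conjp3 g p) = conjp (tp p) (toG g)^-1.
Proof. by move=> Gg /andP[G1 G2]; rewrite /tp /conjp /= !toG_conj. Qed.

Lemma isl2_conj g p : g \in isl -> isl2 p -> isl2 (conjp3 g p).
Proof. by move=> Gg /andP[G1 G2]; rewrite /isl2 !conj3_in. Qed.

Lemma gen3_conj g p : g \in isl -> gen3 p -> gen3 (conjp3 g p).
Proof.
move=> Gg /andP[Gp gp]; rewrite /gen3 isl2_conj // tp_conj //.
by apply: genp_conj => //; rewrite groupV toG_in.
Qed.

Lemma conj3_mm g a b : g \in isl -> conj3 g (mm a b) = mm (conj3 g a) (conj3 g b).
Proof.
move=> Gg; rewrite !conj3E -!mm_assoc mmK //.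
Qed.

Lemma lab3_conj g p : g \in isl -> isl2 p -> lab3 (conjp3 g p) = lab3 p.
Proof.
move=> Gg /andP[G1 G2]; rewrite /lab3 /= -conj3_mm // !lab_conj ?mm_in //.
Qed.

Lemma lem_lev1 a b c a' b' c' : lem (M a b c) (M a' b' c') -> vcode a <= vcode a'.
Proof.
rewrite lemE /=; have := vcode_lt b; have := vcode_lt b'; have := vcode_lt c; have := vcode_lt c'; lia.
Qed.
Lemma lem_lev2 a b c b' c' : lem (M a b c) (M a b' c') -> vcode b <= vcode b'.
Proof.
rewrite lemE /=; have := vcode_lt b; have := vcode_lt b'; have := vcode_lt c; have := vcode_lt c'; lia.
Qed.

Lemma flag_le u v : vcode u <= vcode v -> flag u <> Z3 -> flag v <> Z3.
Proof. by case: u => [[] [] []]; case: v => [[] [] []]. Qed.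

Lemma labmin_le a b c : labmin (M a b c) -> vcode a <= vcode b /\ vcode b <= vcode c.
Proof.
move=> lm; have t1 := allP lm (M b a c); have t2 := allP lm (M a c b).
by split; [apply/lem_lev1/t1 | apply/lem_lev2/t2]; rewrite !inE eqxx ?orbT.
Qed.

Lemma regP a : reflect (flag (lab a) = Z3) (reg a). Proof. exact: eqfP. Qed.

(** The flag is the leading digit of a label and [Z3] is the least flag. If the smallest label is
    not regular, then neither is the second, and [derog_check] gives a common eigenvector. *)
Lemma labmin_reg p : gen3 p -> labmin (lab3 p) -> reg p.1.
Proof.
move=> gp /labmin_le[le12 _]; have /andP[/andP[G1 G2] _] := gp.
apply/regP; case: (eqVneq (flag (lab p.1)) Z3) => // /eqP f1.
have f2 := flag_le le12 f1.
have [g Gg gE] : exists2 g, g \in isl & conj3 g p.1 \in [:: one3; D2; D3].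
  case: (eqVneq p.1 one3) => [p1 | /eqP p1].
    by exists one3 => //; rewrite p1 conj3_1.
  have [g Gg gE] := rep_conj G1 p1; exists g; rewrite // gE /repl.
  by case: (flag _) f1 => // _; case: ifP; rewrite !inE eqxx ?orbT.
have := ngred_sound (gen3_conj Gg gp); have Gb := conj3_in Gg G2.
have := allP derog_check _ gE => /allP/(_ (conj3 g p.2)).
rewrite mem_allG => /(_ Gb); rewrite lab_conj //; case: eqfP => // _.
by rewrite /conjp3 => ->.
Qed.

(** The normal form starts with a companion matrix, has minimal labels and a least second component,
    so [Rtest] accepts it; [isgen] does too, because [nongen] never holds for a generating pair. *)
Lemma Plist_complete p : gen3 p -> labmin (lab3 p) -> nform p \in Plist.
Proof.
move=> gp lm; have r1 := labmin_reg gp lm; have /andP[Gp _] := gp.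
have [g Gg defq] := nform_conj Gp r1; have gq : gen3 (nform p) by rewrite defq gen3_conj.
have lq : lab3 (nform p) = lab3 p by rewrite defq lab3_conj.
have nq : nform (nform p) = nform p by rewrite {1}defq nform_inv.
have /andP[Gq _] := gq; have rq : reg (nform p).1 by rewrite defq /reg lab_conj //; case/andP: Gp.
rewrite mem_filter; apply/andP; split.
  by rewrite /isgen nongen_sound // if_same.
have := nformE Gq rq; rewrite nq; case=> x defx [_ xmin].
have [y defy _] := nformE Gp r1.
apply/flattenP; exists [seq ((nform p).1, bl.1) | bl <- [seq bl <- labG | Rtest (nform p).1 (lab (nform p).1) (cands (nform p).1) bl]].
  by apply/mapP; exists (nform p).1; rewrite // defy compl_comps.
apply/mapP; exists ((nform p).2, lab (nform p).2); last by rewrite -surjective_pairing.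
rewrite mem_filter; apply/andP; split; last first.
  by apply/mapP; exists (nform p).2; rewrite // mem_allG; case/andP: Gq.
have lmq := lm; rewrite -lq in lmq; have [le1 le2] := labmin_le lmq.
rewrite /Rtest !levE le1 le2 lmq; apply/allP => gg cg; rewrite lemE.
have -> : (nform p).2 = x by rewrite defx.
by apply: xmin; apply/mapP; exists gg; rewrite // defx.
Qed.

Lemma Plist_sound p : p \in Plist -> [/\ gen3 p, labmin (lab3 p), reg p.1 & nform p = p].
Proof.
move=> Pp; have gt := allP gen_Plist _ Pp; move: Pp; rewrite mem_filter => /andP[_].
case/flattenP=> _ /mapP[a ca ->] /mapP[[b lb]]; rewrite mem_filter => /andP[].
move=> Rt /mapP[c Gc [eb elb]]; rewrite {}eb {}elb in Rt * => defp.
rewrite mem_allG in Gc; move: Rt; rewrite /Rtest; case: ifP => // _; case: ifP => // _; case: ifP => // lm /allP cmin.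
have /and4P[Ga ra /eqmP ea /eqmP e1] := allP comps_check _ ca.
have Gp : isl2 p by rewrite defp /isl2 Gc andbT.
have r1 : reg p.1 by rewrite defp.
split; [exact: gentest_sound | by rewrite defp; exact: lm | exact: r1 | ].
have [x -> [xin xmin]] := nformE Gp r1; rewrite defp /= ea; congr pair; apply: mcode_inj.
apply/eqP; rewrite eqn_leq; apply/andP; split.
  (* The first basis vector is cyclic for a companion matrix and gives the identity as a
     candidate. *)
  apply: xmin; apply/mapP; exists (one3, inv3 one3).
    by apply/candsP; exists (V O3 Z3 Z3); rewrite defp [(_, _).1]/= e1.
  by rewrite defp /cj /= inv3_1 m1m mm1.
move: xin => /mapP[gg]; rewrite defp /= => /cmin; rewrite lemE => le_c defx.
by rewrite defx.
Qed.

Lemma genp_lift p : genp G p -> exists2 p3, gen3 p3 & tp p3 = p.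
Proof.
move=> gp; have [/toGP[a Ga a1] /toGP[b Gb b2]] := genp_mem gp.
have tpE : tp (a, b) = p by rewrite /tp /= a1 b2 -surjective_pairing.
by exists (a, b); rewrite // /gen3 tpE gp /isl2 Ga Gb.
Qed.

Definition ofG (g : gT) : m3 :=
  if pselect (exists2 a, a \in isl & toG a = g) is left e then s2val (cid2 e) else one3.
Lemma ofGK a : a \in isl -> ofG (toG a) = a.
Proof.
move=> Ga; rewrite /ofG; case: pselect => [e|[]]; last by exists a.
by case: cid2 => b Gb E; apply: toG_inj.
Qed.
Definition taug g := toG (tau3 (ofG g)).
Lemma taugE a : a \in isl -> taug (toG a) = toG (tau3 a).
Proof. by move=> Ga; rewrite /taug ofGK. Qed.
Lemma taugM : {in G &, {morph taug : x y / x * y}}.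
Proof.
move=> _ _ /toGP[a Ga <-] /toGP[b Gb <-].
by rewrite -toGM // !taugE ?mm_in // tau3M // toGM ?tau3_in.
Qed.
Lemma taugG x : x \in G -> taug x \in G.
Proof. by case/toGP=> a Ga <-; rewrite taugE // toG_in ?tau3_in. Qed.
Lemma taugK : {in G, involutive taug}.
Proof. by move=> _ /toGP[a Ga <-]; rewrite !taugE ?tau3_in // tau3K. Qed.

Lemma tp_tau p : isl2 p -> tp (taup3 p) = taup taug (tp p).
Proof. by case/andP=> G1 G2; rewrite /tp /taup /= !taugE. Qed.
Lemma isl2_tau p : isl2 p -> isl2 (taup3 p).
Proof. by case/andP=> G1 G2; rewrite /isl2 !tau3_in. Qed.

Definition word (w : seq bool) : Defs.F2 :=
  foldr (fun (b : bool) x => (if b then F2y else F2x) * x) 1 w.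
Lemma evw_in p w : isl2 p -> evw p w \in isl.
Proof. by case/andP=> G1 G2; elim: w => //= b w IHw; case: b; apply: mm_in. Qed.
Lemma toG_evw p w : isl2 p -> toG (evw p w) = ev (tp p) (word w).
Proof.
move=> Gp; have /andP[G1 G2] := Gp; elim: w => [|b w IHw] /=.
  by rewrite toG1 ev1.
have Gw := evw_in w Gp.
by case: b; rewrite toGM // IHw evM ?evx ?evy.
Qed.
Lemma evw_conj g p w : g \in isl -> isl2 p -> evw (conjp3 g p) w = conj3 g (evw p w).
Proof.
move=> Gg Gp; elim: w => [|b w IHw] /=; first by rewrite conj3E mm1 mm_invr.
by rewrite IHw; case: b; rewrite -conj3_mm.
Qed.
Lemma relpat_conj g p : g \in isl -> isl2 p -> relpat (conjp3 g p) = relpat p.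
Proof.
move=> Gg Gp; apply: eq_map => w; rewrite evw_conj //.
have Gw := evw_in w Gp; apply/eqmP/eqmP => [E|->]; last by rewrite conj3E mm1 mm_invr.
apply: (toG_inj Gw one3_in); apply: (conjg_inj (toG g)^-1).
by rewrite -toG_conj // E toG1 conj1g.
Qed.

Lemma relpat_lab q : isl2 q -> relpat q = relpat P0 -> lab3 q = lab3 P0.
Proof.
case/andP=> G1 G2; rewrite relpat0 /relpat.
move=> [] /= /eqmP a4 /eqmP a2 /eqmP b4 /eqmP b2 /eqmP c6 /eqmP c2 /eqmP c3 _.
rewrite lab3_P0.
have ord a := allP ordlab_check a; move: a4 a2 b4 b2 c6 c2 c3; rewrite !mm1 => a4 a2 b4 b2 c6 c2 c3.
have l4 a : a \in isl -> mm a (mm a (mm a a)) = one3 -> mm a a <> one3 -> lab a = V Z3 O3 O3.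
  rewrite -mem_allG => /ord; rewrite /ordlab_test /sq => + a4' a2'.
  case: eqmP => // _; rewrite -!mm_assoc a4'; case: eqmP => // _; exact: eqvP.
rewrite /lab3 (l4 _ G1 a4 a2) (l4 _ G2 b4 b2).
have := ord (mm q.1 q.2); rewrite mem_allG mm_in // => /(_ isT).
rewrite /ordlab_test /sq; set c := mm q.1 q.2 in c6 c2 c3 *.
case: eqmP => [c2'|_]; first by case: c2; rewrite -c2' /c -!mm_assoc.
case: eqmP => [c4|_].
  case: c2; have: mm (mm c c) (mm (mm c c) (mm c c)) = one3 by rewrite -c6 /c -!mm_assoc.
  by rewrite c4 mm1 /c -!mm_assoc.
case: eqmP => [_|[]]; last by rewrite -c6 /c -!mm_assoc.
case: eqmP => [c3'|_]; first by case: c3; rewrite -c3' /c -!mm_assoc.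
by move/eqvP->.
Qed.

Lemma gen3_P0 : gen3 P0.
Proof. exact: gentest_sound isl2_P0 gentest_P0. Qed.

Lemma conjp3V g p : g \in isl -> isl2 p -> conjp3 (inv3 g) (conjp3 g p) = p.
Proof.
case: p => a b Gg /andP[G1 G2]; rewrite /conjp3 /= -!conj3M ?inv3_in // mm_inv //.
by rewrite !conj3E !m1m inv3_1 !mm1.
Qed.

Lemma conjp3M g h p : g \in isl -> h \in isl -> conjp3 (mm g h) p = conjp3 g (conjp3 h p).
Proof. by move=> Gg Gh; rewrite /conjp3 !conj3M. Qed.

Lemma rigid q : gen3 q -> relpat q = relpat P0 ->
  exists2 g, g \in isl & q = conjp3 g P0 \/ q = conjp3 g (taup3 P0).
Proof.
move=> gq rq; have /andP[Gq _] := gq; have lq := relpat_lab Gq rq.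
have lm : labmin (lab3 q) by rewrite lq; apply: labmin_P0.
have r1 := labmin_reg gq lm; have [g Gg defq] := nform_conj Gq r1.
have GP0 := isl2_P0; have Gt := isl2_tau GP0; have Gg' := inv3_in Gg.
have rq' : relpat (nform q) = relpat P0 by rewrite defq relpat_conj.
have [E|E] := rigid_Plist (Plist_complete gq lm) rq'.
  exists (inv3 g); first exact: Gg'.
  by left; rewrite -E defq (conjp3V Gg Gq).
have rt : reg (taup3 P0).1.
  by apply/regP; have [G1 _] := andP GP0; rewrite lab_tau3 //; have [-> _ _] := lab3_P0.
have [h Gh deft] := nform_conj Gt rt.
exists (mm (inv3 g) h); first exact: mm_in Gg' Gh.
by right; rewrite (conjp3M _ Gg' Gh) -deft -E defq (conjp3V Gg Gq).
Qed.

(** Words [u0], [u1] expressing [P0] in [p] yield at [q] a pair [q0] with the relations of [P0], so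
    [q0] is conjugate to [P0] or to its image under [tau]. The words [v0], [v1] that recover [p]
    from [P0] also recover [q] from [q0]. *)
Lemma model_rel p q : genp G p -> genp G q -> samerel p q ->
  exists2 g, g \in G & q = conjp p g \/ q = conjp (taup taug p) g.
Proof.
move=> gp gq pq; have /andP[_ gP] := gen3_P0.
have [GP1 GP2] := genp_mem gP.
have /(genpP _ _ gp)[u0 u0E] := GP1; have /(genpP _ _ gp)[u1 u1E] := GP2.
have P0E w : ev (tp P0) w = ev p (subst u0 u1 w).
  by rewrite ev_subst u0E u1E -surjective_pairing.
have [Gp1 Gp2] := genp_mem gp.
have /(genpP _ _ gP)[v0 v0E] := Gp1; have /(genpP _ _ gP)[v1 v1E] := Gp2.
pose q0 := (ev q u0, ev q u1).
have q0E w : ev q0 w = ev q (subst u0 u1 w) by rewrite ev_subst.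
have transfer u v : ev p u = ev p v -> ev q u = ev q v.
  move=> E; apply/eqP; rewrite eq_mulgV1 -evV -evM; apply/eqP/pq.
  by rewrite evM evV E mulgV.
have q1E : ev q0 v0 = q.1.
  by rewrite q0E -[RHS]evx; apply: transfer; rewrite -P0E v0E evx.
have q2E : ev q0 v1 = q.2.
  by rewrite q0E -[RHS]evy; apply: transfer; rewrite -P0E v1E evy.
have gq0 : genp G q0.
  apply/genpP => g; split=> [Gg | [u <-]]; last by rewrite q0E ev_gen.
  have /(genpP _ _ gq)[u <-] := Gg; exists (subst v0 v1 u).
  by rewrite ev_subst q1E q2E -surjective_pairing.
have [q3 gq3 tq3] := genp_lift gq0; have /andP[Gq3 _] := gq3.
have rq3 : relpat q3 = relpat P0.
  apply: eq_map => w; have GP0 := isl2_P0.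
  have eq1 r : isl2 r -> (eqm (evw r w) one3) = (ev (tp r) (word w) == 1).
    move=> Gr; rewrite -toG_evw // -toG1; apply/eqmP/eqP => [-> //|].
    exact: (toG_inj (evw_in w Gr) one3_in).
  rewrite !eq1 // tq3 P0E q0E; apply/eqP/eqP => E; exact/pq.
have [g Gg E] := rigid gq3 rq3; exists (toG g)^-1; first by rewrite groupV toG_in.
have GP0 := isl2_P0.
have P1 : ev (tp P0) v0 = p.1 by []. have P2 : ev (tp P0) v1 = p.2 by [].
case: E => E; [left | right]; move: tq3; rewrite E.
  rewrite (tp_conj Gg GP0) => defq0.
  by rewrite [LHS]surjective_pairing -q1E -q2E -defq0 !ev_conj P1 P2.
rewrite (tp_conj Gg (isl2_tau GP0)) (tp_tau GP0) => defq0.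
rewrite [LHS]surjective_pairing -q1E -q2E -defq0 !ev_conj.
by rewrite !(ev_tau taugM _ gP) P1 P2.
Qed.

(** * The set Y of classes of generating pairs and the maps on it *)

Definition orb (p : gT * gT) := [set conjp p g | g in G].
Definition orbs := [set o : {set gT * gT} | [exists p, genp G p && (o == orb p)]].
Local Notation cY := {o : {set gT * gT} | o \in orbs}.

Lemma orb_in p : genp G p -> orb p \in orbs.
Proof. by move=> gp; rewrite inE; apply/existsP; exists p; rewrite gp eqxx. Qed.

Lemma genp_P0 : genp G (tp P0). Proof. by case/andP: gen3_P0. Qed.
Definition clY (p : gT * gT) : cY := insubd (exist (fun o => o \in orbs) (orb (tp P0)) (orb_in genp_P0)) (orb p).
Lemma clYE p : genp G p -> val (clY p) = orb p.
Proof. by move=> gp; rewrite insubdK //; apply: orb_in. Qed.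

Lemma conjpM (p : gT * gT) g h : conjp p (g * h) = conjp (conjp p g) h.
Proof. by rewrite /conjp /= !conjgM. Qed.
Lemma conjp1 (p : gT * gT) : conjp p 1 = p. Proof. by case: p => a b; rewrite /conjp !conjg1. Qed.

Lemma clYP p q : genp G p -> genp G q ->
  (clY p = clY q <-> exists2 g, g \in G & q = conjp p g).
Proof.
move=> gp gq; split=> [/(congr1 val) | [g Gg ->]].
  rewrite !clYE // => E; have: q \in orb q by apply/imsetP; exists 1; rewrite ?conjp1.
  by rewrite -E => /imsetP[g Gg ->]; exists g.
apply: val_inj; rewrite !clYE ?genp_conj //; apply/setP => r; apply/imsetP/imsetP => -[h Gh ->].
  by exists (g^-1 * h); rewrite ?groupM ?groupV // -conjpM mulKVg.
by exists (g * h); rewrite ?groupM // conjpM.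
Qed.

Lemma clY_onto y : exists2 p, genp G p & clY p = y.
Proof.
have := valP y; rewrite inE => /existsP[p /andP[gp /eqP yp]].
by exists p => //; apply: val_inj; rewrite clYE.
Qed.

Definition repY y := s2val (cid2 (clY_onto y)).
Lemma repY_gen y : genp G (repY y). Proof. exact: s2valP (cid2 (clY_onto y)). Qed.
Lemma repYK y : clY (repY y) = y. Proof. exact: s2valP' (cid2 (clY_onto y)). Qed.

Lemma repY_clY p : genp G p -> exists2 g, g \in G & p = conjp (repY (clY p)) g.
Proof. by move=> gp; apply/clYP; rewrite ?repY_gen ?repYK. Qed.

Definition cl3 p := clY (tp p).
Lemma gen3_mth p : gen3 p -> gen3 (mth p).
Proof.
case/andP=> /andP[G1 G2] gp; apply/andP; split; first by apply/andP.
by move: gp; rewrite /genp /= setUC.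
Qed.

Lemma tp_mde p : isl2 p -> tp (mde p) = ((tp p).2^-1 * (tp p).1^-1, (tp p).2).
Proof. by case/andP=> G1 G2; rewrite /tp /= toGV ?mm_in // toGM // invMg. Qed.

Lemma gen3_mde p : gen3 p -> gen3 (mde p).
Proof.
case/andP=> Gp /eqP gp; have /andP[G1 G2] := Gp.
rewrite /gen3 /isl2 /= inv3_in ?mm_in // G2 tp_mde //= /genp -gp /=.
rewrite eqEsubset !gen_subG; apply/andP; split; apply/subsetP => _ /set2P[] ->.
- by rewrite groupM ?groupV ?mem_gen // !inE /= eqxx ?orbT.
- by rewrite mem_gen // !inE /= eqxx ?orbT.
- have B2 : toG p.2 \in <<[set (toG p.2)^-1 * (toG p.1)^-1; toG p.2]>>.
    by rewrite mem_gen // !inE /= eqxx ?orbT.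
  by rewrite -groupV -(groupMl _ (groupVr B2)) mem_gen // !inE /= eqxx.
by rewrite mem_gen // !inE /= eqxx ?orbT.
Qed.

Lemma gen3_tau p : gen3 p -> gen3 (taup3 p).
Proof.
case/andP=> Gp gp; rewrite /gen3 isl2_tau // tp_tau //.
exact: genp_tau taugM taugG taugK _ gp.
Qed.

Lemma cl3P p q : gen3 p -> gen3 q -> (cl3 p = cl3 q <-> exists2 g, g \in isl & q = conjp3 g p).
Proof.
move=> /andP[Gp gp] /andP[Gq gq]; split=> [/(iffLR (clYP gp gq))[_ /toGP[g Gg <-] E] | [g Gg ->]].
  exists (inv3 g); first exact: inv3_in.
  have := tp_conj (inv3_in Gg) Gp; rewrite toGV // invgK -E => -[E1 E2].
  have /andP[G1 G2] := Gp; have /andP[G1' G2'] := Gq.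
  rewrite [LHS]surjective_pairing [RHS]surjective_pairing; congr pair.
    by apply/esym/(toG_inj (conj3_in (inv3_in Gg) G1) G1').
  by apply/esym/(toG_inj (conj3_in (inv3_in Gg) G2) G2').
rewrite /cl3 tp_conj //; apply/(clYP gp); last first.
  by exists (toG g)^-1; rewrite // groupV toG_in.
by apply: genp_conj => //; rewrite groupV toG_in.
Qed.

Lemma cl3_conj g p : g \in isl -> gen3 p -> cl3 (conjp3 g p) = cl3 p.
Proof. by move=> Gg gp; apply/esym/cl3P => //; [apply: gen3_conj | exists g]. Qed.

Lemma cl3_onto y : exists2 p, gen3 p & cl3 p = y.
Proof. by have [p3 g3 E] := genp_lift (repY_gen y); exists p3; rewrite // /cl3 E repYK. Qed.

Definition tthY y := clY ((repY y).2, (repY y).1).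
Definition tdeY y := clY ((repY y).2^-1 * (repY y).1^-1, (repY y).2).
Definition ttaY y := clY (taup taug (repY y)).
Definition labY y := lab (ofG (repY y).1).

(** A map on pairs descends to classes once it is compatible with conjugation; [h] allows the
    conjugating element to change, as it does under [taug]. *)
Lemma clY_equivariant (f : gT * gT -> gT * gT) h p : {in genp G, forall q, genp G (f q)} ->
  (forall q g, genp G q -> g \in G -> f (conjp q g) = conjp (f q) (h g)) -> {in G, forall g, h g \in G} ->
  genp G p -> clY (f (repY (clY p))) = clY (f p).
Proof.
move=> fG fE hG gp; have [g Gg E] := repY_clY gp; have gr := repY_gen (clY p).
apply/(clYP (fG _ gr) (fG _ gp)); exists (h g); first exact: hG.
by rewrite {1}E fE.
Qed.

Lemma tthYE p : genp G p -> tthY (clY p) = clY (p.2, p.1).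
Proof.
apply: (@clY_equivariant (fun q => (q.2, q.1)) id) => // q gq.
by have [r gr <-] := genp_lift gq; case/andP: (gen3_mth gr).
Qed.

Lemma tdeYE p : genp G p -> tdeY (clY p) = clY (p.2^-1 * p.1^-1, p.2).
Proof.
apply: (@clY_equivariant (fun q => (q.2^-1 * q.1^-1, q.2)) id) => // [q gq | q g _ _].
  have [r gr <-] := genp_lift gq; case/andP: (gen3_mde gr) => _.
  by rewrite tp_mde //; case/andP: gr.
by rewrite /conjp /= conjMg !conjVg.
Qed.

Lemma ttaYE p : genp G p -> ttaY (clY p) = clY (taup taug p).
Proof.
apply: (@clY_equivariant (taup taug) taug) => [q gq | q g gq Gg |]; last exact: taugG.
  have gq' : genp G q := gq; exact: (genp_tau taugM taugG taugK gq').
have tJ := tauJ taugM; have [G1 G2] := genp_mem gq.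
by rewrite /conjp /taup /= !tJ.
Qed.

Lemma labYE p : genp G p -> labY (clY p) = lab (ofG p.1).
Proof.
move=> gp; have [r gr rE] := genp_lift (repY_gen (clY p)); have [q gq qE] := genp_lift gp.
have /(cl3P gr gq)[g Gg qr] : cl3 r = cl3 q by rewrite /cl3 rE qE repYK.
have /andP[/andP[Gr1 _] _] := gr; have /andP[/andP[Gq1 _] _] := gq.
rewrite /labY -rE; have -> : p.1 = toG q.1 by rewrite -qE.
have -> : (tp r).1 = toG r.1 by [].
by rewrite !ofGK // qr lab_conj.
Qed.

Lemma labYP p q : genp G p -> genp G q -> (labY (clY p) = labY (clY q) <-> q.1 \in p.1 ^: G).
Proof.
move=> gp gq; rewrite !labYE //; have [q3 /andP[/andP[Gq1 _] _] <-] := genp_lift gq.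
have [p3 /andP[/andP[Gp1 _] _] <-] := genp_lift gp; rewrite /= !ofGK //.
exact: labP3.
Qed.

Lemma model_isog : GT1 G \isog symgroup tthY tdeY ttaY labY.
Proof.
apply: (GT1_isog_symset model_simple _ taugM taugG taugK model_rel clYP clY_onto tthYE tdeYE ttaYE labYP).
apply/negP => abG; have C13T13 : mm C13 T13 = mm T13 C13.
  apply: toG_inj; rewrite ?mm_in // !toGM //.
  by apply: (centsP abG); apply: toG_in.
by move: C13T13.
Qed.

Lemma cl3_th p : gen3 p -> tthY (cl3 p) = cl3 (mth p).
Proof. by case/andP=> _ gp; rewrite /cl3 tthYE. Qed.
Lemma cl3_de p : gen3 p -> tdeY (cl3 p) = cl3 (mde p).
Proof. by case/andP=> Gp gp; rewrite /cl3 tdeYE // tp_mde. Qed.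
Lemma cl3_ta p : gen3 p -> ttaY (cl3 p) = cl3 (taup3 p).
Proof. by case/andP=> Gp gp; rewrite /cl3 ttaYE // tp_tau. Qed.
Lemma cl3_lab p : gen3 p -> labY (cl3 p) = lab p.1.
Proof. by case/andP=> /andP[G1 G2] gp; rewrite /cl3 labYE // ofGK. Qed.

Lemma genp_th p : genp G p -> genp G (p.2, p.1).
Proof. by move=> gp; have [r gr <-] := genp_lift gp; case/andP: (gen3_mth gr). Qed.
Lemma genp_de p : genp G p -> genp G (p.2^-1 * p.1^-1, p.2).
Proof.
move=> gp; have [r gr <-] := genp_lift gp; case/andP: (gen3_mde gr) => _.
by rewrite tp_mde //; case/andP: gr.
Qed.
Lemma genp_taug p : genp G p -> genp G (taup taug p).
Proof. exact: genp_tau taugM taugG taugK _. Qed.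

Lemma tthK : involutive tthY.
Proof.
move=> y; have [p gp <-] := clY_onto y.
by rewrite tthYE // (tthYE (genp_th gp)) -surjective_pairing.
Qed.

(** On pairs, [delta] applied twice is conjugation by the second component, so it is an involution
    on classes only. *)
Lemma tdeK : involutive tdeY.
Proof.
move=> y; have [p gp <-] := clY_onto y; have gd := genp_de gp; have [_ G2] := genp_mem gp.
rewrite tdeYE // (tdeYE gd); apply/esym/(clYP gp (genp_de gd)); exists p.2 => //=.
by rewrite /conjp invMg !invgK /conjg mulKg mulgA.
Qed.

Lemma ttaYK : involutive ttaY.
Proof.
move=> y; have [p gp <-] := clY_onto y; have [G1 G2] := genp_mem gp.
by rewrite ttaYE // (ttaYE (genp_taug gp)) /taup /= !taugK // -surjective_pairing.
Qed.

(** On pairs the two sides differ by conjugation by the first component. *)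
Lemma tbraid y : tthY (tdeY (tthY y)) = tdeY (tthY (tdeY y)).
Proof.
have [p gp <-] := clY_onto y; have [G1 _] := genp_mem gp.
have gh := genp_th gp; have gd := genp_de gp.
have gdh := genp_de gh; have ghd := genp_th gd.
rewrite tthYE // (tdeYE gh) (tthYE gdh) tdeYE // (tthYE gd) (tdeYE ghd) /=.
apply/esym/(clYP (genp_de ghd) (genp_th gdh)); exists p.1 => //.
by rewrite /conjp /= invMg !invgK mulgK /conjg mulKg mulgKV.
Qed.

Lemma tta_tth y : ttaY (tthY y) = tthY (ttaY y).
Proof.
have [p gp <-] := clY_onto y.
by rewrite tthYE // (ttaYE (genp_th gp)) ttaYE // (tthYE (genp_taug gp)).
Qed.

Lemma taugV : {in G, forall g, taug g^-1 = (taug g)^-1}.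
Proof.
have t1 : taug 1 = 1 by apply: (mulgI (taug 1)); rewrite -taugM ?group1 // !mulg1.
by move=> g Gg; apply: (mulIg (taug g)); rewrite -taugM ?groupV // !mulVg.
Qed.

Lemma tta_tde y : ttaY (tdeY y) = tdeY (ttaY y).
Proof.
have [p gp <-] := clY_onto y; have [G1 G2] := genp_mem gp.
rewrite tdeYE // (ttaYE (genp_de gp)) ttaYE // (tdeYE (genp_taug gp)).
by rewrite /taup /= taugM ?groupV // !taugV.
Qed.

Definition labY3 y := M (labY y) (labY (tthY y)) (labY (tdeY y)).

Lemma cl3_lab3 p : gen3 p -> labY3 (cl3 p) = lab3 p.
Proof.
move=> gp; have /andP[/andP[G1 G2] _] := gp.
rewrite /labY3 (cl3_th gp) (cl3_de gp) (cl3_lab gp) (cl3_lab (gen3_mth gp)).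
by rewrite (cl3_lab (gen3_mde gp)) /lab3 /= lab_inv ?mm_in.
Qed.

Lemma labY3_th y : labY3 (tthY y) = sth (labY3 y).
Proof.
rewrite /labY3 tthK /=; congr M; have [p gp <-] := cl3_onto y.
have /andP[/andP[G1 G2] _] := gp; have gh := gen3_mth gp.
rewrite (cl3_th gp) (cl3_de gh) (cl3_de gp) (cl3_lab (gen3_mde gh)) (cl3_lab (gen3_mde gp)) /=.
rewrite !lab_inv ?mm_in //; congr tlab.
by rewrite -(lab_conj G2 (mm_in G1 G2)) conj3E -!mm_assoc mm_invr // mm1.
Qed.

Lemma labY3_de y : labY3 (tdeY y) = sde (labY3 y).
Proof.
rewrite /labY3 tdeK /=; congr M; have [p gp <-] := cl3_onto y.
have gd := gen3_mde gp.
by rewrite (cl3_th gp) (cl3_de gp) (cl3_th gd) (cl3_lab (gen3_mth gd)) (cl3_lab (gen3_mth gp)).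
Qed.

Lemma labY_ta y : labY (ttaY y) = tlab (labY y).
Proof.
have [p gp <-] := cl3_onto y; have /andP[/andP[G1 G2] _] := gp.
by rewrite (cl3_ta gp) (cl3_lab gp) (cl3_lab (gen3_tau gp)) /= lab_tau3.
Qed.

Lemma labY3_ta y : labY3 (ttaY y) = sta (labY3 y).
Proof. by rewrite /labY3 -tta_tth -tta_tde !labY_ta. Qed.

(** * Comparison of the computed keys and blocks with those of W on Y *)

Local Notation WY := (orbgroup tthK tdeK ttaYK).
Local Notation wlY := (orbwords tthK tdeK ttaYK).
Local Notation keyY := (orbkey tthY tdeY ttaY labY3).
Local Notation inW := (orbgroupE tthK tdeK ttaYK tbraid tta_tth tta_tde).

Lemma gen3_orb6 p q : gen3 p -> q \in orb6 mth mde p -> gen3 q.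
Proof.
move=> gp; have gh := gen3_mth gp; have gd := gen3_mde gp; have gdh := gen3_mde gh.
rewrite !inE => /or4P[| | |/or3P[]] /eqP->;
  [exact: gp | exact: gh | exact: gd | exact: (gen3_mth gd) | exact: gdh | exact: (gen3_mth gdh)].
Qed.
Lemma gen3_orbp p q : gen3 p -> q \in orbp p -> gen3 q.
Proof.
by move=> gp; rewrite mem_cat => /orP[]; apply: gen3_orb6; [exact: gp | exact: gen3_tau gp].
Qed.

Lemma cl3_orb6 p : gen3 p -> map cl3 (orb6 mth mde p) = orb6 tthY tdeY (cl3 p).
Proof.
move=> gp; have gh := gen3_mth gp; have gd := gen3_mde gp; have gdh := gen3_mde gh.
rewrite /orb6 (cl3_th gp) (cl3_de gp) (cl3_th gd) (cl3_de gh) (cl3_th gdh).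
by rewrite !map_cons.
Qed.
Lemma cl3_orbp p : gen3 p -> map cl3 (orbp p) = orb12 tthY tdeY ttaY (cl3 p).
Proof.
move=> gp; have gt := gen3_tau gp.
by rewrite /orbp /orb12 map_cat (cl3_orb6 gp) (cl3_orb6 gt) (cl3_ta gp).
Qed.

Lemma orbp_word p q : gen3 p -> q \in orbp p -> exists2 w, w \in WY & cl3 q = w (cl3 p).
Proof.
move=> gp /(map_f cl3); rewrite (cl3_orbp gp) (orb12E tthK tdeK ttaYK) => /mapP[w ww ->].
by exists w; rewrite ?inW.
Qed.
Lemma word_orbp p w : gen3 p -> w \in WY -> exists2 q, q \in orbp p & w (cl3 p) = cl3 q.
Proof.
move=> gp; rewrite inW => /(map_f (fun w : {perm cY} => w (cl3 p))).
by rewrite -orb12E -(cl3_orbp gp) => /mapP.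
Qed.

Lemma nform_cl3 p : gen3 p -> reg p.1 ->
  [/\ cl3 (nform p) = cl3 p, gen3 (nform p) & lab3 (nform p) = lab3 p].
Proof.
move=> gp r1; have /andP[Gp _] := gp; have [g Gg ->] := nform_conj Gp r1.
by rewrite (cl3_conj Gg gp) (lab3_conj Gg Gp); split=> //; apply: gen3_conj.
Qed.

Lemma nform_eq p q : gen3 p -> gen3 q -> reg p.1 -> cl3 p = cl3 q -> nform q = nform p.
Proof.
move=> gp gq r1 /(cl3P gp gq)[g Gg ->]; have /andP[Gp _] := gp.
exact: nform_inv.
Qed.

(** A point of the orbit with the same triple is again minimal, so its first component is regular
    and [nform] is a complete invariant of its class. *)
Lemma cl3_keyE p : p \in Plist -> keyY (cl3 p) = key3 p.
Proof.
move=> /Plist_sound[gp lm r1 np].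
have bitE q : q \in orbp p ->
    (cl3 q == cl3 p) = (if eqm (lab3 q) (lab3 p) then eqp (nform q) p else false).
  move=> oq; have gq := gen3_orbp gp oq.
  case: (eqmP (lab3 q) (lab3 p)) => [lq | nl]; last first.
    by apply/eqP => E; case: nl; rewrite -(cl3_lab3 gq) E (cl3_lab3 gp).
  have rq : reg q.1 by apply: labmin_reg gq _; rewrite lq.
  apply/eqP/eqpP => [E | E]; first by rewrite (nform_eq gp gq r1 (esym E)) np.
  by have [<- _ _] := nform_cl3 gq rq; rewrite E.
rewrite /orbkey -(cl3_orbp gp) -map_comp (cl3_lab3 gp); congr pair.
by apply/eq_in_map => q /bitE.
Qed.

Lemma labmin_key p : gen3 p -> labmin (lab3 p) ->
  [/\ nform p \in Plist, cl3 (nform p) = cl3 p & keyY (cl3 p) = key3 (nform p)].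
Proof.
move=> gp lm; have Pp := Plist_complete gp lm.
have [E _ _] := nform_cl3 gp (labmin_reg gp lm).
by split; [exact: Pp | exact: E | rewrite -E; exact: cl3_keyE].
Qed.

Lemma labminP y : reflect (forall w, w \in WY -> mcode (labY3 y) <= mcode (labY3 (w y)))
  (labmin (labY3 y)).
Proof.
rewrite /labmin (orb12_label tthK tdeK ttaYK labY3_th labY3_de labY3_ta).
apply: (iffP allP) => [H w | H _ /mapP[w ww ->]]; last by rewrite lemE H // inW.
by rewrite inW -lemE => ww; apply: H; apply: (map_f (fun w : {perm cY} => labY3 (w y))).
Qed.

Lemma keyed_rep x : x \in kreps keyed ->
  [/\ x.1 \in Plist, x.2 = key3 x.1 & x.2 = keyY (cl3 x.1)].
Proof.
move=> /kreps_sub/keyedP[Px kx]; split; [exact: Px | exact: kx |].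
by rewrite kx; apply/esym; exact: cl3_keyE.
Qed.

Definition reps := [seq cl3 x.1 | x <- kreps keyed].

Lemma reps_key : map (orbkey tthY tdeY ttaY labY3) reps = map snd (kreps keyed).
Proof. by rewrite -map_comp; apply/eq_in_map => x /keyed_rep[_ _ ->]. Qed.

Lemma reps_uniq : uniq reps.
Proof. by apply: (@map_uniq _ _ (orbkey tthY tdeY ttaY labY3)); rewrite reps_key kreps_uniq. Qed.

(** A translate of [z] with the least triple in its orbit has its normal form in [Plist]. *)
Lemma reps_cover z : exists2 y, y \in reps & exists2 w, w \in WY & keyY (w z) = keyY y.
Proof.
have [w Ww wmin] := @arg_minnP _ 1 (mem WY) (fun w : {perm cY} => mcode (labY3 (w z))) (group1 WY).
have [p gp pE] := cl3_onto (w z).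
have lm : labmin (lab3 p).
  rewrite -(cl3_lab3 gp) pE; apply/labminP => v Wv.
  by rewrite -permM; apply: wmin; apply: groupM.
have [Pp _ kE] := labmin_key gp lm.
have /kreps_cover[x rx xE] : (nform p, key3 (nform p)) \in keyed.
  exact: (iffRL (keyedP (nform p, key3 (nform p))) (conj Pp erefl)).
exists (cl3 x.1); first exact: (map_f (fun x => cl3 x.1) rx).
have [_ _ kx] := keyed_rep rx; exists w; first exact: Ww.
by rewrite -pE; exact: etrans kE (etrans (esym xE) kx).
Qed.

Lemma bits_min p w : p \in Plist -> w \in WY -> labY3 (w (cl3 p)) = labY3 (cl3 p) ->
  leb (bits p) (keyY (w (cl3 p))).2.
Proof.
move=> Pp Ww; have [gp lm _ _] := Plist_sound Pp; have [q oq ->] := word_orbp gp Ww.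
have gq := gen3_orbp gp oq; rewrite (cl3_lab3 gq) (cl3_lab3 gp) => lq.
have [selP _ _ _ _] := final.
have lmq : labmin (lab3 q) by rewrite lq.
have [_ _ ->] := labmin_key gq lmq.
have := allP (selP _ Pp) _ oq; rewrite lq.
by case: (eqmP (lab3 p) (lab3 p)) => [_ H | n _]; [exact: H | case: n].
Qed.

(** Both triples are minimal in the same orbit, hence equal. [bits_min], used with [w] and with its
    inverse, makes the patterns equal, so the keys agree and [kreps] keeps one point for each
    key. *)
Lemma reps_inj : {in reps &, forall y z w, w \in WY -> keyY (w z) = keyY y -> y = z}.
Proof.
move=> _ _ /mapP[x rx ->] /mapP[x' rx' ->] w Ww E.
have [Px kx kyx] := keyed_rep rx; have [Px' kx' kyx'] := keyed_rep rx'.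
have [gx lx _ _] := Plist_sound Px; have [gx' lx' _ _] := Plist_sound Px'.
have Wv : w^-1 \in WY by rewrite groupV.
have E' : keyY (w^-1 (cl3 x.1)) = keyY (cl3 x'.1).
  rewrite -[in RHS](permK w (cl3 x'.1)); apply/esym.
  exact: (orbkey_orb tbraid tta_tth tta_tde labY3_th labY3_de labY3_ta Wv E).
have lE : labY3 (cl3 x.1) = labY3 (cl3 x'.1).
  apply: mcode_inj; apply/eqP; rewrite eqn_leq.
  have l1 : labY3 (w (cl3 x'.1)) = labY3 (cl3 x.1) := congr1 fst E.
  have l2 : labY3 (w^-1 (cl3 x.1)) = labY3 (cl3 x'.1) := congr1 fst E'.
  rewrite -{1}l2 -{2}l1; apply/andP; split.
    by apply: labminP Wv; rewrite (cl3_lab3 gx).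
  by apply: labminP Ww; rewrite (cl3_lab3 gx').
have l1 : labY3 (w (cl3 x'.1)) = labY3 (cl3 x'.1) by rewrite -lE; apply: (congr1 fst E).
have l2 : labY3 (w^-1 (cl3 x.1)) = labY3 (cl3 x.1) by rewrite lE; apply: (congr1 fst E').
have b1 := bits_min Px' Ww l1; have b2 := bits_min Px Wv l2.
rewrite E (cl3_keyE Px) in b1; rewrite E' (cl3_keyE Px') in b2.
have bE : bits x.1 = bits x'.1 by apply: leb_anti b2 b1.
have kE : x.2 = x'.2.
  by rewrite kx kx' /key3 bE -(cl3_lab3 gx) lE (cl3_lab3 gx').
by rewrite (uniq_map_inj (kreps_uniq keyed) rx rx' kE).
Qed.

(** Points of the block share the minimal triple, so each is the class of exactly one normal form in
    [Plist]; counting keys there counts the block. *)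
Lemma reps_block x : x \in kreps keyed -> #|block keyY (cl3 x.1)| = kcount keyed x.2.
Proof.
move=> /keyed_rep[Px kx kyx]; have [_ uP _ _ ->] := final.
pose s := [seq p <- Plist | x.2 == key3 p].
have sP p : p \in s -> p \in Plist by rewrite mem_filter => /andP[].
have us : uniq (map cl3 s).
  rewrite map_inj_in_uniq; first exact: filter_uniq uP.
  move=> p q /sP Pp /sP Pq E.
  have [gp _ rp <-] := Plist_sound Pp; have [gq _ _ <-] := Plist_sound Pq.
  exact/esym/(nform_eq gp gq rp E).
have <- : size (map cl3 s) = size s by rewrite size_map.
rewrite -(card_uniqP us); apply: eq_card => z; rewrite inE.
apply/eqP/mapP => [zx | [p + ->]].
  have [p gp pz] := cl3_onto z; have [gx lx _ _] := Plist_sound Px.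
  have lm : labmin (lab3 p).
    have l1 : labY3 z = labY3 (cl3 x.1) := congr1 fst zx.
    by rewrite -(cl3_lab3 gp) pz l1 (cl3_lab3 gx).
  have [Pn En kn] := labmin_key gp lm.
  exists (nform p); last by rewrite En pz.
  rewrite mem_filter Pn andbT; apply/eqP; rewrite kyx -zx -pz; exact: kn.
by rewrite mem_filter => /andP[/eqP E Pp]; rewrite (cl3_keyE Pp) -E kyx.
Qed.

Lemma nbrsP x w : x \in kreps keyed -> w \in WY -> keyY (w (cl3 x.1)) = keyY (cl3 x.1) ->
  exists2 p, p \in nbrs x & p \in Plist /\ cl3 p = w (cl3 x.1).
Proof.
move=> rx Ww E; have [Px kx kyx] := keyed_rep rx; have [gx lx _ _] := Plist_sound Px.
have [q oq wq] := word_orbp gx Ww; have gq := gen3_orbp gx oq.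
have lq : lab3 q = lab3 x.1.
  by rewrite -(cl3_lab3 gq) -(cl3_lab3 gx) -wq; exact: (congr1 fst E).
have lmq : labmin (lab3 q) by rewrite lq.
have [Pn En kn] := labmin_key gq lmq.
exists (nform q); last by split; [exact: Pn | rewrite En].
apply: map_f; rewrite mem_filter oq andbT.
have -> : lab3 q = x.2.1 by rewrite lq kx.
case: (eqmP x.2.1 x.2.1) => [_|n]; last by case: n.
apply/eqbsP.
by rewrite kyx -E wq kn.
Qed.

Lemma nbrsP' x p : x \in kreps keyed -> p \in nbrs x ->
  exists2 w, w \in WY & [/\ cl3 p = w (cl3 x.1), p \in Plist & keyY (cl3 p) = keyY (cl3 x.1)].
Proof.
move=> rx /mapP[q]; rewrite mem_filter => /andP[+ oq] ->.
have [Px kx kyx] := keyed_rep rx; have [gx lx _ _] := Plist_sound Px.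
have gq := gen3_orbp gx oq; have [w Ww wq] := orbp_word gx oq.
case: (eqmP (lab3 q) x.2.1) => [lq /eqbsP bq | _]; last by move=> F; discriminate F.
have lmq : labmin (lab3 q) by rewrite lq kx.
have [Pn En kn] := labmin_key gq lmq.
exists w; first exact: Ww.
split; [by rewrite En | exact: Pn |].
rewrite En kn /key3 bq -kyx; have [_ _ ->] := nform_cl3 gq (labmin_reg gq lmq); rewrite lq; exact/esym/surjective_pairing.
Qed.

Lemma reps_type x : x \in kreps keyed -> block_type WY keyY (cl3 x.1) (code3 keyed x).
Proof.
move=> rx; have [_ _ codeP _ _] := final; have := codeP _ rx.
have [Px kx kyx] := keyed_rep rx; have [_ _ _ nx] := Plist_sound Px.
rewrite /code_ok /code3; case: (@idP (all (eqp x.1) (nbrs x))) => [/allP all1 _ | _].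
  split; first exact: reps_block.
  by move=> w Ww /(nbrsP rx Ww)[p /all1/eqpP<- [_ <-]].
case: (@idP (odd (kcount keyed x.2))) => [_ F | /negP oddm /hasP[p np]]; first discriminate F.
case: (eqpP x.1 p) => [_ F | nxp /allP nb]; first discriminate F.
split; first by rewrite (reps_block rx) -[LHS]odd_double_half (negbTE oddm).
have [w Ww [pw Pp kp]] := nbrsP' rx np; exists w; first exact: Ww.
rewrite -pw; split=> [||v Wv]; first exact: kp.
  apply/eqP => E; case: nxp; have [gp _ rp <-] := Plist_sound Pp.
  by rewrite -nx; have [gx _ _ _] := Plist_sound Px; apply: nform_eq gp gx rp E.
move=> /(nbrsP rx Wv)[z nz [_ <-]]; have := nb _ nz.
by case: (eqpP x.1 z) => [<-|_ /eqpP<-]; [left | right].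
Qed.

Lemma model_prod : prodof wreath [seq code3 keyed x | x <- kreps keyed]
  (symgroup tthY tdeY ttaY labY).
Proof.
(* Codes belong to computed keys and have to be read on classes; the default [x0] is never reached
   on [reps]. *)
pose x0 := (P0, (one3, [::] : seq bool)).
pose code y := code3 keyed (nth x0 (kreps keyed) (index y reps)).
have codeE x : x \in kreps keyed -> code (cl3 x.1) = code3 keyed x.
  move=> rx; exact: (congr1 (code3 keyed) (nth_index_map_in x0 reps_uniq rx)).
rewrite (map_factor codeE) -/reps.
rewrite (symset_lperm tthK tdeK ttaYK tbraid tta_tth tta_tde).
have labL y z : labY3 y = labY3 z -> labY y = labY z by case.
(* Preserving the first label while commuting with [tthY] and [tdeY] already preserves the whole
   triple. *)
have LK t y : t \in lperm WY labY -> labY3 (t y) = labY3 y.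
  rewrite -[lperm _ _]/(gval (lpermg WY labY)) -(symset_lperm tthK tdeK ttaYK tbraid tta_tth tta_tde).
  move=> /symsetP tP; have [t1 t2 _ l0] := tP y; have [_ _ _ l1] := tP (tthY y).
  by have [_ _ _ l2] := tP (tdeY y); rewrite /labY3 l0 -t1 -t2 l1 l2.
have k1 := orbkey_lab (th := tthY) (de := tdeY) (ta := ttaY) labL.
have k2 := orbkey_orb tbraid tta_tth tta_tde labY3_th labY3_de labY3_ta.
have k3 := orbkey_lperm tbraid tta_tth tta_tde LK.
have k4 := orbkey_stab tbraid tta_tth tta_tde.
have typ : {in reps, forall y, block_type WY keyY y (code y)}.
  move=> _ /mapP[x rx ->]; rewrite (codeE _ rx); exact: reps_type rx.
exact (lperm_prod k1 (k2 _ _ _) k3 (k4 _ _ _ _ _) reps_uniq typ reps_inj reps_cover).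
Qed.

End Model.

Lemma card_setXg (aT bT : finGroupType) (A : {group aT}) (B : {group bT}) :
  #|(A \X B)%G| = (#|A| * #|B|)%N.
Proof. exact: cardsX. Qed.

Local Open Scope Group_scope.

Theorem theorem5p3 :
  exists (aT bT cT : finGroupType)
         (A : {group aT}) (B : {group bT}) (C : {group cT}),
    [/\ form_sdprod
          (form_sdprod
            (form_sdprod
              (form_of (Cyc 2 \X Cyc 2 \X Cyc 2 \X Cyc 2 \X Cyc 2)) 'Alt_('I_6))
            (Cyc 2))
          (Cyc 2) aT A,
        form_sdprod
          (form_sdprod
            (form_sdprod
              (form_sdprod (form_of (Cyc 2 \X 'D_8)) (Cyc 2))
              (Cyc 3))
            (Cyc 2))
          (Cyc 2) bT B,
        form_sdprod
          (form_sdprod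
            (form_of (Cyc 2 \X Cyc 2 \X Cyc 2 \X Cyc 2)) 'Alt_('I_5))
          (Cyc 2) cT C
      & GT1 (PSL 3 'F_3)
        \isog (Cyc 2 ^X 26 \X 'D_8 ^X 6 \X 'Sym_('I_3) ^X 4
                 \X 'Sym_('I_4) ^X 21 \X 'Sym_('I_6) ^X 12 \X 'Sym_('I_7) ^X 6
                 \X 'Sym_('I_8) ^X 3 \X 'Sym_('I_9) ^X 11
                 \X A ^X 3 \X B ^X 8 \X C ^X 5)%G].
Proof.
have e2 := abelem_Cyc2; have ord_neq n : (ord0 : 'I_n.+2) != ord_max by [].
exists _, _, _, (hyp 6), (hyp 4), (even_hyp 5); split.
- have [L [dE iL _]] := even_hyp_sdprod (ord0 : 'I_6); exists (even_hyp 6), L; split=> //.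
  apply: (even_hyp_form (ord_neq 4)); first by do 4! apply: abelem2_setX => //.
  by rewrite !card_setXg card_Cyc2.
- exact: hyp4_form.
- apply: (even_hyp_form (ord_neq 3)); first by do 3! apply: abelem2_setX => //.
  by rewrite !card_setXg card_Cyc2.
apply: isog_trans (model_isog toGM toG_inj toGP) _.
have [_ _ _ targetP _] := final.
have mod := prodof_flatten _ (model_prod toGM toG_inj toGP).
(* A code outside the expected ones would contribute 0, which does not occur in [target]. *)
have f0 : 0%N \notin flatten (map facs [seq code3 keyed x | x <- kreps keyed]).
  by rewrite -map_comp (perm_mem targetP).
have := mod f0; rewrite -map_comp => /(prodof_perm targetP) mod'.
apply: prodof_uniq mod' _.
have X n c := @prodof_setXn _ (any_type \o factor) facgroup n c.
have := prodof_setX (prodof_setX (prodof_setX (prodof_setX (prodof_setX (prodof_setX (prodof_setX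
  (prodof_setX (prodof_setX (prodof_setX (X 26 2) (X 6 22)) (X 4 3)) (X 21 4)) (X 12 6)) (X 6 7))
  (X 3 8)) (X 11 9)) (X 3 26)) (X 8 24)) (X 5 25).
exact.
Qed.
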